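(* Let $k\ge 1$ and let $\mu$ be a $(k+1)$-core which splits into components $\mu_1,\dots,\mu_r$ (each $\mu_i$ a $(k+1)$-core). Then $$s_\mu^{(k)}=\prod_{i=1}^r s_{\mu_i}^{(k)} .$$
   Context: Partitions are identified with their Ferrers diagrams. Fix an integer $k\ge1$. A $k$-bounded partition is a partition all of whose parts are $\le k$. A $(k+1)$-core is a partition with no box of hook length $k+1$. The $k$-boundary $\partial_k(\mu)$ of a partition $\mu$ is the skew shape obtained from $\mu$ by removing all boxes with hook length $>k$. For a $(k+1)$-core $\mu$ let $\mathfrak p(\mu)$ be the $k$-bounded partition whose $i$-th part is the number of boxes of $\partial_k(\mu)$ in row $i$; $\mathfrak p$ is a bijection from $(k+1)$-cores to $k$-bounded partitions, with inverse denoted $\mathfrak c$. The $k$-conjugate of a $k$-bounded partition $\lambda$ is $\lambda^{(k)}:=\mathfrak p(\mathfrak c(\lambda)')$, where $'$ is the usual conjugate (transpose). $k$-Schur functions: let $\Lambda^{(k)}=\mathbb Z[h_1,\dots,h_k]$ be the subring of symmetric functions generated by the complete homogeneous functions $h_1,\dots,h_k$. (Equivalently, it is the commutative subalgebra of the affine nil-Coxeter algebra generated by the sums $h_i=\sum_{|A|=i}d_A$ of cyclically decreasing elements.) The $k$-Schur functions $s^{(k)}_\lambda$, indexed by $k$-bounded partitions $\lambda$, are the elements of $\Lambda^{(k)}$ determined by $s^{(k)}_\emptyset=1$ and the $k$-Pieri rule: for $1\le l\le k$, $$h_l\, s^{(k)}_\mu=\sum_\nu s^{(k)}_\nu,$$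 the sum over $k$-bounded partitions $\nu\supset\mu$ with $|\nu|=|\mu|+l$ such that $\nu\setminus\mu$ is a horizontal strip (at most one box in each column) and $\nu^{(k)}\setminus\mu^{(k)}$ is a vertical strip (at most one box in each row). For a $(k+1)$-core $\mu$, write $s_\mu^{(k)}:=s^{(k)}_{\mathfrak p(\mu)}$. Splitting: a skew shape is connected if any box can be reached from any other by a sequence of vertical and horizontal unit steps within the shape. A $(k+1)$-core $\mu$ splits if $\partial_k(\mu)$ is not connected. In that case each connected component of $\partial_k(\mu)$ is (up to translation) the $k$-boundary $\partial_k(\rho)$ of some $(k+1)$-core $\rho$; these cores (one for each connected component) are the components of $\mu$. *)

(* Defs.v *)
From HB Require Import structures.
From mathcomp Require Import all_boot all_order all_algebra.
From mathcomp Require Import boolp classical_sets functions cardinality fsbigop.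
From mathcomp Require Import mpoly.

Set Implicit Arguments.
Unset Strict Implicit.
Unset Printing Implicit Defensive.

Import GRing.Theory.

Local Open Scope classical_set_scope.
Local Open Scope ring_scope.

(* Setting the last of n.+1 variables to 0. *)
Definition trunc_mpoly n (p : {mpoly int[n.+1]}) : {mpoly int[n]} :=
  p \mPo [tuple if unlift ord_max i is Some j then 'X_j else 0 | i < n.+1].

(* Lambda is the inverse limit of the rings of symmetric polynomials in the
   category of graded rings: the degrees of the components are required to be
   uniformly bounded. *)
Record symfun := SymFun {
  sf_val :> forall n, {mpoly int[n]};
  sf_sym : forall n, sf_val n \is symmetric;
  sf_trunc : forall n, trunc_mpoly (sf_val n.+1) = sf_val n;
  sf_bound : exists d, forall n, (msize (sf_val n) <= d)%N
}.

Lemma symfunP (f g : symfun) : (forall n, f n = g n) -> f = g.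
Proof.
case: f g => [f fs ft fb] [g gs gt gb] /= fg.
have {}fg : f = g by apply: functional_extensionality_dep.
by rewrite {}fg in fs ft fb *; congr SymFun; exact: Prop_irrelevance.
Qed.

Lemma trunc_mpolyD n : {morph @trunc_mpoly n : p q / p + q}.
Proof. exact: comp_mpolyD. Qed.

Lemma trunc_mpolyN n : {morph @trunc_mpoly n : p / - p}.
Proof. exact: comp_mpolyN. Qed.

Lemma trunc_mpoly1 n : trunc_mpoly (1 : {mpoly int[n.+1]}) = 1.
Proof. exact: comp_mpoly1. Qed.

Lemma trunc_mpolyM n : {morph @trunc_mpoly n : p q / p * q}.
Proof. by move=> p q; rewrite /trunc_mpoly rmorphM. Qed.

Lemma sf_zero_bound : exists d, forall n, (msize (0 : {mpoly int[n]}) <= d)%N.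
Proof. by exists 0%N => n; rewrite msize0. Qed.

Lemma sf_one_bound : exists d, forall n, (msize (1 : {mpoly int[n]}) <= d)%N.
Proof. by exists 1%N => n; rewrite msize1. Qed.

Lemma sf_opp_bound (f : symfun) : exists d, forall n, (msize (- f n) <= d)%N.
Proof. by case: (sf_bound f) => d fd; exists d => n; rewrite msizeN. Qed.

Lemma sf_add_bound (f g : symfun) :
  exists d, forall n, (msize (f n + g n) <= d)%N.
Proof.
case: (sf_bound f) (sf_bound g) => [a fa] [b gb]; exists (maxn a b) => n.
apply: leq_trans (msizeD_le _ _) _; rewrite geq_max !leq_max.
by rewrite fa gb orbT.
Qed.

Lemma sf_mul_bound (f g : symfun) :
  exists d, forall n, (msize (f n * g n) <= d)%N.
Proof.
case: (sf_bound f) (sf_bound g) => [a fa] [b gb]; exists (a + b).+1 => n.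
by apply: leq_trans (msizeM_le _ _) _; rewrite ltnS leq_add.
Qed.

Definition sf_zero : symfun := @SymFun (fun=> 0)
  (fun=> rpred0 _) (fun=> comp_mpoly0 _) sf_zero_bound.

Definition sf_one : symfun := @SymFun (fun=> 1)
  (fun=> rpred1 _) (fun n => trunc_mpoly1 n) sf_one_bound.

Definition sf_opp (f : symfun) : symfun := @SymFun (fun n => - f n)
  (fun n => rpredNr (sf_sym f n))
  (fun n => etrans (trunc_mpolyN _) (congr1 -%R (sf_trunc f n)))
  (sf_opp_bound f).

Definition sf_add (f g : symfun) : symfun := @SymFun (fun n => f n + g n)
  (fun n => rpredD (sf_sym f n) (sf_sym g n))
  (fun n => etrans (trunc_mpolyD _ _)
              (congr2 +%R (sf_trunc f n) (sf_trunc g n)))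
  (sf_add_bound f g).

Definition sf_mul (f g : symfun) : symfun := @SymFun (fun n => f n * g n)
  (fun n => rpredM (sf_sym f n) (sf_sym g n))
  (fun n => etrans (trunc_mpolyM _ _)
              (congr2 *%R (sf_trunc f n) (sf_trunc g n)))
  (sf_mul_bound f g).

Lemma sf_addA : associative sf_add.
Proof. by move=> f g h; apply: symfunP => n; exact: addrA. Qed.

Lemma sf_addC : commutative sf_add.
Proof. by move=> f g; apply: symfunP => n; exact: addrC. Qed.

Lemma sf_add0 : left_id sf_zero sf_add.
Proof. by move=> f; apply: symfunP => n; exact: add0r. Qed.

Lemma sf_addN : left_inverse sf_zero sf_opp sf_add.
Proof. by move=> f; apply: symfunP => n; exact: addNr. Qed.

Lemma sf_mulA : associative sf_mul.
Proof. by move=> f g h; apply: symfunP => n; exact: mulrA. Qed.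

Lemma sf_mulC : commutative sf_mul.
Proof. by move=> f g; apply: symfunP => n; exact: mulrC. Qed.

Lemma sf_mul1 : left_id sf_one sf_mul.
Proof. by move=> f; apply: symfunP => n; exact: mul1r. Qed.

Lemma sf_mulDl : left_distributive sf_mul sf_add.
Proof. by move=> f g h; apply: symfunP => n; exact: mulrDl. Qed.

Lemma sf_one_neq0 : sf_one <> sf_zero.
Proof. by move/(congr1 (fun f : symfun => f 0%N))/eqP; rewrite oner_eq0. Qed.

HB.instance Definition _ := gen_eqMixin symfun.
HB.instance Definition _ := gen_choiceMixin symfun.
HB.instance Definition _ :=
  GRing.isZmodule.Build symfun sf_addA sf_addC sf_add0 sf_addN.

Lemma sf_oner_neq0 : sf_one != 0 :> symfun.
Proof. exact/eqP/sf_one_neq0. Qed.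

HB.instance Definition _ := GRing.Zmodule_isComNzRing.Build symfun
  sf_mulA sf_mulC sf_mul1 sf_mulDl sf_oner_neq0.

Definition hsym_mpoly l n : {mpoly int[n]} :=
  \sum_(m : 'X_{1..n < l.+1} | mdeg m == l) 'X_[m].

Lemma mcoeff_hsym l n (m : 'X_{1..n}) : (hsym_mpoly l n)@_m = (mdeg m == l)%:R.
Proof.
rewrite raddf_sum /=; have [dm|dm] := eqVneq (mdeg m) l; last first.
  rewrite big1 // => m' /eqP dm'; rewrite mcoeffX; case: eqP => // mm'.
  by rewrite -mm' dm' eqxx in dm.
have ltm : (mdeg m < l.+1)%N by rewrite dm.
rewrite (bigD1 (BMultinom ltm)) /= ?dm // mcoeffX eqxx big1 ?addr0 // => m'.
move=> /andP[_ nm]; rewrite mcoeffX; case: eqP => // mm'.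
by case/eqP: nm; apply: val_inj.
Qed.

Lemma mcoeff_trunc n (p : {mpoly int[n.+1]}) m :
  (trunc_mpoly p)@_m = p@_(mnmwiden m).
Proof.
rewrite /trunc_mpoly comp_mpolyEX [in RHS](mpolyE p) !raddf_sum /=.
apply: eq_bigr => m' _; rewrite !mcoeffZ; congr (_ * _).
rewrite comp_mpolyX big_ord_recr /= !tnth_mktuple unlift_none.
under eq_bigr => i _.
  have wE : widen_ord (leqnSn n) i = lift ord_max i.
    by apply: val_inj; rewrite /= /bump leqNgt ltn_ord.
  rewrite tnth_mktuple wE liftK -wE; over.
have -> : \prod_(i < n) 'X_i ^+ m' (widen_ord (leqnSn n) i)
    = 'X_[[multinom m' (widen_ord (leqnSn n) i) | i < n]] :> {mpoly int[n]}.
  by rewrite [RHS]mpolyXE_id; apply: eq_bigr => i _; rewrite mnmE.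
rewrite expr0n mcoeffX; case: (posnP (m' ord_max)) => m'0; last first.
  rewrite mulr0 mcoeff0; case: eqP => // mm'.
  by rewrite mm' mnmwiden_ordmax in m'0.
rewrite mulr1 mcoeffX; congr (_ : bool)%:R; apply/eqP/eqP => [<-|->].
  apply/mnmP => i; case: (unliftP ord_max i) => [j ->|->]; last first.
    by rewrite mnmwiden_ordmax.
  have -> : lift ord_max j = widen_ord (leqnSn n) j.
    by apply: val_inj; rewrite /= /bump leqNgt ltn_ord.
  by rewrite mnmwiden_widen mnmE.
by apply/mnmP => i; rewrite mnmE mnmwiden_widen.
Qed.

Lemma hsym_sym l n : hsym_mpoly l n \is symmetric.
Proof.
apply/issymP => s; apply/mpolyP => m.
by rewrite mcoeff_sym !mcoeff_hsym mdeg_mperm.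
Qed.

Lemma hsym_trunc l n : trunc_mpoly (hsym_mpoly l n.+1) = hsym_mpoly l n.
Proof.
apply/mpolyP => m; rewrite mcoeff_trunc !mcoeff_hsym; congr (_ == _)%:R.
rewrite !mdegE big_ord_recr /= mnmwiden_ordmax addn0.
by apply: eq_bigr => i _; rewrite mnmwiden_widen.
Qed.

Lemma hsym_bound l : exists d, forall n, (msize (hsym_mpoly l n) <= d)%N.
Proof.
exists l.+1 => n; apply: leq_trans (msize_sum _ _ _) _.
by apply/bigmax_leqP => m _; rewrite msizeX bmdeg.
Qed.

Definition hsym l : symfun :=
  SymFun (hsym_sym l) (hsym_trunc l) (hsym_bound l).

(* Z[h_1, ..., h_k] as the image of evaluation at the complete homogeneous
   symmetric functions; 'X_i is sent to h_(i+1). *)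
Definition Lambda_k k : set symfun :=
  range (fun P : {mpoly int[k]} =>
    mmap (intr : int -> symfun) (fun i : 'I_k => hsym i.+1) P).

(* A partition is the list of its positive parts in decreasing order. Its
   diagram is the set of boxes (i, j), with row i and column j counted from 0,
   such that j is smaller than the i-th part. *)
Definition box := (nat * nat)%type.

Definition is_part (la : seq nat) : bool := sorted geq la && (0%N \notin la).

Definition diagram (la : seq nat) : set box :=
  [set b | (b.2 < nth 0 la b.1)%N].

Definition conj_part (la : seq nat) : seq nat :=
  [seq count (fun p => j < p)%N la | j <- iota 0 (head 0%N la)].

Definition hook_length (la : seq nat) (b : box) : nat :=
  ((nth 0 la b.1 - b.2.+1) + (nth 0 (conj_part la) b.2 - b.1.+1) + 1)%N.

Definition is_core (n : nat) (mu : seq nat) : Prop :=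
  is_part mu /\ forall b, diagram mu b -> hook_length mu b <> n.

Definition boundary (k : nat) (mu : seq nat) : set box :=
  [set b | diagram mu b /\ (hook_length mu b <= k)%N].

Definition k_bounded (k : nat) (la : seq nat) : bool :=
  is_part la && all (fun p => p <= k)%N la.

Definition core_to_bounded (k : nat) (mu : seq nat) : seq nat :=
  [seq count (fun j => hook_length mu (i, j) <= k)%N (iota 0 (nth 0%N mu i))
     | i <- iota 0 (size mu)].

(* The inverse of the bijection core_to_bounded from (k+1)-cores to k-bounded
   partitions; the default value [::] is irrelevant on k-bounded partitions. *)
Definition bounded_to_core (k : nat) (la : seq nat) : seq nat :=
  xget [::] [set mu | is_core k.+1 mu /\ core_to_bounded k mu = la].

Definition k_conj (k : nat) (la : seq nat) : seq nat :=
  core_to_bounded k (conj_part (bounded_to_core k la)).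

(* A strip is in particular a skew shape, which includes containment. *)
Definition horizontal_strip (mu nu : seq nat) : Prop :=
  diagram mu `<=` diagram nu /\
  forall b c, (diagram nu `\` diagram mu) b -> (diagram nu `\` diagram mu) c ->
    b.2 = c.2 -> b = c.

Definition vertical_strip (mu nu : seq nat) : Prop :=
  diagram mu `<=` diagram nu /\
  forall b c, (diagram nu `\` diagram mu) b -> (diagram nu `\` diagram mu) c ->
    b.1 = c.1 -> b = c.

Definition pieri_set (k l : nat) (mu : seq nat) : set (seq nat) :=
  [set nu | [/\ k_bounded k nu, sumn nu = (sumn mu + l)%N,
                horizontal_strip mu nu &
                vertical_strip (k_conj k mu) (k_conj k nu)]].

(* \sum_(i \in A) is by convention 0 when the support is infinite; the Pieri
   sums are genuine finite sums. *)
Lemma finite_pieri_set k l mu : finite_set (pieri_set k l mu).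
Proof.
pose n := (sumn mu + l)%N.
pose f (t : n.-bseq 'I_n.+1) : seq nat := map val t.
apply: (@sub_finite_set _ _ (f @` setT)); last exact: finite_image.
move=> nu [/andP[/andP[_ nu0] _] snu _ _].
have lepart p : p \in nu -> (p < n.+1)%N.
  move=> pnu; rewrite ltnS /n -snu sumnE (big_rem p) //=; exact: leq_addr.
have size_nu : (size nu <= n)%N.
  rewrite /n -snu {lepart snu}; elim: nu nu0 => //= p nu IH.
  rewrite in_cons negb_or eq_sym -lt0n => /andP[p0 /IH]; exact: (leq_add p0).
have nuE : map val [seq inord p : 'I_n.+1 | p <- nu] = nu.
  by rewrite -map_comp map_id_in // => p /lepart ltp; rewrite /= inordK.
have szt : (size [seq inord p : 'I_n.+1 | p <- nu] <= n)%N by rewrite size_map.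
by exists (Bseq szt).
Qed.

(* s la is the k-Schur function of la for every k-bounded partition la; the
   values of s at other lists are unconstrained. *)
Definition is_kschur (k : nat) (s : seq nat -> symfun) : Prop :=
  [/\ forall la, k_bounded k la -> Lambda_k k (s la),
      s [::] = 1 &
      forall l mu, (1 <= l <= k)%N -> k_bounded k mu ->
        hsym l * s mu = \sum_(nu \in pieri_set k l mu) s nu].

Definition adjacent (b c : box) : bool :=
  ((b.1 == c.1) && ((b.2.+1 == c.2) || (c.2.+1 == b.2))) ||
  ((b.2 == c.2) && ((b.1.+1 == c.1) || (c.1.+1 == b.1))).

Definition joined (S : set box) (b c : box) : Prop :=
  exists p : seq box,
    [/\ path adjacent b p, last b p = c & forall x, x \in b :: p -> S x].

Definition connected_shape (S : set box) : Prop :=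
  forall b c, S b -> S c -> joined S b c.

Definition shape_components (S : set box) : set (set box) :=
  [set joined S b | b in S].

Definition splits (k : nat) (mu : seq nat) : Prop :=
  ~ connected_shape (boundary k mu).

Definition shift (v b : box) : box := (v.1 + b.1, v.2 + b.2)%N.

(* S and T differ by the translation of vector v - u, an arbitrary integer
   vector. *)
Definition translates (S T : set box) : Prop :=
  exists u v : box, shift v @` S = shift u @` T.

(* rho lists the components of mu, exactly one core for each connected
   component of the k-boundary of mu, in any order. *)
Definition core_components (k : nat) (mu : seq nat) (r : nat)
    (rho : 'I_r -> seq nat) : Prop :=
  exists C : 'I_r -> set box,
    [/\ injective C, range C = shape_components (boundary k mu) &
        forall i, is_core k.+1 (rho i) /\ translates (boundary k (rho i)) (C i)].

(* Main.v *)
Require Import Defs.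
From mathcomp Require Import all_boot all_order all_algebra.
From HB Require Import structures.
From mathcomp Require Import boolp classical_sets cardinality fsbigop.
From mathcomp Require Import mpoly.
From mathcomp Require Import zify ring.
Local Open Scope ring_scope.

(** Let n = k + 1. A core is recorded on the abacus by the first gap of each
    residue class modulo n, and the affine symmetric group acts on these
    vectors. The partitions in a k-Pieri sum are those obtained by reduced words
    listing a proper subset of Z/n cyclically, so that h_l acts by the sum of
    these ascending words of length l. A sign-reversing involution on pairs of
    an ascending and a descending word shows that e_l acts by descending words,
    that is, the functions s_(la^(k)) satisfy the Pieri rule for the e_l.

    The Pieri rules are triangular for the weight \sum_i (i - 1) la_i: modulo
    partitions of smaller weight and no greater length, s_la is h_la. Let mu be
    obtained by stacking rho1, moved to the right, on top of rho2. By
    triangularity every core ga in s_rho1 s_rho2 satisfies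
    ga_(r + a) <= (rho2)_r, where a is the number of rows of rho1; the dual rule
    bounds the columns of ga by those of rho1 in the same way. Hence ga is
    contained in mu. Containment of cores is the strong Bruhat order, which is
    graded by the size of the k-bounded partition, so that ga = mu, and its
    coefficient is 1 by triangularity. The s_la are linearly independent because
    e_1, ..., e_k are algebraically independent in k variables. *)

Set Implicit Arguments.
Unset Strict Implicit.
Unset Printing Implicit Defensive.
Import Order.TTheory GRing.Theory Num.Theory.

(** * Abacus and reflections *)

Section Abacus.
Variable k : nat.
(* The k of the theorem is k.+1 here, and cores are n-cores. *)
Local Notation n := k.+2.

(** The obstacle is the bound on columns. The Pieri rule controls rows only, and the defining
    properties of the s_la offer no symmetry of the ring that would exchange rows and columns. The
    Pieri rule for the family s_(la^(k)) takes the place of such a symmetry: the row bound for this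
    family is the column bound for the original one. The same family gives linear independence,
    because it is triangular with respect to products of the e_l, to which the fundamental theorem
    on symmetric polynomials applies.

    The shift by a arises as follows. Multiplying by one h_l makes row r + 1 of the new core at most
    row r of the old one, and s_rho1 is a combination of products of at most a factors.

    The two bounds come from two different expansions of one product. By linear independence a term
    of the first expansion other than s_mu would have to occur in the second; it would then be
    contained in mu, hence equal to mu, although its weight is smaller. *)

Definition cong (x y : int) : bool := (n %| x - y)%Z.

Lemma congP x y : reflect (exists q : int, x = y + q * n%:Z) (cong x y).
Proof.
apply: (iffP dvdzP) => [[q e]|[q ->]]; exists q; last by rewrite addrC addKr.
by rewrite -e addrCA subrr addr0.
Qed.

Lemma congxx x : cong x x.
Proof. by rewrite /cong subrr dvdz0. Qed.

Lemma congC x y : cong x y = cong y x.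
Proof. by rewrite /cong -opprB rpredN. Qed.

Lemma cong_trans y x z : cong x y -> cong y z -> cong x z.
Proof. by rewrite /cong => xy yz; rewrite -[x](subrK y) -addrA rpredD. Qed.

Lemma congl x y z : cong x y -> cong x z = cong y z.
Proof.
move=> xy; apply/idP/idP; last exact: cong_trans.
by apply: cong_trans; rewrite congC.
Qed.

Lemma congr x y z : cong x y -> cong z x = cong z y.
Proof. by move=> xy; rewrite !(congC z); apply: congl. Qed.

Lemma cong_addr x y z t : x + t = y + z -> cong x y = cong z t.
Proof. by move=> e; rewrite /cong; congr (_ %| _)%Z; lia. Qed.

Lemma congDr x y z : cong (x + z) (y + z) = cong x y.
Proof. by apply: cong_addr; lia. Qed.

Lemma cong_small x y : cong x y -> x - y < n%:Z -> y - x < n%:Z -> x = y.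
Proof.
move=> /congP[q ->]; rewrite addrAC subrr add0r opprD addrA subrr add0r.
move=> h1 h2; suff -> : q = 0 by rewrite mul0r addr0.
case: (ltrgt0P q) => // q0; exfalso.
  have : 1 * n%:Z <= q * n%:Z by rewrite ler_pM2r; lia.
  lia.
have : q * n%:Z <= (-1) * n%:Z by rewrite ler_pM2r; lia.
lia.
Qed.

Lemma cong_lt x y : cong x y -> x < y -> x + n%:Z <= y.
Proof.
move=> c lt; case: (leP (x + n%:Z) y) => // h.
by have := cong_small c; lia.
Qed.

(** The integer n is at least 2, so it does not divide 1. This is why the classes c and c + 1 moved
    by a reflection are different. *)
Lemma cong_lt1 (d x y : int) : cong (x + d) (y + d - 1) -> cong x y -> False.
Proof.
rewrite /cong => h1 h2; have := rpredB h2 h1.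
rewrite (_ : x - y - _ = -1); last by lia.
by rewrite rpredN dvdz1; lia.
Qed.

Lemma ncongS x y : cong x y -> cong x (y + 1) = false.
Proof.
move=> h; apply/negP => h1; apply: (@cong_lt1 0 y (y + 1)).
  by rewrite addr0 addr0 addrK congxx.
by rewrite -(congl _ h).
Qed.

Lemma ncongS' x y : cong x (y + 1) -> cong x y = false.
Proof. by move=> h; apply/negP => /ncongS; rewrite h. Qed.

(** The number of positive multiples of n that are at most x. At x = T i - z - 1 it counts the beads
    T i - n, T i - 2n, ... above z. *)
Definition pd (x : int) : nat := if x is Posz m then (m %/ n)%N else 0%N.

Lemma pd_neg x : x < n%:Z -> pd x = 0%N.
Proof. by case: x => // m; rewrite ltz_nat => h; rewrite /= divn_small. Qed.

Lemma pd_shift x : pd (x + n%:Z) = (pd x + (0%R <= x)%R)%N.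
Proof.
case: (leP 0 x) => x0; last by rewrite pd_neg ?addn0; [case: x x0|lia].
case: x x0 => // m _; rewrite -PoszD /= divnDr ?dvdnn // divnn //.
Qed.

Lemma pd_pred x : pd x = (pd (x - 1) + (cong x 0 && (0%R < x)%R))%N.
Proof.
case: (leP x 0) => [x0|]; first by rewrite andbF addn0 !pd_neg; lia.
case: x => // -[|m] // _.
rewrite andbT -addn1 PoszD addrK /cong subr0 -PoszD addn1 /=.
rewrite divnS // addnC; congr addn.
Qed.

Lemma pd_ncong x : ~~ cong x 0 -> pd x = pd (x - 1).
Proof. by move=> /negbTE h; rewrite pd_pred h addn0. Qed.

Definition distinct (T : 'I_n -> int) := forall i j, cong (T i) (T j) -> i = j.

(* The second condition says that the abacus has charge 0. *)
Definition valid (T : 'I_n -> int) :=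
  distinct T /\ \sum_i T i = \sum_(i < n) (i : nat)%:Z.

Definition residue (x : int) : 'I_n := inord `|(x %% n%:Z)%Z|%N.

Lemma residueE x : (residue x : int) = (x %% n)%Z.
Proof.
have h0 : 0 <= (x %% n)%Z by rewrite modz_ge0.
have h1 : (x %% n)%Z < n by rewrite ltz_pmod.
by rewrite /residue inordK; lia.
Qed.

Lemma eq_residue x y : (residue x == residue y) = cong x y.
Proof.
rewrite /cong -eqz_mod_dvd; apply/eqP/eqP => [/(congr1 (fun i : 'I_n => (i : int)))|h].
  by rewrite !residueE.
by apply: val_inj; apply/eqP; rewrite -eqz_nat !residueE h.
Qed.

Lemma distinct_onto T c : distinct T -> exists i, cong (T i) c.
Proof.
move=> inj; have injr : injective (fun i => residue (T i)).
  by move=> i j /eqP; rewrite eq_residue; apply: inj.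
have /codomP[i e] := inj_card_onto injr (leqnn _) (residue c).
by exists i; rewrite -eq_residue -e.
Qed.

Lemma cong_residue x : cong (residue x : int) x.
Proof. by rewrite residueE /cong -eqz_mod_dvd modz_mod. Qed.

Lemma residue_ord (i : 'I_n) : residue (i : nat)%:Z = i.
Proof. by apply: val_inj; rewrite /= /residue modz_small ?inordK //; have := ltn_ord i; lia. Qed.

Lemma sum_residues (T : 'I_n -> int) : distinct T ->
  \sum_i (T i %% n)%Z = \sum_(i < n) (i : nat)%:Z.
Proof.
move=> inj; have injr : injective (fun i => residue (T i)).
  by move=> i j /eqP; rewrite eq_residue; apply: inj.
rewrite [RHS](reindex_inj injr) /=.
by apply: eq_bigr => i _; rewrite residueE.
Qed.

(** The simple reflection of the affine symmetric group that exchanges the neighbouring positions of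
    classes c and c + 1. *)
Definition refl (c z : int) : int :=
  if cong z c then z + 1 else if cong z (c + 1) then z - 1 else z.

Lemma reflK c : involutive (refl c).
Proof.
move=> x; rewrite /refl; case: (boolP (cong x c)) => h.
  rewrite (congl _ (_ : cong (x + 1) (c + 1))) ?congDr //.
  by rewrite congC ncongS ?congDr ?h ?congxx // addrK.
case: (boolP (cong x (c + 1))) => h'; last by rewrite (negbTE h) (negbTE h').
have -> : cong (x - 1) c by rewrite (@cong_addr _ _ x (c + 1)) //; lia.
by rewrite subrK.
Qed.

Lemma refl_cong c z t : cong (refl c z) (refl c t) = cong z t.
Proof.
have step (x y : int) : cong x y -> cong (refl c x) (refl c y).
  move=> xy; rewrite /refl -!(congl _ xy).
  by case: ifP => _; [rewrite congDr|case: ifP => _ //; rewrite congDr].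
by apply/idP/idP; [move/step; rewrite !reflK|apply: step].
Qed.

(* T lists the first gap of each of the n residue classes of an abacus: the
   beads congruent to T i are T i - n, T i - 2n, and so on. This counts the
   beads larger than z. *)
Definition beads (T : 'I_n -> int) (z : int) : nat := \sum_i pd (T i - z - 1).

Lemma refl_distinct c T : distinct T -> distinct (refl c \o T).
Proof. by move=> inj i j; rewrite /= refl_cong; apply: inj. Qed.

Lemma refl_labels c T : distinct T -> exists i j,
  [/\ i != j, cong (T i) c, cong (T j) (c + 1) &
   forall q, q != i -> q != j -> ~~ cong (T q) c && ~~ cong (T q) (c + 1)].
Proof.
move=> inj; have [i ic] := distinct_onto c inj.
have [j jc] := distinct_onto (c + 1) inj; exists i, j; split => //.
  apply/eqP => ij; move: jc; rewrite -ij; apply/negP.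
  by rewrite (ncongS ic).
by move=> q qi qj; apply/andP; split; apply/negP => h;
  [case/eqP: qi|case/eqP: qj]; apply: inj;
  rewrite (congl _ h) congC.
Qed.

(** The common remainder s replaces a subtraction, so that the lemma serves sums in [nat] as well as
    in [int]. *)
Lemma big_labels (V : nmodType) (F G : 'I_n -> V) (i j : 'I_n) : i != j ->
  (forall q, q != i -> q != j -> F q = G q) ->
  exists s, \sum_q F q = F i + (F j + s) /\ \sum_q G q = G i + (G j + s).
Proof.
move=> ij FG; exists (\sum_(q | (q != i) && (q != j)) F q).
split; rewrite (bigD1 i) //= (bigD1 j) ?(eq_sym j) //=; congr (_ + (_ + _)).
by apply: eq_bigr => q /andP[]; symmetry; apply: FG.
Qed.

Lemma refl_valid c T : valid T -> valid (refl c \o T).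
Proof.
case=> inj sumT; split; first exact: refl_distinct.
have [i [j [ij ic jc other]]] := refl_labels c inj.
have [] := @big_labels int (refl c \o T) T i j ij.
  by move=> q qi qj; have /andP[/negbTE h1 /negbTE h2] := other q qi qj; rewrite /= /refl h1 h2.
move=> s [-> e]; rewrite -sumT e /= /refl ic jc.
by rewrite (ncongS' jc); lia.
Qed.

(** Beads move only between a position of class c and the next one, so the count changes only at
    cuts just above a position of class c. *)
Lemma beads_refl_eq c z T : valid T -> ~~ cong z c ->
  beads (refl c \o T) z = beads T z.
Proof.
case=> inj _ zc; apply: eq_bigr => q _; rewrite /= /refl.
case: (boolP (cong (T q) c)) => [h|_].
  rewrite (_ : T q + 1 - z - 1 = T q - z); last by lia.
  rewrite pd_ncong //.
  rewrite (@cong_addr _ _ (T q) z); last by lia.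
  by rewrite (congl _ h) congC.
case: (boolP (cong (T q) (c + 1))) => // h.
rewrite [RHS]pd_ncong; first by congr pd; lia.
by rewrite (@cong_addr _ _ (T q) (z + 1)) ?(congl _ h) ?congDr 1?congC //; lia.
Qed.

(** A bead at z (the case z < T i) moves above the cut, and a bead at z + 1 (the case z + 1 < T j)
    moves below it. *)
Lemma beads_refl c z T i j : valid T -> cong (T i) c -> cong (T j) (c + 1) ->
  cong z c ->
  (beads (refl c \o T) z + (z + 1 < T j)%R = beads T z + (z < T i)%R)%N.
Proof.
case=> inj _ ic jc zc; have ij : i != j.
  by apply/eqP => ij; move: jc; rewrite -ij (ncongS ic).
have [] := @big_labels nat (fun q => pd (refl c (T q) - z - 1)) (fun q => pd (T q - z - 1)) i j ij.
  move=> q qi qj; rewrite /refl; case: ifP => [h|_].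
    by case/eqP: qi; apply: inj; rewrite (congl _ h) congC.
  by case: ifP => // h; case/eqP: qj; apply: inj; rewrite (congl _ h) congC.
move=> s []; rewrite /beads /= => -> ->; rewrite /refl ic (ncongS' jc) jc.
rewrite (_ : T i + 1 - z - 1 = T i - z); last by lia.
rewrite (pd_pred (T i - z)) (pd_pred (T j - z - 1)).
rewrite (_ : cong (T i - z) 0); last first.
  by rewrite (@cong_addr _ _ (T i) z) ?(congl _ ic) 1?congC //; lia.
rewrite (_ : cong (T j - z - 1) 0); last first.
  by rewrite (@cong_addr _ _ (T j) (z + 1)) ?(congl _ jc) ?congDr 1?congC //; lia.
rewrite !andTb !subr_gt0 (_ : T j - 1 - z - 1 = T j - z - 1 - 1); last by lia.
rewrite (_ : (1 < T j - z) = (z + 1 < T j)); last by lia.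
by rewrite -!plusE; lia.
Qed.

Lemma beads_pred z T i : valid T -> cong (T i) z ->
  beads T (z - 1) = (beads T z + (z < T i)%R)%N.
Proof.
case=> inj _ iz; rewrite /beads (bigD1 i) //= [in RHS](bigD1 i) //=.
rewrite (_ : T i - (z - 1) - 1 = T i - z); last by lia.
rewrite pd_pred (_ : cong (T i - z) 0); last first.
  by rewrite (@cong_addr _ _ (T i) z) //; lia.
rewrite subr_gt0 andTb -!addnA; congr addn; rewrite addnC; congr addn.
apply: eq_bigr => q qi; rewrite (_ : T q - (z - 1) - 1 = T q - z); last by lia.
rewrite pd_ncong //; apply/negP.
rewrite (@cong_addr _ _ (T q) z); last by lia.
by move=> h; case/eqP: qi; apply: inj; rewrite (congl _ h) congC.
Qed.

Lemma beads_le1 z T : valid T -> (beads T z <= beads T (z + 1) + 1)%N.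
Proof.
move=> vT; have [i iz] := distinct_onto (z + 1) vT.1.
have := beads_pred vT iz; by rewrite addrK => ->; case: (z + 1 < T i); rewrite ?addn0 ?leq_addr.
Qed.

Lemma beads_self T i : valid T -> beads T (T i - 1) = beads T (T i).
Proof. by move=> vT; rewrite (beads_pred vT (congxx _)) ltxx addn0. Qed.

(** The length of the affine Grassmannian element encoded by the abacus. For increasing T it is the
    size of the bounded partition, by [sumn_bounded_rep]. *)
Definition inv (T : 'I_n -> int) : nat := \sum_i beads T (T i).

Lemma inv_parts c T i j : valid T -> cong (T i) c -> cong (T j) (c + 1) ->
  [/\ (beads (refl c \o T) (refl c (T i)) + (T i + 1 < T j)%R = beads T (T i))%N,
    (beads (refl c \o T) (refl c (T j)) = beads T (T j) + (T j < T i)%R)%N &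
    forall q, q != i -> q != j -> beads (refl c \o T) (refl c (T q)) = beads T (T q)].
Proof.
move=> vT ic jc; have [inj _] := vT.
have j1c : cong (T j - 1) c by rewrite (@cong_addr _ _ (T j) (c + 1)) //; lia.
have i1c : cong (T i + 1) (c + 1) by rewrite congDr.
split.
- rewrite /refl ic beads_refl_eq //; last by rewrite ncongS' // i1c.
  have := @beads_pred (T i + 1) T j vT; rewrite addrK => <- //.
  by rewrite (congl _ jc) congC.
- rewrite /refl jc (ncongS' jc).
  have := beads_refl vT ic jc j1c; rewrite subrK ltxx addn0 => ->.
  rewrite beads_self //; congr (_ + nat_of_bool _)%N; apply/idP/idP => h; last by lia.
  rewrite lt_neqAle; apply/andP; split; last by lia.
  by apply/eqP => e; move: jc; rewrite e (ncongS ic).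
move=> q qi qj; have nc : ~~ cong (T q) c.
  by apply/negP => h; case/eqP: qi; apply: inj; rewrite (congl _ h) congC.
rewrite {2}/refl (negbTE nc) ifN ?beads_refl_eq //.
by apply/negP => h; case/eqP: qj; apply: inj; rewrite (congl _ h) congC.
Qed.

(** In the remaining case T j = T i + 1 the reflection only exchanges two labels; the abacus and
    [inv] stay the same. *)
Lemma inv_refl c T i j : valid T -> cong (T i) c -> cong (T j) (c + 1) ->
  (inv (refl c \o T) + (T i + 1 < T j)%R = inv T + (T j < T i)%R)%N.
Proof.
move=> vT ic jc; have [e1 e2 e3] := inv_parts vT ic jc.
have ij : i != j by apply/eqP => ij; move: jc; rewrite -ij (ncongS ic).
have [s [E1 E2]] := @big_labels nat _ _ i j ij e3.
rewrite /inv /= E1 E2 e2 -e1 -!plusE; lia.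
Qed.

Lemma inv_refl_le c T : valid T -> (inv (refl c \o T) <= (inv T).+1)%N.
Proof.
move=> vT; have [i [j [_ ic jc _]]] := refl_labels c vT.1.
have := inv_refl vT ic jc; case: (_ < _); case: (_ < _); lia.
Qed.

Lemma inv_refl_up c T i j : valid T -> cong (T i) c -> cong (T j) (c + 1) ->
  inv (refl c \o T) = (inv T).+1 -> T j < T i.
Proof. by move=> vT ic jc e; have := inv_refl vT ic jc; rewrite e; lia. Qed.

End Abacus.

(** * Ascending words *)

Section Words.
Variable k : nat.
Local Notation n := k.+2.
Local Notation cong := (cong k).
Local Notation refl := (refl k).
Implicit Types (w : seq int) (T : 'I_n -> int) (A : {set 'I_n}).

Definition act w (z : int) : int := foldl (fun z c => refl c z) z w.

Lemma act_cat w1 w2 z : act (w1 ++ w2) z = act w2 (act w1 z).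
Proof. exact: foldl_cat. Qed.

Lemma act_rcons w c z : act (rcons w c) z = refl c (act w z).
Proof. exact: foldl_rcons. Qed.

Lemma act_valid w T : valid T -> valid (act w \o T).
Proof.
by elim: w T => [|c w IH] T vT //=; apply: (IH (refl c \o T)); apply: refl_valid.
Qed.

Lemma inv_act_le w T : valid T -> (inv (act w \o T) <= inv T + size w)%N.
Proof.
elim: w T => [|c w IH] T vT /=; first by rewrite addn0.
apply: leq_trans (IH (refl c \o T) _) _; first exact: refl_valid.
by rewrite addnS -addSn leq_add2r inv_refl_le.
Qed.

(** Reduced relative to the abacus T: every letter has to raise [inv], and a letter that moves no
    bead already spoils the word. *)
Definition reduced w T : bool := inv (act w \o T) == (inv T + size w)%N.

Lemma reduced_cat w1 w2 T : valid T ->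
  reduced (w1 ++ w2) T = reduced w1 T && reduced w2 (act w1 \o T).
Proof.
move=> vT; have h1 := inv_act_le w1 vT.
have h2 := inv_act_le w2 (act_valid w1 vT).
rewrite /reduced size_cat.
have -> : inv (act (w1 ++ w2) \o T) = inv (act w2 \o (act w1 \o T)).
  by apply: eq_bigr => i _; rewrite /= act_cat; apply: eq_bigr => j _; rewrite /= act_cat.
by apply/eqP/andP => [e|[/eqP e1 /eqP e2]]; [split; apply/eqP|]; lia.
Qed.

Lemma reduced_rcons w c T : valid T -> reduced (rcons w c) T ->
  reduced w T /\ exists i j, [/\ cong (act w (T i)) c, cong (act w (T j)) (c + 1)
    & act w (T j) < act w (T i)].
Proof.
move=> vT; rewrite -cats1 reduced_cat // => /andP[-> /eqP /= e]; split=> //.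
have vT' := act_valid w vT.
have [i [j [_ ic jc _]]] := refl_labels c vT'.1.
exists i, j; split=> //; apply: (inv_refl_up vT' ic jc).
by rewrite addn1 in e; rewrite -e.
Qed.

Definition increasing T := forall i j : 'I_n, (i < j)%N -> T i < T j.

(** Entries move by 1, which could at worst create a tie, and distinct classes forbid ties. The only
    pair whose order could be exchanged has T j = T i + 1, which T j < T i excludes. *)
Lemma refl_increasing c T i j : distinct T -> increasing T ->
  cong (T i) c -> cong (T j) (c + 1) -> T j < T i -> increasing (refl c \o T).
Proof.
move=> inj incT ic jc ji p q pq; have Tpq := incT _ _ pq.
rewrite /= /refl; case: (boolP (cong (T p) c)) => pc.
  have -> : cong (T q) c = false.
    apply/negP => qc; have e : p = q by apply: inj; rewrite (congl _ pc) congC.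
    by rewrite e ltnn in pq.
  have pi : p = i by apply: inj; rewrite (congl _ pc) congC.
  have -> : cong (T q) (c + 1) = false.
    apply/negP => qc; have e : q = j by apply: inj; rewrite (congl _ qc) congC.
    by move: Tpq; rewrite e pi; lia.
  rewrite lt_neqAle; apply/andP; split; last by lia.
  apply/eqP => e; have e' : j = q.
    by apply: inj; rewrite -e (congl _ jc) congC congDr.
  by move: Tpq; rewrite pi -e'; lia.
case: (boolP (cong (T q) c)) => qc; first by case: ifP => _; lia.
case: (boolP (cong (T q) (c + 1))) => qc1; last by case: ifP => _; lia.
have qj : q = j by apply: inj; rewrite (congl _ qc1) congC.
have -> : cong (T p) (c + 1) = false.
  apply/negP => pc1; have e : p = q by apply: inj; rewrite (congl _ pc1) congC.
  by rewrite e ltnn in pq.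
rewrite lt_neqAle; apply/andP; split; last by lia.
apply/eqP => e; move: pc; rewrite e (@cong_addr _ _ _ (T q) (c + 1)) ?qc1 //; lia.
Qed.

Lemma act_increasing w T : valid T -> increasing T -> reduced w T ->
  increasing (act w \o T).
Proof.
move=> vT incT; elim/last_ind: w => [|w c IH] //.
case/(reduced_rcons vT) => /IH incw [i [j [ic jc ji]]] p q pq.
have := refl_increasing (act_valid w vT).1 incw ic jc ji pq.
by rewrite /= !act_rcons.
Qed.

Definition mem_class w (z : int) : bool := has (cong z) w.

Lemma mem_class_cong w z t : cong z t -> mem_class w z = mem_class w t.
Proof. by move=> zt; apply: eq_has => c; apply: congl. Qed.

Lemma mem_class_rcons w c z : mem_class (rcons w c) z = cong z c || mem_class w z.
Proof. by rewrite /mem_class has_rcons. Qed.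

Definition ascending (x : int) w : bool :=
  sorted <%R w && all (fun c => x < c < x + n%:Z) w.

(** An earlier letter congruent to c + 1 would be c + 1 - n, which is at most x and thus outside the
    open window. *)
Lemma ascending_rcons x w c : ascending x (rcons w c) ->
  [/\ ascending x w, ~~ mem_class w c & ~~ mem_class w (c + 1)].
Proof.
rewrite /ascending !sorted_pairwise; try exact: lt_trans.
rewrite pairwise_rcons all_rcons => /and3P[/andP[lec srt] xc inw].
split; first by rewrite srt.
  apply/hasPn => a aw; have := allP lec a aw; have /andP[] := allP inw a aw.
  move: xc => /andP[]; move=> h1 h2 h3 h4 h5; apply/negP => cc.
  by have := cong_small cc; lia.
apply/hasPn => a aw; have := allP lec a aw; have /andP[] := allP inw a aw.
move: xc => /andP[]; move=> h1 h2 h3 h4 h5; apply/negP => cc.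
by have := cong_small cc; lia.
Qed.

(** On a run a, a + 1, ..., b of consecutive letters an ascending word acts as a cycle: a jumps to b
    + 1, and each of a + 1, ..., b + 1 steps down by one. *)
Variant ascending_spec w (z : int) : int -> Type :=
| AscDown of mem_class w (z - 1) : ascending_spec w z (z - 1)
| AscFix of ~~ mem_class w (z - 1) & ~~ mem_class w z : ascending_spec w z z
| AscUp y of ~~ mem_class w (z - 1) & mem_class w z & z < y &
    mem_class w (y - 1) : ascending_spec w z y.

Lemma ascendingP x w z : ascending x w -> ascending_spec w z (act w z).
Proof.
elim/last_ind: w => [|w c IH]; first by move=> _; apply: AscFix.
case/ascending_rcons=> aw cw c1w; rewrite act_rcons.
case: (IH aw) => [h|h1 h2|y h1 h2 zy h3]; rewrite /refl.
- have -> : cong (z - 1) c = false.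
    by apply/negP => e; rewrite (mem_class_cong _ e) (negbTE cw) in h.
  have -> : cong (z - 1) (c + 1) = false.
    by apply/negP => e; rewrite (mem_class_cong _ e) (negbTE c1w) in h.
  by apply: AscDown; rewrite mem_class_rcons h orbT.
- case: (boolP (cong z c)) => zc.
    apply: AscUp; rewrite ?mem_class_rcons ?(negbTE h1) ?zc ?addrK ?zc ?ltrDl //.
    by rewrite orbF (@cong_addr _ _ _ z (c + 1)) ?(ncongS zc) //; lia.
  case: (boolP (cong z (c + 1))) => zc1.
    apply: AscDown; rewrite mem_class_rcons (@cong_addr _ _ _ z (c + 1)) ?zc1 //; lia.
  apply: AscFix; rewrite mem_class_rcons ?(negbTE zc) //.
  by rewrite (@cong_addr _ _ _ z (c + 1)) ?(negbTE zc1) //; lia.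
have zc1 : cong (z - 1) c = false.
  rewrite (@cong_addr _ _ _ z (c + 1)); last by lia.
  by apply/negP => e; rewrite (mem_class_cong _ e) (negbTE c1w) in h2.
case: (boolP (cong y c)) => yc.
  by apply: AscUp; rewrite ?mem_class_rcons ?zc1 ?h2 ?orbT ?addrK ?yc //; lia.
have -> : cong y (c + 1) = false.
  apply/negP => e; case/negP: cw; rewrite -(@mem_class_cong _ (y - 1)) //.
  by rewrite (@cong_addr _ _ _ y (c + 1)) //; lia.
by apply: AscUp; rewrite ?mem_class_rcons ?zc1 ?h2 ?h3 ?orbT.
Qed.

Lemma ascending_ge x w z : ascending x w -> z - 1 <= act w z.
Proof. by move=> aw; case: (ascendingP z aw) => *; lia. Qed.

(** A gap that moves up passes only positions p of a class whose first gap is smaller, that is,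
    empty positions. It therefore passes no bead, and this later yields the vertical strip
    condition. *)
Lemma ascending_reduced x w T q : ascending x w -> valid T -> reduced w T ->
  beads (act w \o T) (act w (T q)) = (beads T (T q) + (act w (T q) < T q)%R)%N /\
  forall p, T q < p <= act w (T q) -> exists2 j, cong (T j) p & T j < T q.
Proof.
move=> + vT; elim/last_ind: w q => [|w c IH] q.
  by move=> _ _ /=; rewrite ltxx addn0; split=> // p; lia.
case/ascending_rcons=> aw cw c1w /(reduced_rcons vT)[rw [i [j [ic jc ji]]]].
have vT' := act_valid w vT; rewrite act_rcons.
have [Ei Ej Eq] := inv_parts vT' ic jc; rewrite /= in Ei Ej Eq.
have e z : beads (act (rcons w c) \o T) z = beads (refl c \o (act w \o T)) z.
  by apply: eq_bigr => p _; rewrite /= act_rcons.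
rewrite e.
(* The label lowered by the last letter c has not been moved before: to arrive at class c + 1 it
   would have needed an earlier letter of class c or c + 1. *)
have jfix : act w (T j) = T j.
  move: jc; case: (ascendingP (T j) aw) => // [h jc|y _ _ _ h jc].
    by rewrite (mem_class_cong _ jc) (negbTE c1w) in h.
  have yc : cong (y - 1) c by rewrite (@cong_addr _ _ _ y (c + 1)) //; lia.
  by rewrite (mem_class_cong _ yc) (negbTE cw) in h.
have [IH1 IH2] := IH q aw rw.
have [qi|qi] := eqVneq q i.
  subst q; have nlt : ~~ (act w (T i) < T i).
    move: ic; case: (ascendingP (T i) aw) => [h ic|*|*]; try by lia.
    by rewrite (mem_class_cong _ ic) (negbTE cw) in h.
  have -> : refl c (act w (T i)) = act w (T i) + 1 by rewrite /refl ic.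
  have Ei' : beads (refl c \o (act w \o T)) (act w (T i) + 1) = beads T (T i).
    rewrite /refl ic in Ei; move: Ei; rewrite IH1.
    by rewrite (negbTE nlt) addn0 => <-; rewrite (_ : (_ < act w (T j)) = false) ?addn0 //; lia.
  split; first by rewrite Ei' (_ : (_ < _) = false) ?addn0 //; lia.
  move=> p /andP[p1]; rewrite le_eqVlt => /orP[/eqP ->|p2]; last by apply: IH2; lia.
  exists j; first by rewrite -jfix (congl _ jc) congDr congC.
  rewrite ltNge le_eqVlt; apply/negP => /orP[/eqP ei|lt].
    have ij : i = j by apply: vT.1; rewrite ei congxx.
    by rewrite ij ltxx in ji.
  have [|j' h1 h2] := IH2 (T j); first by rewrite -{2}jfix; lia.
  by have jj := vT.1 _ _ h1; rewrite jj in h2; lia.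
have [qj|qj] := eqVneq q j.
  subst q; rewrite Ej ji jfix.
  have -> : refl c (T j) = T j - 1.
    by rewrite -{1}jfix /refl jc (ncongS' jc) jfix.
  rewrite (_ : (T j - 1 < T j)) ?(_ : (T j < T j - 1) = false); try by lia.
  split; last by lia.
  by move: IH1; rewrite jfix ltxx addn0 => <-.
rewrite Eq // IH1; suff -> : refl c (act w (T q)) = act w (T q) by [].
rewrite /refl ifN; last first.
  by apply/negP => h; case/eqP: qi; apply: vT'.1; rewrite /= (congl _ h) congC.
by rewrite ifN //; apply/negP => h; case/eqP: qj; apply: vT'.1; rewrite /= (congl _ h) congC.
Qed.

Lemma beads_act_eq w z T : valid T -> ~~ mem_class w z ->
  beads (act w \o T) z = beads T z.
Proof.
move=> vT; elim/last_ind: w => [|w c IH] //; rewrite mem_class_rcons negb_or.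
case/andP=> zc /IH <-; rewrite -(beads_refl_eq (act_valid w vT) zc).
by apply: eq_bigr => q _; rewrite /= act_rcons.
Qed.

(** If the last letter has the class of z, then no letter has the class of z + 1, so the count above
    z + 1 is the old one, and one position contributes at most one bead. For cores this bounds row r
    + 1 of the new core by row r of the old one. *)
Lemma ascending_strip x w T z : ascending x w -> valid T ->
  (beads (act w \o T) z <= (beads T (z + 1)).+1)%N.
Proof.
move=> + vT; elim/last_ind: w => [|w c IH].
  by move=> _; have := beads_le1 z vT; rewrite addn1.
move=> aw; case/ascending_rcons: (aw) => aw' cw c1w.
have e y : beads (act (rcons w c) \o T) y = beads (refl c \o (act w \o T)) y.
  by apply: eq_bigr => p _; rewrite /= act_rcons.
case: (boolP (cong z c)) => zc; last first.
  by rewrite e (beads_refl_eq (act_valid w vT) zc) IH.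
apply: leq_trans (beads_le1 z (act_valid _ vT)) _; rewrite addn1 ltnS.
have z1c : cong (z + 1) (c + 1) by rewrite congDr.
rewrite e (beads_refl_eq (act_valid w vT)) ?beads_act_eq //.
  by rewrite (mem_class_cong _ z1c).
by rewrite (ncongS' z1c).
Qed.

(** The gaps that step down, each by one, determine the ascending word and its result. This
    criterion serves both to change the cut and to recognise Pieri terms. *)
Lemma ascending_determined x w T T' : ascending x w ->
  valid T -> valid T' -> (forall q, T q - 1 <= T' q) ->
  (forall z, mem_class w z <-> exists q, cong (T q) (z + 1) /\ T' q = T q - 1) ->
  T' =1 act w \o T.
Proof.
move=> + vT; elim/last_ind: w T' => [|w c IH] T' aw vT' bound mem.
  have ge q : 0 <= T' q - T q.
    have := bound q; rewrite le_eqVlt => /orP[/eqP e|]; last by lia.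
    suff // : mem_class [::] (T q - 1) by [].
    by apply/mem; exists q; rewrite subrK congxx e.
  have sum0 : \sum_q (T' q - T q) = 0 by rewrite sumrB vT.2 vT'.2 subrr.
  move=> q; have /eqP := psumr_eq0P (fun q _ => ge q) sum0 (i := q) isT.
  by rewrite subr_eq0 => /eqP.
case/ascending_rcons: aw => aw cw c1w.
have [j [jc jd]] : exists q, cong (T q) (c + 1) /\ T' q = T q - 1.
  by apply/mem; rewrite mem_class_rcons congxx.
have nc1 q : cong (T' q) (c + 1) -> T q < T' q.
  move=> h; have := bound q; rewrite le_eqVlt => /orP[/eqP e|].
    have : mem_class (rcons w c) (c + 1).
      apply/mem; exists q; split=> //.
      by rewrite (@cong_addr _ _ _ (T' q) (c + 1)) //; lia.
    by rewrite mem_class_rcons (negbTE c1w) orbF congC (ncongS) ?congxx.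
  move=> h1.
  case: (ltgtP (T q) (T' q)) => // [|e]; first by lia.
  have qj : q = j by apply: vT.1; rewrite e (congl _ h) congC.
  by move: e; rewrite qj jd; lia.
(* Undo the last letter on T' and apply the induction hypothesis to the rest of the word. *)
suff e : refl c \o T' =1 act w \o T.
  by move=> q; rewrite /= act_rcons -[act w _](e q) /= reflK.
apply: IH => //; first exact: refl_valid.
  move=> q; rewrite /= /refl; have := bound q.
  by case: ifP => _; [lia|case: ifP => [/nc1|_]; lia].
move=> z; split.
  move=> zw; have /mem[q [h1 h2]] : mem_class (rcons w c) z.
    by rewrite mem_class_rcons zw orbT.
  exists q; split=> //; have qz : cong (T' q) z.
    by rewrite h2 (@cong_addr _ _ _ (T q) (z + 1)) //; lia.
  rewrite /= /refl ifN; last first.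
    by apply/negP => e; rewrite (congl _ qz) in e; rewrite -(mem_class_cong _ e) zw in cw.
  rewrite ifN //.
  by apply/negP => e; rewrite (congl _ qz) in e; rewrite -(mem_class_cong _ e) zw in c1w.
case=> q [h1]; rewrite /= /refl; have := bound q.
case: (boolP (cong (T' q) c)) => qc; first by lia.
case: (boolP (cong (T' q) (c + 1))) => [/nc1|_ _ h2]; first by lia.
have : mem_class (rcons w c) z by apply/mem; exists q.
rewrite mem_class_rcons => /orP[zc|//]; case/negP: qc.
by rewrite h2 (congl _ (_ : cong (T q - 1) z)) // (@cong_addr _ _ _ (T q) (z + 1)) //; lia.
Qed.

(* For x outside A, this is the word of the cyclically decreasing element d_A,
   obtained by cutting the cycle at x. *)
Definition asc (x : int) (A : {set 'I_n}) : seq int :=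
  [seq c <- [seq x + o%:Z | o <- iota 1 k.+1] | residue k c \in A].

Lemma asc_ascending x A : ascending x (asc x A).
Proof.
apply/andP; split.
  apply: sorted_filter; first exact: lt_trans.
  rewrite sorted_map; apply: (@sub_sorted _ ltn); last exact: iota_ltn_sorted.
  by move=> a b /= h; rewrite ltrD2l ltz_nat.
apply/allP => c; rewrite mem_filter => /andP[_ /mapP[o]].
by rewrite mem_iota => /andP[h1 h2] ->; lia.
Qed.

Lemma window_rep x z : ~~ cong z x ->
  exists2 c, c \in [seq x + o%:Z | o <- iota 1 k.+1] & cong z c.
Proof.
move=> zx; have zc : cong z (x + ((z - x) %% n%:Z)%Z).
  rewrite (@cong_addr _ _ _ (z - x) ((z - x) %% n%:Z)%Z); last by lia.
  by rewrite /cong -eqz_mod_dvd modz_mod.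
have h0 : 0 <= ((z - x) %% n%:Z)%Z by rewrite modz_ge0.
have h1 : ((z - x) %% n%:Z)%Z < n%:Z by rewrite ltz_pmod.
have h2 : ((z - x) %% n%:Z)%Z != 0.
  by apply: contra zx => /eqP e; rewrite e addr0 in zc.
exists (x + ((z - x) %% n%:Z)%Z) => //; apply/mapP.
by exists `|((z - x) %% n%:Z)%Z|%N; rewrite ?mem_iota; lia.
Qed.

Lemma mem_class_asc x A z : residue k x \notin A ->
  mem_class (asc x A) z = (residue k z \in A).
Proof.
move=> xA; apply/hasP/idP => [[c]|zA].
  by rewrite mem_filter => /andP[cA _]; rewrite -eq_residue => /eqP ->.
have [|c cw zc] := @window_rep x z.
  by rewrite -eq_residue; apply: contra xA => /eqP <-.
by exists c => //; rewrite mem_filter cw andbT; move: zc; rewrite -eq_residue => /eqP <-.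
Qed.

Lemma size_asc x A : residue k x \notin A -> size (asc x A) = #|A|.
Proof.
move=> xA; rewrite -(size_map (residue k)).
rewrite -(card_uniqP _); last first.
  rewrite map_inj_in_uniq ?filter_uniq ?map_inj_uniq ?iota_uniq //; first by move=> a b /=; lia.
  move=> c d; rewrite !mem_filter => /andP[_ /mapP[o]] + -> /andP[_ /mapP[p]] + ->.
  rewrite !mem_iota => h1 h2 /eqP; rewrite eq_residue => h3.
  by apply: (cong_small h3); lia.
apply: eq_card => i; apply/mapP/idP => [[c]|iA].
  by rewrite mem_filter => /andP[cA _] ->.
have [|c cw ic] := @window_rep x (i : nat)%:Z.
  rewrite -eq_residue; apply: contra xA => /eqP <-.
  by rewrite residue_ord.
move: ic; rewrite -eq_residue residue_ord => /eqP ic.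
by exists c => //; rewrite mem_filter cw andbT -ic.
Qed.

(** Both words lower exactly the gaps T q with T q - 1 in A, so no commutation of letters has to be
    tracked. *)
Lemma act_asc_cut x y A T : valid T -> residue k x \notin A -> residue k y \notin A ->
  act (asc x A) \o T =1 act (asc y A) \o T.
Proof.
move=> vT xA yA; apply: (ascending_determined (asc_ascending y A)) => //.
- exact: act_valid.
- by move=> q /=; case: (ascendingP (T q) (asc_ascending x A)) => *; lia.
move=> z; rewrite mem_class_asc //; split.
  move=> zA; have [q qz] := distinct_onto (z + 1) vT.1; exists q; split=> //=.
  have h : mem_class (asc x A) (T q - 1).
    rewrite mem_class_asc //; suff -> : residue k (T q - 1) = residue k z by [].
    by apply/eqP; rewrite eq_residue (@cong_addr _ _ _ (T q) (z + 1)) //; lia.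
  by case: (ascendingP (T q) (asc_ascending x A)) => // [h'|y' h']; rewrite h in h'.
case=> q [qz /=]; case: (ascendingP (T q) (asc_ascending x A)) => [h _|_ _ |y' _ _]; try lia.
move: h; rewrite mem_class_asc //; suff -> : residue k (T q - 1) = residue k z by [].
by apply/eqP; rewrite eq_residue (@cong_addr _ _ _ (T q) (z + 1)) //; lia.
Qed.

End Words.

(** * The dual Pieri rule for words *)

Section Hooks.
Variable k : nat.
Local Notation n := k.+2.
Local Notation cong := (cong k).
Local Notation refl := (refl k).
Local Notation residue := (residue k).
Implicit Types (w : seq int) (T : 'I_n -> int) (A B U : {set 'I_n})
  (p : {set 'I_n} * {set 'I_n}).

(** Transposition reverses the abacus by z -> -1 - z and exchanges beads with gaps. The last bead T
    i - n thus becomes the first gap n - 1 - T i of its class. *)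
Definition flip (z : int) : int := k.+1%:Z - z.

Lemma flipK : involutive flip.
Proof. by move=> z; rewrite /flip; lia. Qed.

Lemma flip_refl c z : flip (refl c z) = refl (k%:Z - c) (flip z).
Proof.
rewrite /refl /flip.
have -> : cong (k.+1%:Z - z) (k%:Z - c) = cong z (c + 1).
  by rewrite congC; apply: cong_addr; lia.
have -> : cong (k.+1%:Z - z) (k%:Z - c + 1) = cong z c.
  by rewrite congC; apply: cong_addr; lia.
case: (boolP (cong z c)) => [h|_]; first by rewrite (ncongS h); lia.
by case: ifP => _; lia.
Qed.

Lemma flip_act w z : flip (act k w z) = act k [seq k%:Z - c | c <- w] (flip z).
Proof. by elim: w z => //= c w IH z; rewrite IH flip_refl. Qed.

Definition flip_set A : {set 'I_n} := [set i : 'I_n | residue (k%:Z - (i : nat)%:Z) \in A].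

Lemma flip_asc x A :
  [seq k%:Z - c | c <- rev (asc x A)] = asc (k%:Z - x - n%:Z) (flip_set A).
Proof.
rewrite /asc -filter_rev -map_rev filter_map [RHS]filter_map -!map_comp.
have -> : rev (iota 1 k.+1) = [seq (n - o)%N | o <- iota 1 k.+1].
  apply: (@eq_from_nth _ 0%N); rewrite ?size_rev ?size_map // => i.
  rewrite size_iota => ik; rewrite nth_rev size_iota // (nth_map 0%N) ?size_iota //.
  by rewrite !nth_iota //; lia.
rewrite filter_map -map_comp; set s := iota 1 k.+1.
have -> : [seq x0 <- s | preim (fun o => k%:Z - x - n%:Z + o%:Z)
    (fun c => residue c \in flip_set A) x0] = [seq x0 <- s
  | preim (subn n) (preim (fun o => x + o%:Z) (fun c => residue c \in A)) x0].
  apply: eq_in_filter => o; rewrite mem_iota => ho /=; rewrite inE.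
  suff /eqP -> : residue (k%:Z - (residue (k%:Z - x - n%:Z + o%:Z) : nat)%:Z)
    == residue (x + (n - o)%N%:Z) by [].
  rewrite eq_residue.
  have h := cong_residue k (k%:Z - x - n%:Z + o%:Z).
  rewrite congC (@cong_addr _ _ _ (residue (k%:Z - x - n%:Z + o%:Z) : nat)%:Z
     (k%:Z - x - n%:Z + o%:Z)) //; lia.
apply/eq_in_map => o; rewrite mem_filter mem_iota => /andP[_ ho] /=; lia.
Qed.

Lemma flip_setE A z : (residue z \in flip_set A) = (residue (k%:Z - z) \in A).
Proof.
rewrite inE; suff -> : residue (k%:Z - (residue z : nat)%:Z) = residue (k%:Z - z) by [].
apply/eqP; rewrite eq_residue congC.
rewrite -(@cong_addr _ (residue z : nat)%:Z z) ?cong_residue //; lia.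
Qed.

Lemma flip_setK : involutive flip_set.
Proof.
move=> A; apply/finset.setP => i; rewrite inE flip_setE subKr.
by rewrite residue_ord.
Qed.

Lemma card_flip_set A : #|flip_set A| = #|A|.
Proof.
have le B : (#|flip_set B| <= #|B|)%N.
  rewrite -(card_in_imset (f := fun i : 'I_n => residue (k%:Z - (i : nat)%:Z))).
    by apply/subset_leq_card/fintype.subsetP => j /imsetP[i]; rewrite inE => h ->.
  move=> i j _ _ /eqP; rewrite eq_residue => h; apply: val_inj => /=.
  have h' : cong (i : nat)%:Z (j : nat)%:Z by rewrite congC -(@cong_addr k (k%:Z - (i : nat)%:Z) (k%:Z - (j : nat)%:Z)) //; lia.
  have := ltn_ord i; have := ltn_ord j; move=> h1 h2.
  by have := cong_small h'; lia.
by apply/eqP; rewrite eqn_leq le -{1}[A]flip_setK le.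
Qed.

Lemma flip_valid T : valid T -> valid (flip \o T).
Proof.
case=> inj sumT; split=> [i j /= h|].
  by apply: inj; rewrite congC -(@cong_addr k (flip (T i)) (flip (T j))) //; rewrite /flip; lia.
have -> : \sum_i (flip \o T) i = \sum_(i < n) (flip (i : nat)%:Z).
  by rewrite !sumrB sumT.
rewrite (reindex_inj rev_ord_inj) /=; apply: eq_bigr => i _; rewrite /flip.
by have := ltn_ord i; lia.
Qed.

Lemma act_asc_eq x y A T : valid T -> residue x \notin A -> residue y \notin A ->
  act k (asc x A) \o T = act k (asc y A) \o T.
Proof. by move=> vT xA yA; apply/funext/act_asc_cut. Qed.

Lemma act_desc_eq x y A T : valid T -> residue x \notin A -> residue y \notin A ->
  act k (rev (asc x A)) \o T = act k (rev (asc y A)) \o T.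
Proof.
move=> vT xA yA; apply/funext => i; apply: (can_inj flipK); rewrite /= !flip_act !flip_asc.
have cut z : residue z \notin A -> residue (k%:Z - z - n%:Z) \notin flip_set A.
  rewrite flip_setE; suff -> : residue (k%:Z - (k%:Z - z - n%:Z)) = residue z by [].
  by apply/eqP; rewrite eq_residue; apply/congP; exists 1; lia.
have /(congr1 (fun f => f i)) := act_asc_eq (flip_valid vT) (cut _ xA) (cut _ yA).
by [].
Qed.

Lemma repeated_not_reduced w1 c w2 T : valid T ->
  ~~ reduced (w1 ++ [:: c, c & w2]) T.
Proof.
move=> vT; apply/negP; rewrite /reduced => /eqP.
have -> : act k (w1 ++ [:: c, c & w2]) \o T = act k (w1 ++ w2) \o T.
  by apply/funext => i; rewrite /= !act_cat /= reflK.
by have := inv_act_le (w1 ++ w2) vT; rewrite !size_cat /=; lia.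
Qed.

(** A point outside U at which the cycle may be opened. The value 0 is a default for the full
    set. *)
Definition cut (U : {set 'I_n}) : int :=
  if [pick i | i \notin U] is Some i then (i : nat)%:Z else 0.

Lemma cutP U : (#|U| < n)%N -> residue (cut U) \notin U.
Proof.
rewrite /cut; case: pickP => [i iU _|all]; first by rewrite residue_ord.
by rewrite ltnNge -{1}[n]card_ord subset_leq_card //; apply/fintype.subsetP => i _; have := all i; case: (i \in U).
Qed.

Definition top_letter x U : int := last x (asc x U).

Lemma asc_top x U A : residue x \notin U -> A \subset U ->
  residue (top_letter x U) \in A ->
  asc x A = rcons (asc x (A :\ residue (top_letter x U))) (top_letter x U).
Proof.
rewrite /top_letter /asc => xU AU.
set L := [seq x + o%:Z | o <- iota 1 k.+1].
have : uniq [seq residue c | c <- L].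
  rewrite map_inj_in_uniq ?map_inj_uniq ?iota_uniq //; first by move=> a b /=; lia.
  move=> c d /mapP[o + ->] /mapP[p + ->]; rewrite !mem_iota => h1 h2 /eqP.
  by rewrite eq_residue => h3; apply: (cong_small h3); lia.
elim/last_ind: L => [_ /=|L d IH].
  by move=> xA; case/negP: xU; apply: (fintype.subsetP AU).
rewrite map_rcons rcons_uniq => /andP[dL uL]; rewrite !filter_rcons.
case: (boolP (residue d \in U)) => dU; last first.
  have dA : residue d \notin A by apply: contra dU; apply: (fintype.subsetP AU).
  by rewrite (negbTE dA) in_setD1 (negbTE dA) andbF; apply: IH.
rewrite last_rcons => dA; rewrite dA in_setD1 eqxx /=; congr rcons.
apply: eq_in_filter => c cL; rewrite in_setD1.
by case: eqP => // e; case/negP: dL; rewrite -e map_f.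
Qed.

Lemma top_letter_in x U : residue x \notin U -> U != finset.set0 ->
  residue (top_letter x U) \in U.
Proof.
move=> xU U0; have : size (asc x U) != 0%N by rewrite size_asc // cards_eq0.
rewrite /top_letter; case E : (asc x U) => [|a s] // _.
have : last a s \in asc x U by rewrite E mem_last.
by rewrite mem_filter => /andP[].
Qed.

(* Moving the top letter between the ascending and the descending word does not
   change the concatenated word, but changes the sign; if it occurs in both, the
   word is not reduced. *)
Lemma hook_sum (R : pzRingType) (F : seq int -> R) (T : 'I_n -> int) l :
  valid T -> (forall w, ~~ reduced w T -> F w = 0) -> (0 < l <= k.+1)%N ->
  \sum_(p : {set 'I_n} * {set 'I_n} | (#|p.1| + #|p.2| == l)%N)
    (-1) ^+ #|p.1| * F (asc (cut (p.1 :|: p.2)) p.1 ++ rev (asc (cut (p.1 :|: p.2)) p.2)) = 0.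
Proof.
move=> vT F0 /andP[l0 lk].
pose x (p : {set 'I_n} * {set 'I_n}) := cut (p.1 :|: p.2).
pose c p := top_letter (x p) (p.1 :|: p.2).
pose M p := residue (c p).
pose W (p : {set 'I_n} * {set 'I_n}) := asc (x p) p.1 ++ rev (asc (x p) p.2).
have xP p : (#|p.1| + #|p.2| == l)%N -> residue (x p) \notin p.1 :|: p.2.
  by move=> /eqP pl; apply: cutP; have := cardsU p.1 p.2; lia.
have MP p : (#|p.1| + #|p.2| == l)%N -> M p \in p.1 :|: p.2.
  move=> pl; apply: top_letter_in; first exact: xP.
  apply/eqP => /eqP; rewrite finset.setU_eq0 => /andP[/eqP p1 /eqP p2].
  by move: pl; rewrite p1 p2 !cards0 => /eqP; lia.
rewrite (bigID (fun p => M p \in p.1)) /= (bigID (fun p => M p \in p.2)) /=.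
rewrite big1 ?add0r; last first.
  move=> [A B] /= /andP[/andP[pl MA] MB]; rewrite F0 ?mulr0 //.
  have xU := xP (A, B) pl.
  rewrite -/(x (A, B)) (asc_top xU (finset.subsetUl _ _) MA) (asc_top xU (finset.subsetUr _ _) MB).
  by rewrite rev_rcons cat_rcons; apply: repeated_not_reduced.
(* Being the identity when the top letter lies in both sets or in neither, [tau] is an involution on
   all pairs, which permits reindexing. *)
pose tau (p : {set 'I_n} * {set 'I_n}) :=
  if (M p \in p.1) == (M p \in p.2) then p else
  if M p \in p.1 then (p.1 :\ M p, M p |: p.2) else (M p |: p.1, p.2 :\ M p).
have tauU p : (tau p).1 :|: (tau p).2 = p.1 :|: p.2.
  rewrite /tau; case: eqP => // /eqP; case: (boolP (M p \in p.1)) => M1 M2.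
    apply/finset.setP => i; rewrite !inE.
    by case: (i =P M p) => [->|]; rewrite ?M1 ?orbT.
  apply/finset.setP => i; rewrite !inE.
  by case: (i =P M p) => [->|//]; rewrite (negbTE M1) /=; case: (_ \in _) M2.
have tauM p : M (tau p) = M p by rewrite /M /c /x tauU.
have tauK : involutive tau.
  move=> p; rewrite {1}/tau tauM /tau.
  case: (boolP (M p \in p.1)) => M1; case: (boolP (M p \in p.2)) => M2 /=;
    rewrite ?M1 ?M2 ?(negbTE M1) ?(negbTE M2) // !inE eqxx ?M1 ?M2 ?(negbTE M1) ?(negbTE M2) /=.
    by rewrite finset.setD1K // finset.setU1K //; case: p {M1 M2}.
  by rewrite finset.setD1K // finset.setU1K //; case: p {M1 M2}.
have tau_card p : (#|(tau p).1| + #|(tau p).2| = #|p.1| + #|p.2|)%N.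
  rewrite /tau; case: (boolP (M p \in p.1)) => M1; case: (boolP (M p \in p.2)) => M2 //=.
    by rewrite (cardsD1 (M p) p.1) cardsU1 M1 M2 addnCA addnA.
  by rewrite (cardsD1 (M p) p.2) cardsU1 M1 M2 [RHS]addnCA addnA.
rewrite [X in _ + X](reindex_inj (can_inj tauK)) /=.
rewrite [X in _ + X](eq_bigl (fun p => [&& #|p.1| + #|p.2| == l, M p \in p.1 & M p \notin p.2]%N)); last first.
  move=> p; rewrite tau_card tauM; case: eqP => //= /eqP pl.
  have := MP p pl; rewrite inE /tau.
  by case: (boolP (M p \in p.1)) => M1; case: (boolP (M p \in p.2)) => M2 //=;
     rewrite ?inE ?eqxx ?M1 ?M2 ?(negbTE M1).
rewrite [X in _ + X](eq_bigr (fun p => - ((-1) ^+ #|p.1| * F (W p)))); last first.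
  move=> p /and3P[pl M1 M2]; have xU := xP p pl; rewrite tauU -/(x p).
  rewrite /tau M1 (negbTE M2) /=.
  have -> : asc (x p) (M p |: p.2) = rcons (asc (x p) p.2) (c p).
    rewrite (@asc_top _ (p.1 :|: p.2)) ?finset.setU1K ?finset.setU11 //.
    by rewrite finset.subUset finset.sub1set finset.subsetUr inE M1.
  rewrite rev_rcons -cat_rcons -(asc_top xU (finset.subsetUl _ _) M1).
  by rewrite (cardsD1 (M p) p.1) M1 /= add1n exprS mulN1r mulNr opprK.
rewrite sumrN; apply/eqP; rewrite subr_eq0; apply/eqP.
by apply: eq_bigl => p; rewrite andbA.
Qed.

End Hooks.

(** * Elementary functions and descending words *)

Section ElementaryPieri.
Variables (k : nat) (R : comNzRingType).
Local Notation n := k.+2.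
Local Notation act := (act k).
Implicit Types (w : seq int) (T : 'I_n -> int) (A B : {set 'I_n})
  (p : {set 'I_n} * {set 'I_n}).

(** The recursion for e_(l+1) refers to all of e_0, ..., e_l, so the whole list is built at once. *)
Fixpoint elem_seq (h : nat -> R) (l : nat) : seq R :=
  if l is l'.+1 then
    rcons (elem_seq h l')
      (\sum_(i < l) (-1) ^+ i * h i.+1 * nth 0 (elem_seq h l') (l' - i))
  else [:: 1].

(* The elementary symmetric function e_l as a polynomial in h_1, ..., h_l. *)
Definition elem (h : nat -> R) (l : nat) : R := nth 0 (elem_seq h l) l.

Lemma size_elem_seq h l : size (elem_seq h l) = l.+1.
Proof. by elim: l => //= l IH; rewrite size_rcons IH. Qed.

Lemma nth_elem_seq h l m : (l <= m)%N -> nth 0 (elem_seq h m) l = elem h l.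
Proof.
elim: m => [|m IH]; first by rewrite leqn0 => /eqP ->.
rewrite leq_eqVlt => /orP[/eqP -> //|lm].
by rewrite /= nth_rcons size_elem_seq lm IH.
Qed.

Lemma elem0 h : elem h 0 = 1. Proof. by []. Qed.

Lemma elemS h l :
  elem h l.+1 = \sum_(i < l.+1) (-1) ^+ i * h i.+1 * elem h (l - i).
Proof.
rewrite /elem /= nth_rcons size_elem_seq ltnn eqxx.
by apply: eq_bigr => i _; rewrite nth_elem_seq // leq_subr.
Qed.

Variable S : ('I_n -> int) -> R.

(** Words that are not reduced contribute 0, as products do in the nil-Coxeter algebra. *)
Definition word_term w T : R := if reduced w T then S (act w \o T) else 0.

Definition asc_pieri (h : nat -> R) := forall l T, (0 < l <= k.+1)%N ->
  valid T -> increasing T ->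
  h l * S T = \sum_(A : {set 'I_n} | #|A| == l) word_term (asc (cut A) A) T.

Definition desc_pieri (e : nat -> R) := forall l T, (l <= k.+1)%N ->
  valid T -> increasing T ->
  e l * S T = \sum_(A : {set 'I_n} | #|A| == l) word_term (rev (asc (cut A) A)) T.

Lemma word_term_eq w1 w2 T : size w1 = size w2 -> act w1 \o T = act w2 \o T ->
  word_term w1 T = word_term w2 T.
Proof. by move=> sz e; rewrite /word_term /reduced sz e. Qed.

Lemma word_term_cat w1 w2 T : valid T ->
  word_term (w1 ++ w2) T = if reduced w1 T then word_term w2 (act w1 \o T) else 0.
Proof.
move=> vT; rewrite /word_term reduced_cat //; case: (reduced w1 T) => //=.
suff -> : act (w1 ++ w2) \o T = act w2 \o (act w1 \o T) by [].
by apply/funext => i; rewrite /= act_cat.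
Qed.

Lemma asc_set0 x : asc x (finset.set0 : {set 'I_n}) = [::].
Proof. by rewrite /asc -(filter_pred0 [seq x + o%:Z | o <- iota 1 k.+1]); apply: eq_filter => c; rewrite inE. Qed.

Lemma sum_card_pairs (V : nmodType) l (X : {set 'I_n} * {set 'I_n} -> V) :
  \sum_(p : {set 'I_n} * {set 'I_n} | (#|p.1| + #|p.2| == l)%N) X p =
  \sum_(i < l.+1) \sum_(A : {set 'I_n} | #|A| == i)
     \sum_(B : {set 'I_n} | #|B| == (l - i)%N) X (A, B).
Proof.
rewrite (partition_big (fun p => inord #|p.1| : 'I_l.+1) xpredT) //=.
apply: eq_bigr => i _; rewrite pair_big_dep /=; apply: eq_big => [[A B]|[A B] _] //=.
have li := ltn_ord i; apply/andP/andP => [[/eqP AB /eqP e]|[/eqP a /eqP b]].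
  have a : #|A| = i by rewrite -e inordK // ltnS -AB leq_addr.
  split; first by rewrite a.
  by have := addKn #|A| #|B|; rewrite AB a => <-.
split; first by rewrite a b subnKC // -ltnS.
by apply/eqP/val_inj; rewrite /= inordK a.
Qed.

(** By [hook_sum] the operators given by ascending and descending words satisfy the alternating
    relation that defines [elem] from h, so strong induction on l identifies e_l with the descending
    words. *)
Lemma desc_pieri_elem h : asc_pieri h -> desc_pieri (elem h).
Proof.
move=> hS; elim/ltn_ind => l IH T lk vT iT.
case: l IH lk => [_ _|l IH lk].
  rewrite elem0 mul1r (big_pred1 finset.set0) => [|A]; last by rewrite cards_eq0.
  by rewrite asc_set0 /word_term /reduced addn0 eqxx.
pose G p := word_term (asc (cut (p.1 :|: p.2)) p.1 ++ rev (asc (cut (p.1 :|: p.2)) p.2)) T.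
(* [hook_sum] opens both words at a point outside the union, while the Pieri rules open each word at
   its own point; all these points are admissible, so the actions agree. *)
have cutU A B : (#|A| + #|B| <= k.+1)%N ->
    [/\ residue k (cut (A :|: B)) \notin A, residue k (cut (A :|: B)) \notin B,
        residue k (cut A) \notin A & residue k (cut B) \notin B].
  move=> AB; have h1 := cardsU A B.
  have : residue k (cut (A :|: B)) \notin A :|: B by apply: cutP; lia.
  by rewrite inE negb_or => /andP[-> ->]; split=> //; apply: cutP; lia.
have term (i : 'I_l.+1) : h i.+1 * elem h (l - i) * S T =
    \sum_(A : {set 'I_n} | #|A| == i.+1) \sum_(B : {set 'I_n} | #|B| == (l - i)%N) G (A, B).
  have li := ltn_ord i.
  rewrite [h _ * _]mulrC -mulrA hS //; last by lia.
  rewrite mulr_sumr; apply: eq_bigr => A /eqP Ai.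
  rewrite {1}/word_term; case: ifP => rA; last first.
    rewrite mulr0; symmetry; apply: big1 => B /eqP Bi.
    have [|u1 u2 u3 u4] := cutU A B; first by rewrite Ai Bi; lia.
    rewrite /G word_term_cat // ifN // /reduced size_asc // (act_asc_eq vT u1 u3).
    by move: rA; rewrite /reduced size_asc // => ->.
  rewrite IH; [|by lia|by lia|exact: act_valid|exact: act_increasing].
  apply: eq_bigr => B /eqP Bi.
  have [|u1 u2 u3 u4] := cutU A B; first by rewrite Ai Bi; lia.
  rewrite /G word_term_cat //= ifT; last first.
    by move: rA; rewrite /reduced !size_asc // (act_asc_eq vT u1 u3).
  rewrite (act_asc_eq vT u1 u3); apply: word_term_eq; first by rewrite !size_rev !size_asc.
  by apply: act_desc_eq => //; apply: act_valid.
have F0 w : ~~ reduced w T -> word_term w T = 0 by rewrite /word_term => /negbTE ->.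
have := @hook_sum k R (word_term ^~ T) T l.+1 vT F0 lk.
rewrite (sum_card_pairs l.+1 (fun p => (-1) ^+ #|p.1| * G p)) big_ord_recl /=.
rewrite (big_pred1 finset.set0) => [|A]; last by rewrite cards_eq0.
rewrite cards0 => /eqP; rewrite addr_eq0 => /eqP H.
have -> : \sum_(A : {set 'I_n} | #|A| == l.+1) word_term (rev (asc (cut A) A)) T =
   \sum_(B : {set 'I_n} | #|B| == (l.+1 - 0)%N) (-1) ^+ 0 * G (finset.set0, B).
  by apply: eq_bigr => B _; rewrite mul1r /G /= asc_set0 finset.set0U.
rewrite H elemS mulr_suml -sumrN; apply: eq_bigr => i _.
rewrite -!mulrA [h _ * _]mulrA term mulr_sumr -sumrN.
apply: eq_bigr => A /eqP Ai; rewrite mulr_sumr -sumrN.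
apply: eq_big => [B|B _]; first by rewrite /bump /= subSS.
by rewrite Ai exprS mulN1r mulNr opprK.
Qed.

End ElementaryPieri.

(** * Cores on the abacus *)

Section Partitions.
Implicit Types (la mu nu : seq nat).
Local Open Scope nat_scope.

Lemma eq_lt_nat a b : (forall r, (r < a) = (r < b)) -> a = b.
Proof. by move=> e; apply/eqP; rewrite eqn_leq leqNgt e ltnn leqNgt -e ltnn. Qed.

Lemma geq_trans : transitive geq.
Proof. by move=> b a c ba cb; apply: leq_trans cb ba. Qed.

Lemma is_part_cons p la : is_part (p :: la) ->
  [/\ 0 < p, is_part la & nth 0 la 0 <= p].
Proof.
rewrite /is_part /= in_cons negb_or eq_sym -lt0n => /and3P[srt p0 la0]; split=> //.
  by rewrite la0 andbT; apply: path_sorted srt.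
by case: la srt {la0} => //= a la /andP[ap _]; exact: ap.
Qed.

Lemma is_part_consE p la : 0 < p -> is_part la -> nth 0 la 0 <= p ->
  is_part (p :: la).
Proof.
move=> p0 /andP[srt la0] lep; rewrite /is_part /= in_cons negb_or eq_sym -lt0n p0 la0 andbT.
by case: la srt la0 lep => //= a la -> _ ->.
Qed.

Lemma nth_part la i j : is_part la -> i <= j -> nth 0 la j <= nth 0 la i.
Proof.
move=> /andP[srt _] ij; case: (ltnP j (size la)) => jl; last by rewrite nth_default.
have := sorted_leq_nth geq_trans (leqnn : reflexive geq) 0 srt.
by move/(_ i j); rewrite !inE; apply=> //; apply: leq_ltn_trans jl.
Qed.

Lemma nth_part_gt0 la i : is_part la -> (0 < nth 0 la i) = (i < size la).
Proof.
move=> /andP[_ la0]; case: (ltnP i (size la)) => il; last by rewrite nth_default.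
by rewrite lt0n; apply: contra la0 => /eqP <-; apply: mem_nth.
Qed.

Lemma eq_part la mu : is_part la -> is_part mu -> nth 0 la =1 nth 0 mu -> la = mu.
Proof.
move=> pl pm e; have sz : size la = size mu.
  by apply: eq_lt_nat => i; rewrite -!nth_part_gt0 // e.
by apply: (eq_from_nth sz) => i _; apply: e.
Qed.

Lemma ltn_count la c r : is_part la -> (r < count (ltn c) la) = (c < nth 0 la r).
Proof.
elim: la r => [|p la IH] r pla; first by rewrite nth_nil.
have [p0 pl le] := is_part_cons pla.
case: (ltnP c p) => cp; last first.
  have -> : count (ltn c) (p :: la) = 0.
    apply/eqP; rewrite -leqn0 leqNgt -has_count; apply/hasPn => q /(nthP 0)[i _ <-].
    by rewrite -leqNgt; apply: leq_trans (nth_part (i := 0) pla _) cp.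
  symmetry; apply/negbTE; rewrite -leqNgt.
  exact: leq_trans (nth_part (i := 0) pla _) cp.
by case: r => [|r] /=; rewrite cp // add1n ltnS IH.
Qed.

Lemma nth_conj la c : is_part la -> nth 0 (conj_part la) c = count (ltn c) la.
Proof.
move=> pl; have h0 : head 0 la = nth 0 la 0 by case: la pl.
rewrite /conj_part h0; case: (ltnP c (nth 0 la 0)) => cl.
  by rewrite (nth_map 0) ?size_iota // nth_iota.
rewrite nth_default ?size_map ?size_iota //.
by symmetry; apply/eqP; rewrite -leqn0 leqNgt ltn_count // -leqNgt.
Qed.

Lemma lt_conj la c r : is_part la -> (r < nth 0 (conj_part la) c) = (c < nth 0 la r).
Proof. by move=> pl; rewrite nth_conj // ltn_count. Qed.

Lemma size_conj la : size (conj_part la) = nth 0 la 0.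
Proof. by rewrite /conj_part size_map size_iota; case: la. Qed.

Lemma conj_is_part la : is_part la -> is_part (conj_part la).
Proof.
move=> pl; rewrite /is_part; apply/andP; split.
  apply/(sortedP 0) => i isz; rewrite /= leqNgt lt_conj // -leqNgt.
  have : nth 0 la (nth 0 (conj_part la) i) <= i by rewrite leqNgt -lt_conj // ltnn.
  exact: leqW.
apply/negP => /(nthP 0)[i]; rewrite size_conj => isz e0.
by have := isz; rewrite -lt_conj // e0.
Qed.

Lemma conj_partK la : is_part la -> conj_part (conj_part la) = la.
Proof.
move=> pl; apply: eq_part => // [|i]; first exact/conj_is_part/conj_is_part.
by apply: eq_lt_nat => r; rewrite !lt_conj //; apply: conj_is_part.
Qed.

Lemma sumn_conj la m : is_part la -> nth 0 la 0 <= m ->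
  sumn la = \sum_(i < m) nth 0 (conj_part la) i.
Proof.
move=> pl; under eq_bigr do rewrite nth_conj //.
elim: la pl => [|p la IH] pl le0 /=; first by rewrite big1.
have [p0 pl' le] := is_part_cons pl.
rewrite big_split /= -IH ?(leq_trans le) //; congr addn.
have -> // : \sum_(i < m) (i < p : nat) = minn p m; last by rewrite (minn_idPl le0).
clear; elim: m => [|m IHm]; rewrite ?big_ord0 ?minn0 // big_ord_recr /= IHm; lia.
Qed.

End Partitions.

(** * Beads, gaps and hook lengths *)

Section Beads.
Implicit Types (la mu nu : seq nat).

(** Rows are beads and columns are gaps of the Maya diagram; the empty partition has its beads at
    the negative integers. Boxes correspond to pairs of a bead and a smaller gap, and the hook
    length is their difference ([hook_bead]). *)
Definition bead la (r : nat) : int := (nth 0%N la r)%:Z - r%:Z - 1.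
Definition gap la (c : nat) : int := c%:Z - (nth 0%N (conj_part la) c)%:Z.

Lemma bead_lt la r q : is_part la -> (bead la r < bead la q) = (q < r)%N.
Proof.
move=> pl; rewrite /bead; case: (ltngtP q r) => [qr|rq|->]; last by rewrite ltxx.
  by have := nth_part pl (ltnW qr); lia.
by have := nth_part pl (ltnW rq); lia.
Qed.

Lemma bead_gap la r c : is_part la -> (gap la c < bead la r) = (c < nth 0 la r)%N.
Proof.
move=> pl; have := lt_conj c r pl; rewrite /bead /gap.
by case: (ltnP r) => h1 h2; rewrite -h2; lia.
Qed.

Lemma bead_neq_gap la r c : is_part la -> bead la r != gap la c.
Proof.
move=> pl; have := lt_conj c r pl; rewrite /bead /gap.
by case: (ltnP r) => h1 h2; lia.
Qed.

Lemma hook_bead la r c : is_part la -> (c < nth 0 la r)%N ->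
  (hook_length la (r, c))%:Z = bead la r - gap la c.
Proof.
move=> pl cr; have := lt_conj c r pl; rewrite cr /hook_length /bead /gap /=.
lia.
Qed.

(** All the beads above z are counted as soon as size la <= N and -N - 1 <= z, the side conditions
    carried by the lemmas below. *)
Definition nbeads la N (z : int) : nat := count (fun r => z < bead la r) (iota 0 N).

Lemma lt_nbeads la N z r : is_part la -> (size la <= N)%N -> - N%:Z - 1 <= z ->
  (r < nbeads la N z)%N = (z < bead la r).
Proof.
move=> pl szN zN; rewrite /nbeads.
have anti (q p : nat) : (q <= p)%N -> z < bead la p -> z < bead la q.
  by rewrite leq_eqVlt => /orP[/eqP -> //|]; rewrite -(bead_lt p q pl); lia.
have far (p : nat) : (N <= p)%N -> z < bead la p = false.
  by move=> Np; rewrite /bead nth_default ?(leq_trans szN) //; lia.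
case: (ltnP r N) => rN; last first.
  rewrite far //; apply/negbTE; rewrite -leqNgt.
  by apply: leq_trans (count_size _ _) _; rewrite size_iota.
have -> : N = (r + (N - r))%N by rewrite subnKC // ltnW.
rewrite iotaD count_cat add0n; case: (boolP (z < bead la r)) => h.
  have /eqP -> : count (fun p => z < bead la p) (iota 0 r) == r.
    rewrite -{2}(size_iota 0 r) -all_count; apply/allP => q; rewrite mem_iota => qr.
    by apply: anti h; lia.
  rewrite (_ : (N - r = (N - r).-1.+1)%N) /=; last by lia.
  by rewrite h; lia.
have /eqP -> : count (fun p => z < bead la p) (iota r (N - r)) == 0%N.
  rewrite -leqn0 leqNgt -has_count; apply/hasPn => q; rewrite mem_iota => qr.
  by apply: contra h; apply: anti; lia.
apply/negbTE; rewrite addn0 -leqNgt; apply: leq_trans (count_size _ _) _.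
by rewrite size_iota.
Qed.

(** Since the charge is 0, the number of gaps at or below z is z + 1 plus the number of beads above
    z, and the columns list the gaps in increasing order. *)
Lemma gap_le la N z c : is_part la -> (size la <= N)%N -> - N%:Z - 1 <= z ->
  (gap la c <= z) = (c%:Z < z + 1 + (nbeads la N z)%:Z).
Proof.
move=> pl szN zN; have lt r := @lt_nbeads la N z r pl szN zN.
apply/idP/idP => h.
  case: (ltrP c%:Z (z + 1)) => cz; first by lia.
  (* With this r the bead of row r lies above z exactly when row r contains column c. *)
  pose r := absz (c%:Z - z - 1)%R.
  have : (r < nbeads la N z)%N; last by rewrite /r; lia.
  rewrite lt; have : (r < nth 0 (conj_part la) c)%N by rewrite /r; move: h; rewrite /gap; lia.
  by rewrite lt_conj // /bead /r; lia.
case: (ltrP c%:Z (z + 1)) => cz; first by rewrite /gap; lia.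
pose r := absz (c%:Z - z - 1)%R.
have : (r < nbeads la N z)%N by rewrite /r; lia.
rewrite lt => hb; have : (c < nth 0 la r)%N by move: hb; rewrite /bead /r; lia.
by rewrite -lt_conj // /gap /r; lia.
Qed.

Lemma nth_core_to_bounded k la r : nth 0%N (core_to_bounded k la) r =
  count (fun j => hook_length la (r, j) <= k)%N (iota 0 (nth 0%N la r)).
Proof.
rewrite /core_to_bounded; case: (ltnP r (size la)) => rl.
  by rewrite (nth_map 0%N) ?size_iota // nth_iota.
by rewrite !nth_default ?size_map ?size_iota.
Qed.

Lemma nbeads_ge la N z : is_part la -> (size la <= N)%N -> - N%:Z - 1 <= z ->
  0 <= z + 1 + (nbeads la N z)%:Z.
Proof.
move=> pl szN zN; case: (leP 0 (z + 1 + (nbeads la N z)%:Z)) => // h; exfalso.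
pose r := absz (- z - 2)%R; have := @lt_nbeads la N z r pl szN zN.
by rewrite /bead /r; lia.
Qed.

Lemma bounded_nbeads k la N r : is_part la -> (size la <= N)%N ->
  - N%:Z - 1 <= bead la r - k%:Z - 1 ->
  (nth 0%N (core_to_bounded k la) r + nbeads la N (bead la r - k%:Z - 1) = r + k.+1)%N.
Proof.
move=> pl szN zN; set z := bead la r - k%:Z - 1; set B := nbeads la N z.
have B0 : 0 <= z + 1 + B%:Z by apply: nbeads_ge.
(* C is the number of gaps at or below z, which is the number of boxes of row r with hook length
   above k. *)
have [C CE] : exists C : nat, C%:Z = z + 1 + B%:Z.
  by exists (absz (z + 1 + B%:Z)%R); lia.
have CL : (C <= nth 0 la r)%N.
  rewrite leqNgt; apply/negP => h.
  have : gap la (nth 0%N la r) <= z by rewrite (gap_le _ pl szN zN) -/B -CE; lia.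
  have := bead_gap r (nth 0%N la r) pl; rewrite ltnn.
  by have := bead_neq_gap r (nth 0%N la r) pl; rewrite /z; lia.
have -> : nth 0%N (core_to_bounded k la) r = (nth 0 la r - C)%N.
  rewrite nth_core_to_bounded.
  have -> : nth 0%N la r = (C + (nth 0 la r - C))%N by rewrite subnKC.
  rewrite iotaD count_cat add0n.
  have inC j : (j < nth 0 la r)%N -> (hook_length la (r, j) <= k)%N = ~~ (j < C)%N.
    move=> jr; have := hook_bead pl jr; have := @gap_le la N z j pl szN zN.
    by rewrite -/B -CE /z; lia.
  have -> : count (fun j => hook_length la (r, j) <= k)%N (iota 0 C) = 0%N.
    apply/eqP; rewrite -leqn0 leqNgt -has_count; apply/hasPn => j; rewrite mem_iota => jC.
    by rewrite inC ?negbK; lia.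
  rewrite add0n; have : all (fun j => hook_length la (r, j) <= k)%N (iota C (nth 0%N la r - C)).
    by apply/allP => j; rewrite mem_iota => jC; rewrite inC; lia.
  rewrite all_count size_iota => /eqP ->; lia.
by move: CE CL; rewrite /z /bead; lia.
Qed.

End Beads.

(** * Gap vectors of cores *)

Section Representation.
Variable k : nat.
Local Notation n := k.+2.
Local Notation cong := (cong k).
Local Notation flip := (flip k).
Local Notation bd := (core_to_bounded k.+1).
Implicit Types (la mu : seq nat) (T : 'I_n -> int).

Lemma card_ord_lt m : (m <= n)%N -> #|[pred q : 'I_n | (q < m)%N]| = m.
Proof.
move=> mn; rewrite cardE size_filter -(count_map val (fun q => q < m)%N) -enumT val_enum_ord.
rewrite -{1}(subnKC mn) iotaD count_cat add0n.
have -> : count (fun q => q < m)%N (iota 0 m) = m.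
  rewrite -{3}(size_iota 0 m); apply/eqP; rewrite -all_count; apply/allP => q.
  by rewrite mem_iota.
rewrite (_ : count _ (iota m _) = 0%N) ?addn0 //.
apply/eqP; rewrite -leqn0 leqNgt -has_count; apply/hasPn => q.
by rewrite mem_iota => /andP[h _]; rewrite -leqNgt.
Qed.

Lemma lt_card_le T (i : 'I_n) z : increasing T ->
  (i < #|[pred q | (T q <= z)%R]|)%N = (T i <= z).
Proof.
move=> iT; apply/idP/idP => h.
  rewrite leNgt; apply/negP => zi; move: h; rewrite ltnNge => /negP; apply.
  rewrite -{1}(card_ord_lt (ltnW (ltn_ord i))); apply: subset_leq_card.
  apply/fintype.subsetP => q; rewrite !inE => qz; rewrite ltnNge leq_eqVlt.
  by apply/negP => /orP[/eqP/val_inj e|/iT]; [rewrite -e in qz|]; lia.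
apply: leq_trans (_ : #|[pred q : 'I_n | (q < i.+1)%N]| <= _)%N.
  by rewrite card_ord_lt // ltn_ord.
apply: subset_leq_card; apply/fintype.subsetP => q; rewrite !inE ltnS leq_eqVlt.
by move=> /orP[/eqP/val_inj -> //|/iT]; lia.
Qed.

Lemma beads_subn T z : beads T (z - n%:Z) = (beads T z + #|[pred i | (z < T i)%R]|)%N.
Proof.
rewrite -sum1_card big_mkcond /= -big_split /=; apply: eq_bigr => i _.
rewrite (_ : T i - (z - n%:Z) - 1 = T i - z - 1 + n%:Z); last by lia.
rewrite pd_shift; congr addn; rewrite inE.
by rewrite (_ : (0 <= T i - z - 1) = (z < T i)); [case: (z < T i)|lia].
Qed.

Definition rep la T := forall N z, (size la <= N)%N -> - N%:Z - 1 <= z ->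
  nbeads la N z = beads T z.

Lemma rep_bead la T r i : is_part la -> valid T -> rep la T ->
  cong (T i) (bead la r) -> bead la r < T i.
Proof.
move=> pl vT rT ir; have := beads_pred vT ir.
pose N := (size la + r + 2)%N.
have h1 : (size la <= N)%N by rewrite /N; lia.
have h2 : - N%:Z - 1 <= bead la r - 1 by rewrite /N /bead; lia.
rewrite -!(rT N) //; last by lia.
case: ltP => // _; rewrite addn0 => e.
have := @lt_nbeads la N (bead la r - 1) r pl h1 h2; rewrite e lt_nbeads //; last by lia.
by rewrite ltxx ltrBlDr ltrDl.
Qed.

Lemma rep_gap la T c i : is_part la -> valid T -> rep la T ->
  cong (T i) (gap la c) -> T i <= gap la c.
Proof.
move=> pl vT rT ic; have := beads_pred vT ic.
have c1 : (nth 0%N (conj_part la) c <= size la)%N.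
  by rewrite leqNgt lt_conj // nth_default // -leqNgt.
pose N := (size la + 2)%N.
have h1 : (size la <= N)%N by rewrite /N; lia.
have h2 : - N%:Z - 1 <= gap la c - 1 by rewrite /N /gap; lia.
rewrite -!(rT N) //; last by lia.
suff -> : nbeads la N (gap la c - 1) = nbeads la N (gap la c).
  by case: ltP => // _ /eqP; rewrite -{1}[nbeads _ _ _]addn0 eqn_add2l.
apply: eq_lt_nat => r; rewrite !lt_nbeads //; last by lia.
by have := bead_neq_gap r c pl; lia.
Qed.

Lemma rep_core la T : is_part la -> valid T -> rep la T -> is_core n la.
Proof.
move=> pl vT rT; split=> // -[r c] rc h; have := hook_bead pl rc; rewrite h /= => e.
have [i ic] := distinct_onto (gap la c) vT.1.
have h1 := rep_gap pl vT rT ic.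
have : bead la r < T i.
  apply: rep_bead rT _ => //; rewrite (congl _ ic); apply/congP; exists (-1); lia.
lia.
Qed.

(** The n - 1 positions just below the bead represent each other class once. Such a position is a
    gap, hence a box of the boundary, exactly when the first gap of its class is below the bead. *)
Lemma nth_bounded_rep la T r : is_part la -> rep la T ->
  nth 0%N (bd la) r = #|[pred i | T i <= bead la r]|.
Proof.
move=> pl rT; pose N := (size la + r + n + 2)%N.
have h1 : (size la <= N)%N by rewrite /N; lia.
have h2 : - N%:Z - 1 <= bead la r - k.+1%:Z - 1 by rewrite /N /bead; lia.
have := bounded_nbeads pl h1 h2; rewrite rT //.
rewrite (_ : bead la r - _ - 1 = bead la r - n%:Z); last by lia.
rewrite beads_subn -(rT N) //; last by lia.
have -> : nbeads la N (bead la r) = r.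
  by apply: eq_lt_nat => q; rewrite lt_nbeads ?bead_lt //; lia.
have := cardC [pred i | T i <= bead la r]; rewrite card_ord.
have -> : #|[predC [pred i | T i <= bead la r]]| = #|[pred i | bead la r < T i]|.
  by apply: eq_card => i; rewrite !inE ltNge.
by move=> h e; apply: (@addIn #|[pred i | bead la r < T i]|); rewrite h; apply: (@addnI r); rewrite -e addnCA.
Qed.

Lemma size_bounded la : size (bd la) = size la.
Proof. by rewrite size_map size_iota. Qed.

Lemma bounded_rep la T : is_part la -> valid T -> rep la T -> k_bounded k.+1 (bd la).
Proof.
move=> pl vT rT; have beta r := nth_bounded_rep r pl rT.
have pb : is_part (bd la).
  apply/andP; split.
    apply/(sortedP 0%N) => r _ /=; rewrite !beta; apply: subset_leq_card.
    apply/fintype.subsetP => i; rewrite !inE.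
    by have := bead_lt r.+1 r pl; rewrite ltnSn; lia.
  apply/negP => /(nthP 0%N)[r]; rewrite size_bounded beta => rl /eqP; apply/negP.
  have [i ic] := distinct_onto (gap la 0) vT.1.
  rewrite -lt0n; apply/card_gt0P; exists i; rewrite inE.
  have := rep_gap pl vT rT ic; have := nth_part_gt0 r pl; rewrite rl.
  by rewrite -(lt_conj 0 r) // /gap /bead; lia.
rewrite /k_bounded pb; apply/allP => p /(nthP 0%N)[r _ <-]; rewrite beta.
have [i ir] := distinct_onto (bead la r) vT.1.
rewrite -ltnS -[X in (_ < X)%N]card_ord; apply: proper_card.
apply/properP; split; first by apply/fintype.subsetP => q.
by exists i => //; rewrite inE -ltNge; apply: rep_bead rT _.
Qed.

(** The gaps being sorted, row r reaches column i exactly when T i is at most the bead of row r. *)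
Lemma conj_bounded_rep la T (i : 'I_n) : is_part la -> valid T -> increasing T ->
  rep la T -> nth 0%N (conj_part (bd la)) i = beads T (T i).
Proof.
move=> pl vT iT rT; have /andP[pb _] := bounded_rep pl vT rT.
rewrite -(beads_self i vT); pose N := (size la + absz (T i))%N.
rewrite -(rT N); [|by rewrite /N; lia|by rewrite /N; lia].
apply: eq_lt_nat => r; rewrite lt_conj // (nth_bounded_rep _ pl rT) lt_card_le //.
by rewrite lt_nbeads //; rewrite /N; lia.
Qed.

Lemma sumn_bounded_rep la T : is_part la -> valid T -> increasing T ->
  rep la T -> sumn (bd la) = inv T.
Proof.
move=> pl vT iT rT; have /andP[pb /allP le] := bounded_rep pl vT rT.
rewrite (sumn_conj (m := n)) //; last first.
  case: (ltnP 0 (size (bd la))) => h; last by rewrite nth_default.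
  exact: leqW (le _ (mem_nth 0%N h)).
by apply: eq_bigr => i _; rewrite (conj_bounded_rep i pl vT iT rT).
Qed.

(** The difference is x / n rounded up: the first count gives it for positive x, the second for
    negative x. *)
Lemma pd_charge (x : int) :
  n%:Z * ((pd k (k.+1%:Z + x))%:Z - (pd k (- x))%:Z) = x + ((- x) %% n%:Z)%Z.
Proof.
have := divz_eq (- x) n%:Z; set q := (_ %/ _)%Z; set r := (_ %% _)%Z => e.
have r0 : 0 <= r by rewrite modz_ge0.
have rn : r < n%:Z by rewrite ltz_pmod.
have pdq (m : nat) t : 0 <= t < n%:Z -> pd k (m%:Z * n%:Z + t) = m.
  case: t => // t /andP[_ tn]; rewrite -PoszM -PoszD /= divnMDl // divn_small ?addn0 //.
case: (leP 0 q) => q0.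
  have -> : pd k (- x) = absz q by rewrite -(pdq (absz q) r) ?r0 //; congr (pd k _); lia.
  have -> : pd k (k.+1%:Z + x) = 0%N.
    apply: pd_neg; have : 0 <= q * n%:Z by rewrite mulr_ge0. lia.
  have -> : (absz q : int) = q by lia.
  by move: e; lia.
have -> : pd k (- x) = 0%N.
  apply: pd_neg; have : q * n%:Z <= (-1) * n%:Z by rewrite ler_pM2r //; lia. lia.
have -> : pd k (k.+1%:Z + x) = absz q.
  rewrite -(pdq (absz q) (k.+1%:Z - r)); last by lia.
  congr (pd k _); have -> : (absz q : int) = - q by lia.
  by rewrite mulNr; lia.
have -> : (absz q : int) = - q by lia.
by move: e; lia.
Qed.

(** The left side counts the gaps of T at or below -z - 2, and charge 0 relates these to the beads
    above -z - 2. Multiplication by n turns the roundings in [pd_charge] into residues, whose sum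
    over all classes is known. *)
Lemma beads_flip T z : valid T ->
  (beads (flip \o T) z)%:Z = (beads T (- z - 2))%:Z - z - 1.
Proof.
move=> vT; apply: (@mulfI _ n%:Z) => //.
rewrite -[LHS](subrK (n%:Z * (beads T (- z - 2))%:Z)) -mulrBr.
have -> : n%:Z * ((beads (flip \o T) z)%:Z - (beads T (- z - 2))%:Z) =
   \sum_i ((- z - 1 - T i) + ((T i + (z + 1)) %% n%:Z)%Z).
  rewrite /beads !(big_morph Posz PoszD (erefl 0%:Z)) -sumrB mulr_sumr.
  apply: eq_bigr => i _; rewrite (_ : T i + (z + 1) = - (- z - 1 - T i)); last by lia.
  rewrite -pd_charge /= /flip; congr (_ * (_%:Z - _%:Z)); congr (pd k _); lia.
rewrite big_split /=.
have -> : \sum_i ((T i + (z + 1)) %% n%:Z)%Z = \sum_(i < n) (i : nat)%:Z.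
  by apply: (@sum_residues k (fun i => T i + (z + 1))) => i j; rewrite congDr; apply: vT.1.
rewrite sumrB vT.2 subrK sumr_const card_ord -[_ *+ _]mulr_natl natz.
lia.
Qed.

Lemma rep_conj la T : is_part la -> valid T -> rep la T ->
  rep (conj_part la) (flip \o T).
Proof.
move=> pl vT rT N z h1 h2; apply/eqP; rewrite -eqz_nat beads_flip //; apply/eqP.
have pc := conj_is_part pl.
pose M := (size la + absz z + 1)%N.
have M1 : (size la <= M)%N by rewrite /M; lia.
have M2 : - M%:Z - 1 <= - z - 2 by rewrite /M; lia.
rewrite -(rT M) //; have := nbeads_ge pl M1 M2; set B := nbeads la M _ => B0.
suff -> : nbeads (conj_part la) N z = absz (B%:Z - z - 1)%R by lia.
apply: eq_lt_nat => c; rewrite lt_nbeads //.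
have := @gap_le la M (- z - 2) c pl M1 M2; rewrite -/B /gap /bead; lia.
Qed.

Lemma valid_ord : valid (fun i : 'I_n => (i : nat)%:Z).
Proof.
split=> // i j h; apply: val_inj => /=; have := ltn_ord i; have := ltn_ord j.
by move=> h1 h2; have := cong_small h; lia.
Qed.

Lemma nbeads_nil N z : - N%:Z - 1 <= z -> nbeads [::] N z = if z is Negz m then m else 0%N.
Proof.
move=> zN; apply: eq_lt_nat => r; rewrite lt_nbeads // /bead nth_nil.
by case: z zN => m; lia.
Qed.

(** For nonnegative entries with distinct residues, 0 + ... + (n - 1) is the least possible sum,
    reached only when each entry equals its residue. *)
Lemma valid_small T : valid T -> (forall i, 0 <= T i) -> forall i, T i < n%:Z.
Proof.
move=> vT ge i.
have mle (x : int) : 0 <= x -> 0 <= x - (x %% n%:Z)%Z.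
  by case: x => // m _; rewrite modz_nat subr_ge0 lez_nat leq_mod.
have sum0 : \sum_q (T q - (T q %% n%:Z)%Z) = 0.
  by rewrite sumrB [X in X - _]vT.2 (sum_residues vT.1) subrr.
have /eqP := psumr_eq0P (fun q _ => mle _ (ge q)) sum0 (i := i) isT.
by rewrite subr_eq0 => /eqP ->; rewrite ltz_pmod.
Qed.

(** For the flipped vector the upper bound is nonnegativity, so [valid_small] bounds T from both
    sides. *)
Lemma rep_nil T : valid T -> (forall i, T i < n%:Z) -> rep [::] T.
Proof.
move=> vT lt; have vf := flip_valid vT.
have ge i : 0 <= flip (T i) by rewrite /flip; have := lt i; lia.
have small := valid_small vf ge.
move=> N z _ zN; rewrite nbeads_nil //.
have zero T' y : (forall i, T' i < n%:Z) -> -1 <= y -> beads T' y = 0%N.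
  by move=> lt' y0; apply: big1 => i _; apply: pd_neg; have := lt' i; lia.
case: z zN => m zN; first by rewrite zero //.
apply/eqP; rewrite -eqz_nat; apply/eqP.
have := @beads_flip T (- (Negz m) - 2) vT; rewrite zero //; last by lia.
by rewrite (_ : - (- Negz m - 2) - 2 = Negz m); lia.
Qed.

(** A new first row of length T j shifts all beads down by one and places a bead at T j - 1, the
    shifted first gap of class j. *)
Definition add_row T (j : 'I_n) : 'I_n -> int :=
  fun i => if i == j then T i - 1 + n%:Z else T i - 1.

Lemma beads_add_row T j z :
  beads (add_row T j) z = (beads T (z + 1) + (z < T j - 1)%R)%N.
Proof.
rewrite /beads (bigD1 j) //= [in RHS](bigD1 j) //= /add_row eqxx.
rewrite (_ : T j - 1 + n%:Z - z - 1 = T j - (z + 1) - 1 + n%:Z); last by lia.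
rewrite pd_shift (_ : (0 <= T j - (z + 1) - 1) = (z < T j - 1)); last by lia.
rewrite addnAC; congr (_ + _ + _)%N; apply: eq_bigr => i /negbTE ->.
by congr (pd k _); lia.
Qed.

Lemma valid_add_row T j : valid T -> valid (add_row T j).
Proof.
case=> inj sumT; split=> [p q|].
  have c1 i : cong (add_row T j i) (T i - 1).
    by rewrite /add_row; case: ifP => _; rewrite ?congxx //; apply/congP; exists 1; lia.
  rewrite (congl _ (c1 p)) (congr _ (c1 q)) (@cong_addr _ _ _ (T p) (T q)); last by lia.
  exact: inj.
rewrite -sumT (bigD1 j) //= [in RHS](bigD1 j) //= {1}/add_row eqxx.
rewrite (eq_bigr (fun i => T i - 1)) => [|i /negbTE h]; last by rewrite /add_row h.
rewrite sumrB sumr_const -[_ *+ _]mulr_natl natz.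
have := cardC1 j; rewrite card_ord => -> /=; move: (\sum_(i | _) T i) => X; lia.
Qed.

Lemma nbeads_cons L la N z : 
  nbeads (L :: la) N.+1 z = ((z < L%:Z - 1)%R + nbeads la N (z + 1))%N.
Proof.
rewrite /nbeads /= /bead /= subr0; congr addn.
rewrite -[1%N]addn0 iotaDl count_map; apply: eq_count => r; rewrite /= add1n add0n /=; lia.
Qed.

Lemma rep_cons L la T j : L%:Z = T j -> rep la T -> rep (L :: la) (add_row T j).
Proof.
move=> Lj rT [|N] z // szN zN.
rewrite nbeads_cons beads_add_row Lj addnC rT //; lia.
Qed.

Lemma hook_cons L la r c : is_part (L :: la) -> (c < nth 0 la r)%N ->
  hook_length (L :: la) (r.+1, c) = hook_length la (r, c).
Proof.
move=> pl cr; have [L0 pl' le] := is_part_cons pl.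
apply/eqP; rewrite -eqz_nat !hook_bead //; apply/eqP.
have cL : (c < L)%N by apply: leq_trans cr (leq_trans (nth_part pl' (leq0n r)) le).
rewrite /gap !nth_conj //= cL /bead /=; lia.
Qed.

Lemma bounded_cons L la : is_part (L :: la) ->
  bd (L :: la) = count (fun j => hook_length (L :: la) (0%N, j) <= k.+1)%N (iota 0 L) :: bd la.
Proof.
move=> pl; rewrite {1}/core_to_bounded /=; congr cons.
rewrite -[1%N]addn0 iotaDl -map_comp; apply/eq_in_map => r _ /=.
by apply: eq_in_count => c; rewrite mem_iota => cr; rewrite hook_cons.
Qed.

Lemma core_tail L la : is_core n (L :: la) -> is_core n la.
Proof.
move=> [pl h]; have [_ pl' _] := is_part_cons pl; split=> // -[r c] rc.
by rewrite -(hook_cons pl rc); apply: h.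
Qed.

(** Position L is a gap of the tail, so its class has first gap T j <= L. If T j < L, then L - n is
    a gap too, and with the new bead it would form a hook of length n. *)
Lemma core_head L la T : is_core n (L :: la) -> valid T -> rep la T ->
  exists j, L%:Z = T j.
Proof.
move=> [pl hc] vT rT; have [L0 pl' le] := is_part_cons pl.
have [j jL] := distinct_onto L%:Z vT.1; exists j.
have jle : T j <= L%:Z.
  rewrite leNgt; apply/negP => lt; have := beads_pred vT jL; rewrite lt.
  rewrite -!(rT (size la)) //; try by lia.
  have := @lt_nbeads la (size la) (L%:Z - 1) 0%N pl'; rewrite /bead; lia.
case: (ltgtP (T j) L%:Z) jle => // lt _; exfalso.
have jn := cong_lt jL lt; pose z := L%:Z - 1 - n%:Z.
have [i iz] := distinct_onto (z + 1) vT.1.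
have zj : cong (z + 1) (T j) by rewrite congC (congl _ jL); apply/congP; exists 1; rewrite /z; lia.
have := beads_pred vT (_ : cong (T j) (z + 1)); rewrite addrK => /(_ _).
rewrite congC => /(_ zj); rewrite (_ : (z + 1 < T j) = false) ?addn0; last by rewrite /z; lia.
pose N := (size la + n + 2)%N.
rewrite -!(rT N); try by rewrite /N /z; lia.
move=> e1; pose B := nbeads (L :: la) N.+1.
have e : B z = B (z - 1).
  by rewrite /B !nbeads_cons subrK -e1; congr addn; rewrite /z; lia.
have sz : (size (L :: la) <= N.+1)%N by rewrite /N /=; lia.
have zN : - N.+1%:Z - 1 <= z - 1 by rewrite /N /z; lia.
have B0 := nbeads_ge pl sz zN; rewrite -/(B _) in B0.
(* By [gap_le] this is the number of gaps below z, hence the index of the column whose gap is z. *)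
pose c := absz (z - 1 + 1 + (B (z - 1)%R)%:Z)%R.
have g1 := @gap_le (L :: la) N.+1 (z - 1) c pl sz zN.
have zN' : - N.+1%:Z - 1 <= z by lia.
have g2 := @gap_le (L :: la) N.+1 z c pl sz zN'; rewrite -!/(B _) in g1 g2.
have gz : gap (L :: la) c = z by move: g1 g2; rewrite e /c; lia.
have cL : (c < nth 0 (L :: la) 0)%N by rewrite -bead_gap // gz /bead /= /z; lia.
apply: (hc (0%N, c) cL); apply/eqP; rewrite -eqz_nat hook_bead // gz /bead /= /z.
by apply/eqP; lia.
Qed.

Lemma increasing_relabel T : valid T ->
  exists T', [/\ valid T', increasing T' & forall z, beads T' z = beads T z].
Proof.
move=> [inj sumT]; pose s := sort <=%R (codom T).
have ps : perm_eq s (codom T) by rewrite perm_sort.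
have ss : size s = n by rewrite size_sort size_codom card_ord.
pose T' (i : 'I_n) := nth 0 s i.
have sT' : [seq T' i | i <- enum 'I_n] = s.
  apply: (@eq_from_nth _ 0); first by rewrite size_map -cardE card_ord ss.
  move=> i; rewrite size_map -cardE card_ord => ik.
  by rewrite (nth_map ord0) ?size_enum_ord // /T' nth_enum_ord.
have sums (V : nmodType) (f : int -> V) : \sum_i f (T' i) = \sum_i f (T i).
  have E U : \sum_i f (U i) = \sum_(x <- [seq U i | i <- enum 'I_n]) f x.
    by rewrite big_map big_enum.
  by rewrite (E T') (E T) sT'; apply: perm_big.
have ur : uniq [seq residue k x | x <- s].
  rewrite (perm_uniq (perm_map _ ps)) -map_comp map_inj_uniq ?enum_uniq //.
  by move=> i j /eqP /=; rewrite eq_residue; apply: inj.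
have inj' : distinct T'.
  move=> i j; rewrite -eq_residue => /eqP e; apply/val_inj/eqP => /=.
  rewrite -(nth_uniq ord0 _ _ ur) ?size_map ?ss //.
  by rewrite !(nth_map 0) ?ss //; apply/eqP.
exists T'; split=> [|i j ij|z]; first by split=> //; rewrite -sumT (sums _ id).
  have : T' i <= T' j.
    have srt : sorted <=%R s by apply: sort_sorted; exact: le_total.
    by apply: (sorted_leq_nth le_trans lexx) => //; rewrite ?inE ?ss //; apply: ltnW.
  rewrite le_eqVlt => /orP[/eqP e|//].
  by have := inj' i j; rewrite e congxx => /(_ isT) ij'; rewrite ij' ltnn in ij.
by rewrite /beads (sums _ (fun x => pd k (x - z - 1))).
Qed.

Lemma rep_eq la T T' : (forall z, beads T' z = beads T z) -> rep la T -> rep la T'.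
Proof. by move=> e rT N z h1 h2; rewrite e rT. Qed.

Lemma exists_rep la : is_core n la -> exists T, [/\ valid T, increasing T & rep la T].
Proof.
move=> cl; suff [T [vT rT]] : exists T, valid T /\ rep la T.
  have [T' [vT' iT' e]] := increasing_relabel vT.
  by exists T'; split=> //; apply: rep_eq rT.
elim: la cl => [_|L la IH cl].
  by exists (fun i => (i : nat)%:Z); split; [exact: valid_ord|apply: rep_nil valid_ord _ => i; rewrite ltz_nat].
have [T [vT rT]] := IH (core_tail cl).
have [j Lj] := core_head cl vT rT.
by exists (add_row T j); split; [apply: valid_add_row|apply: rep_cons].
Qed.

Lemma rep_unique la mu T : is_part la -> is_part mu -> rep la T -> rep mu T -> la = mu.
Proof.
move=> pl pm rl rm; apply: eq_part => // r.
pose N := (size la + size mu + r)%N.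
have e z : - N%:Z - 1 <= z -> (z < bead la r) = (z < bead mu r).
  move=> zN; rewrite -!(lt_nbeads (N := N)) ?rl ?rm //; rewrite /N; lia.
have h1 : - N%:Z - 1 <= bead la r by rewrite /N /bead; lia.
have h2 : - N%:Z - 1 <= bead mu r by rewrite /N /bead; lia.
by have := e _ h1; have := e _ h2; rewrite !ltxx /bead; lia.
Qed.

End Representation.

(** * Cores and bounded partitions *)

Section Bijection.
Variable k : nat.
Local Notation n := k.+2.
Local Notation flip := (flip k).
Local Notation bd := (core_to_bounded k.+1).
Implicit Types (la mu : seq nat) (T : 'I_n -> int).

Lemma sum_ord_double m : (\sum_(i < m) (i : nat)%:Z) *+ 2 = m%:Z * (m%:Z - 1).
Proof.
elim: m => [|m IH]; first by rewrite big_ord0 mul0rn mul0r.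
by rewrite big_ord_recr /= mulrnDl IH; lia.
Qed.

Definition sub_row T (j : 'I_n) : 'I_n -> int :=
  fun i => if i == j then T i + 1 - n%:Z else T i + 1.

Lemma sub_rowK T j : add_row (sub_row T j) j = T.
Proof. by apply/funext => i; rewrite /add_row /sub_row; case: eqP => _; lia. Qed.

Lemma valid_sub_row T j : valid T -> valid (sub_row T j).
Proof.
case=> inj sumT; split=> [p q|].
  have c1 i : cong k (sub_row T j i) (T i + 1).
    by rewrite /sub_row; case: ifP => _; rewrite ?congxx //; apply/congP; exists (-1); lia.
  by rewrite (congl _ (c1 p)) (congr _ (c1 q)) congDr; apply: inj.
rewrite -sumT (bigD1 j) //= [in RHS](bigD1 j) //= {1}/sub_row eqxx.
rewrite (eq_bigr (fun i => T i + 1)) => [|i /negbTE h]; last by rewrite /sub_row h.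
rewrite big_split /= sumr_const -[_ *+ _]mulr_natl natz.
have := cardC1 j; rewrite card_ord => -> /=; move: (\sum_(i | _) T i) => X; lia.
Qed.

(** The termination measure for [exists_core], where first rows are stripped off one after
    another. *)
Definition sqsum T : int := \sum_i T i * T i.

Lemma sqsum_sub_row T j : valid T -> n%:Z <= T j -> sqsum (sub_row T j) < sqsum T.
Proof.
move=> vT jn; have e : \sum_i (sub_row T j i * sub_row T j i - T i * T i) =
    \sum_i (T i *+ 2 + 1) + ((T j + 1 - n%:Z) * (T j + 1 - n%:Z) - (T j + 1) * (T j + 1)).
  rewrite (bigD1 j) //= [in RHS](bigD1 j) //= {1 2}/sub_row eqxx.
  rewrite (eq_bigr (fun i => T i *+ 2 + 1)) => [|i /negbTE h]; last first.
    by rewrite /sub_row h; lia.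
  by move: (\sum_(i | _) _) => X; lia.
rewrite -subr_lt0 /sqsum -sumrB e big_split /= sumrMnl vT.2 sum_ord_double.
rewrite sumr_const card_ord -[_ *+ _]mulr_natl natz.
have -> : n%:Z * (n%:Z - 1) + n%:Z * 1 + ((T j + 1 - n%:Z) * (T j + 1 - n%:Z) - (T j + 1) * (T j + 1))
   = n%:Z * (2 * (n%:Z - 1 - T j)) by lia.
by rewrite pmulr_rlt0 //; lia.
Qed.

Lemma exists_core T : valid T -> exists la, is_part la /\ rep la T.
Proof.
have [m] := ubnP (absz (sqsum T)); elim: m T => // m IH T lem vT.
have [small|/forallPn /= [i]] := boolP [forall i, T i < n%:Z].
  by exists [::]; split=> //; apply: rep_nil => // i; apply: (forallP small).
rewrite -leNgt => ni.
(* The largest first gap T j comes with the largest bead T j - n, which is the bead of a first row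
   of length T j - n + 1. *)
have [j jmax] : exists j, forall q, T q <= T j.
  by case: (arg_maxP T (isT : xpredT i)) => j _ jmax; exists j => q; apply: jmax.
have nj : n%:Z <= T j by apply: le_trans ni (jmax i).
have pos U : 0 <= sqsum U by apply: sumr_ge0 => q _; rewrite -expr2 sqr_ge0.
have lt : (absz (sqsum (sub_row T j)) < m)%N.
  by have := sqsum_sub_row vT nj; have := pos T; have := pos (sub_row T j); lia.
have [la [pl rl]] := IH _ lt (valid_sub_row j vT).
pose L := absz (T j + 1 - n%:Z)%R.
have LE : L%:Z = sub_row T j j by rewrite /sub_row eqxx /L; lia.
exists (L :: la); split; last by rewrite -(sub_rowK T j); apply: rep_cons.
apply: is_part_consE => //; first by move: LE; rewrite /sub_row eqxx; lia.
have : beads (sub_row T j) (L%:Z - 1) = 0%N.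
  apply: big1 => q _; apply: pd_neg; rewrite LE /sub_row eqxx.
  case: eqP => [->|/eqP qj]; first by lia.
  have := jmax q; rewrite le_eqVlt => /orP[/eqP e|]; last by lia.
  by case/eqP: qj; apply: vT.1; rewrite e congxx.
rewrite -(rl (size la)) //; last by lia.
by have := @lt_nbeads la (size la) (L%:Z - 1) 0%N pl (leqnn _); rewrite /bead; lia.
Qed.

(** The first part is the rank of the gap taken by the new row. A core and its bounded partition
    therefore determine each other row by row, and both halves of the bijection rest on this. *)
Lemma bounded_head L la T j : is_part (L :: la) -> valid T -> increasing T ->
  rep la T -> L%:Z = T j -> nth 0%N (bd (L :: la)) 0 = j.
Proof.
move=> pl vT iT rT Lj; rewrite (nth_bounded_rep _ pl (rep_cons Lj rT)).
rewrite -(@card_ord_lt k j (ltnW (ltn_ord j))); apply: eq_card => i; rewrite !inE.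
rewrite /bead /= Lj /add_row; case: eqP => [->|/eqP ij]; first by rewrite ltnn; lia.
case: (ltngtP i j) => [/iT|/iT|/val_inj e]; try by lia.
by rewrite e eqxx in ij.
Qed.

Lemma core_to_bounded_inj la mu : is_core n la -> is_core n mu ->
  bd la = bd mu -> la = mu.
Proof.
elim: la mu => [|L la IH] [|M mu] // cl cm; have [pl _] := cl; have [pm _] := cm.
rewrite !bounded_cons // => e; have {}IH := IH mu (core_tail cl) (core_tail cm).
have [T [vT iT rT]] := exists_rep (core_tail cl).
have [j Lj] := core_head cl vT rT; have := e; case=> _ /IH em; rewrite -em in cm pm e *.
have [j' Mj] := core_head cm vT rT.
have := bounded_head pl vT iT rT Lj; have := bounded_head pm vT iT rT Mj.
rewrite !bounded_cons // e /= => -> /val_inj jj.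
by congr cons; apply/eqP; rewrite -eqz_nat Lj Mj jj.
Qed.

Lemma core_to_bounded_onto be : k_bounded k.+1 be ->
  exists2 la, is_core n la & bd la = be.
Proof.
elim: be => [|p be IH] /andP[pb ab].
  by exists [::] => //; split=> // -[r c]; rewrite /diagram /= nth_nil.
have [p0 pb' le] := is_part_cons pb; case/andP: ab => pk ab.
have [|la cl e] := IH; first by rewrite /k_bounded pb'.
have [T [vT iT rT]] := exists_rep cl; have [pl _] := cl.
have pn : (p < n)%N by [].
pose j := Ordinal pn.
have b0 := nth_bounded_rep 0 pl rT.
have j0 (i : 'I_n) : (nth 0%N be 0 <= i)%N -> bead la 0 < T i.
  by rewrite -e b0 ltNge -(lt_card_le _ _ iT) -leqNgt.
have Tj : (nth 0%N la 0 : int) <= T j by have := j0 j le; rewrite /bead; lia.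
have Tj0 : 0 < T j.
  case: la cl e rT pl b0 j0 Tj => [|L la] cl e rT pl b0 j0 Tj.
    have := iT ord0 j p0; have := j0 ord0; rewrite -e /bead nth_nil => /(_ isT); lia.
  by have [L0 _ _] := is_part_cons pl; move: Tj => /=; lia.
pose L := absz (T j); have Lj : L%:Z = T j by rewrite /L; lia.
have pL : is_part (L :: la) by apply: is_part_consE => //; lia.
have rL := rep_cons Lj rT; have vL := valid_add_row j vT.
exists (L :: la); first exact: rep_core rL.
have := bounded_head pL vT iT rT Lj; rewrite bounded_cons //= => ->.
by rewrite e.
Qed.

Lemma bounded_coreP be : k_bounded k.+1 be ->
  is_core n (bounded_to_core k.+1 be) /\ bd (bounded_to_core k.+1 be) = be.
Proof.
case/core_to_bounded_onto=> la cl e; apply: (@xgetPex _ [::] [set mu | is_core n mu /\ bd mu = be]%classic).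
by exists la.
Qed.

Lemma core_bounded la : is_core n la -> k_bounded k.+1 (bd la).
Proof.
by move=> cl; have [T [vT _ rT]] := exists_rep cl; apply: bounded_rep rT; case: cl.
Qed.

Lemma core_to_boundedK la : is_core n la -> bounded_to_core k.+1 (bd la) = la.
Proof.
by move=> cl; have [c e] := bounded_coreP (core_bounded cl); apply: core_to_bounded_inj.
Qed.

Lemma conj_core la : is_core n la -> is_core n (conj_part la).
Proof.
move=> cl; have [T [vT _ rT]] := exists_rep cl; have [pl _] := cl.
apply: rep_core (conj_is_part pl) (flip_valid vT) (rep_conj pl vT rT).
Qed.

Lemma k_conjE la : is_core n la -> k_conj k.+1 (bd la) = bd (conj_part la).
Proof. by move=> cl; rewrite /k_conj core_to_boundedK. Qed.

Lemma k_conj_bounded be : k_bounded k.+1 be -> k_bounded k.+1 (k_conj k.+1 be).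
Proof.
by case/bounded_coreP=> c e; apply/core_bounded/conj_core.
Qed.

Lemma k_conjK be : k_bounded k.+1 be -> k_conj k.+1 (k_conj k.+1 be) = be.
Proof.
case/bounded_coreP=> c e; rewrite {2}/k_conj k_conjE; last exact: conj_core.
by rewrite conj_partK //; case: c.
Qed.

End Bijection.

(** * The Pieri rule as a rule for words *)

Section Strips.
Implicit Types (la mu nu : seq nat).
Local Open Scope nat_scope.

Lemma diagram_sub mu nu : (diagram mu `<=` diagram nu)%classic <->
  forall r, nth 0 mu r <= nth 0 nu r.
Proof.
split=> [sub r|le [r c] /=]; last by move=> h; apply: leq_trans (le r).
by rewrite leqNgt; apply/negP => h; have := sub (r, nth 0 nu r) h; rewrite /diagram /= ltnn.
Qed.

Lemma vertical_stripP mu nu : vertical_strip mu nu <->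
  forall r, nth 0 mu r <= nth 0 nu r <= (nth 0 mu r).+1.
Proof.
split=> [[/diagram_sub le one] r|le].
  rewrite le /= leqNgt; apply/negP => h.
  have : (r, nth 0 mu r) = (r, (nth 0 mu r).+1).
    by apply: one => //; rewrite /diagram /setD /=; split; try apply/negP; lia.
  by case; lia.
split; first by apply/diagram_sub => r; case/andP: (le r).
move=> [r c] [r' c']; rewrite /diagram /setD /= => -[h1 h2] [h3 h4] e; subst r'.
by congr pair; have := le r; lia.
Qed.

Lemma horizontal_stripP mu nu : is_part mu -> is_part nu -> horizontal_strip mu nu <->
  forall i, nth 0 (conj_part mu) i <= nth 0 (conj_part nu) i <= (nth 0 (conj_part mu) i).+1.
Proof.
move=> pm pn; split=> [[/diagram_sub le one] i|le].
  apply/andP; split.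
    rewrite leqNgt lt_conj // -leqNgt; apply: leq_trans (le _) _.
    by rewrite leqNgt -lt_conj // ltnn.
  rewrite leqNgt; apply/negP => h.
  have h1 : nth 0 mu (nth 0 (conj_part mu) i) <= i by rewrite leqNgt -lt_conj // ltnn.
  have h2 := nth_part pm (leqnSn (nth 0 (conj_part mu) i)).
  have h3 : i < nth 0 nu (nth 0 (conj_part mu) i).+1 by rewrite -lt_conj.
  have h4 := nth_part pn (leqnSn (nth 0 (conj_part mu) i)).
  have : (nth 0 (conj_part mu) i, i) = ((nth 0 (conj_part mu) i).+1, i).
    by apply: one => //; rewrite /diagram /setD /=; split; try apply/negP; lia.
  by case; lia.
split.
  apply/diagram_sub => r; rewrite leqNgt -lt_conj //; apply/negP => h.
  have := le (nth 0 nu r); have := h; rewrite lt_conj // => h'.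
  have := lt_conj (nth 0 nu r) r pn; rewrite ltnn; lia.
move=> [r c] [r' c']; rewrite /diagram /setD /= => -[h1 h2] [h3 h4] e; subst c'.
rewrite -(lt_conj c r pn) in h1; rewrite -(lt_conj c r pm) in h2.
rewrite -(lt_conj c r' pn) in h3; rewrite -(lt_conj c r' pm) in h4.
by congr pair; have := le c; lia.
Qed.

Lemma conj_leS mu nu : is_part mu -> is_part nu ->
  (forall r, nth 0 nu r <= (nth 0 mu r).+1) <->
  (forall i, nth 0 (conj_part nu) i.+1 <= nth 0 (conj_part mu) i).
Proof.
move=> pm pn; split=> le => [i|r].
  rewrite leqNgt lt_conj // -leqNgt; apply: leq_trans (le _) _; rewrite ltnS.
  by rewrite leqNgt -lt_conj // ltnn.
rewrite leqNgt -lt_conj // -leqNgt; apply: leq_trans (le _) _.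
by rewrite leqNgt lt_conj // ltnn.
Qed.

Lemma conj_le mu nu : is_part mu -> is_part nu ->
  (forall r, nth 0 mu r <= nth 0 nu r) <->
  (forall i, nth 0 (conj_part mu) i <= nth 0 (conj_part nu) i).
Proof.
move=> pm pn; split=> le => [i|r].
  rewrite leqNgt lt_conj // -leqNgt; apply: leq_trans (le _) _.
  by rewrite leqNgt -lt_conj // ltnn.
rewrite leqNgt -lt_conj // -leqNgt; apply: leq_trans (le _) _.
by rewrite leqNgt lt_conj // ltnn.
Qed.

End Strips.

Section PieriWords.
Variable k : nat.
Local Notation n := k.+2.
Local Notation K := k.+1.
Local Notation flip := (flip k).
Local Notation act := (act k).
Local Notation bd := (core_to_bounded k.+1).
Implicit Types (la mu nu : seq nat) (T : 'I_n -> int) (A : {set 'I_n}).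

Definition core_of T : seq nat := xget [::] [set la | is_part la /\ rep la T]%classic.

Lemma core_ofP T : valid T -> is_part (core_of T) /\ rep (core_of T) T.
Proof.
case/exists_core=> la h; apply: (@xgetPex _ [::] [set la | is_part la /\ rep la T]%classic).
by exists la.
Qed.

Lemma core_of_core T : valid T -> is_core n (core_of T).
Proof. by move=> vT; have [p r] := core_ofP vT; apply: rep_core r. Qed.

Lemma core_ofE la T : valid T -> is_part la -> rep la T -> core_of T = la.
Proof. by move=> vT pl rT; have [p r] := core_ofP vT; apply: rep_unique r rT. Qed.

Definition bounded_of T : seq nat := bd (core_of T).

#[local] Opaque core_of.

Lemma bounded_of_bounded T : valid T -> k_bounded K (bounded_of T).
Proof. by move/core_of_core; apply: core_bounded. Qed.

Lemma sumn_bounded_of T : valid T -> increasing T -> sumn (bounded_of T) = inv T.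
Proof. by move=> vT iT; have [p r] := core_ofP vT; apply: sumn_bounded_rep. Qed.

Lemma conj_bounded_of T (i : 'I_n) : valid T -> increasing T ->
  nth 0%N (conj_part (bounded_of T)) i = beads T (T i).
Proof. by move=> vT iT; have [p r] := core_ofP vT; apply: conj_bounded_rep. Qed.

Lemma exists_bounded_of la : k_bounded K la ->
  exists T, [/\ valid T, increasing T & bounded_of T = la].
Proof.
case/bounded_coreP=> cl e; have [T [vT iT rT]] := exists_rep cl.
by exists T; split=> //; rewrite /bounded_of (core_ofE vT _ rT) //; case: cl.
Qed.

(** [flip] reverses the order of the gaps, so [rev_ord] is needed to keep increasing vectors
    increasing. *)
Definition conj_gaps T : 'I_n -> int := flip \o T \o (@rev_ord n).

Lemma beads_conj_gaps T z : beads (conj_gaps T) z = beads (flip \o T) z.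
Proof. by rewrite [RHS](reindex_inj rev_ord_inj). Qed.

Lemma conj_gaps_valid T : valid T -> valid (conj_gaps T).
Proof.
move/flip_valid => [inj s]; split; first by move=> i j /inj /rev_ord_inj.
by rewrite -s [RHS](reindex_inj rev_ord_inj).
Qed.

Lemma conj_gaps_increasing T : increasing T -> increasing (conj_gaps T).
Proof.
move=> iT i j ij; have : (rev_ord j < rev_ord i)%N by rewrite /=; have := ltn_ord j; lia.
by move/iT; rewrite /conj_gaps /flip /=; lia.
Qed.

Lemma conj_gapsK T : conj_gaps (conj_gaps T) = T.
Proof. by apply/funext => i; rewrite /conj_gaps /= flipK rev_ordK. Qed.

Lemma core_of_conj T : valid T -> core_of (conj_gaps T) = conj_part (core_of T).
Proof.
move=> vT; have [p r] := core_ofP vT; apply: core_ofE.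
- exact: conj_gaps_valid.
- exact: conj_is_part.
by apply: rep_eq (rep_conj p vT r) => z; rewrite beads_conj_gaps.
Qed.

Lemma k_conj_bounded_of T : valid T -> k_conj K (bounded_of T) = bounded_of (conj_gaps T).
Proof. by move=> vT; rewrite /bounded_of k_conjE ?core_of_conj //; apply: core_of_core. Qed.

(** After transposition this column counts the gaps of T at or below T i - 1 - n. There are T i +
    [beads T (T i)] gaps below T i, and i of them lie in the last n positions. *)
Lemma conj_k_conj T (i : 'I_n) : valid T -> increasing T ->
  (nth 0%N (conj_part (k_conj K (bounded_of T))) (rev_ord i))%:Z =
  T i + (beads T (T i))%:Z - (i : nat)%:Z.
Proof.
move=> vT iT; rewrite k_conj_bounded_of // conj_bounded_of; last 2 first.
- exact: conj_gaps_valid.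
- exact: conj_gaps_increasing.
rewrite beads_conj_gaps /conj_gaps /= rev_ordK beads_flip //.
rewrite (_ : - flip (T i) - 2 = T i - 1 - n%:Z); last by rewrite /flip; lia.
rewrite beads_subn beads_self //.
have -> : #|[pred q | T i - 1 < T q]| = (n - i)%N.
  have := cardC [pred q : 'I_n | (q < i)%N]; rewrite card_ord card_ord_lt; last exact: ltnW.
  have -> : #|[predC [pred q : 'I_n | (q < i)%N]]| = #|[pred q | T i - 1 < T q]|.
    apply: eq_card => q; rewrite !inE -leqNgt.
    case: (ltngtP i q) => [/iT|/iT|/val_inj ->]; lia.
  by move=> h; apply: (@addnI i); rewrite h subnKC // ltnW.
by have := ltn_ord i; rewrite /flip; lia.
Qed.

Lemma bounded_conj0 la i : k_bounded K la -> (K <= i)%N -> nth 0%N (conj_part la) i = 0%N.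
Proof.
move=> /andP[pl /allP al] Ki; apply/eqP; rewrite -leqn0 leqNgt lt_conj // -leqNgt.
case: (ltnP 0 (size la)) => h; last by rewrite nth_default.
exact: leq_trans (al _ (mem_nth 0%N h)) Ki.
Qed.

Definition asc_word A := asc (cut A) A.

(** The horizontal strip lets each bead count [beads T (T q)] grow by at most 1, and containment of
    the k-conjugates says that T q plus this count does not decrease. So no gap drops by more than
    1, and [ascending_determined] applies. *)
Lemma pieri_word T l nu : valid T -> increasing T -> (l <= K)%N ->
  pieri_set K l (bounded_of T) nu ->
  exists A, [/\ #|A| = l, reduced (asc_word A) T & nu = bounded_of (act (asc_word A) \o T)].
Proof.
move=> vT iT lK [bn sn hs vs].
have [T' [vT' iT' e]] := exists_bounded_of bn; subst nu.
have bT := bounded_of_bounded vT; have bT' := bounded_of_bounded vT'.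
have /andP[pT _] := bT; have /andP[pT' _] := bT'.
have /andP[pc _] := k_conj_bounded bT; have /andP[pc' _] := k_conj_bounded bT'.
rewrite !sumn_bounded_of // in sn.
move/(horizontal_stripP pT pT'): hs => hs.
have R q : (beads T (T q) <= beads T' (T' q) <= (beads T (T q)).+1)%N.
  by have := hs q; rewrite !conj_bounded_of.
have Q q : T q + (beads T (T q))%:Z <= T' q + (beads T' (T' q))%:Z.
  have /conj_le := fun r => proj1 (andP (proj1 (vertical_stripP _ _) vs r)).
  move/(_ pc pc' (rev_ord q)); have := conj_k_conj q vT iT; have := conj_k_conj q vT' iT'; lia.
have bound q : T q - 1 <= T' q by have := R q; have := Q q; lia.
pose D := [set q | T' q == T q - 1].
pose A := [set residue k (T q - 1) | q in D].
have cA : #|A| = #|D|.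
  rewrite card_in_imset // => p q _ _ /eqP; rewrite eq_residue congDr; exact: vT.1.
(* A gap that drops gains a bead above it, and there are l gains in all. Equality follows below,
   since a word of length #|A| raises [inv] by at most #|A|. *)
have Dl : (#|D| <= l)%N.
  rewrite -(leq_add2l (inv T)) -sn -sum1_card big_mkcond /= -big_split /=.
  apply: leq_sum => q _; rewrite inE; have := R q; have := Q q.
  by case: eqP => [->|_]; lia.
have An : (#|A| < n)%N by rewrite cA; lia.
have xA := cutP An.
have TE : T' =1 act (asc_word A) \o T.
  apply: (ascending_determined (asc_ascending (cut A) A)) => // z.
  rewrite mem_class_asc //; split=> [/imsetP[q]|[q [qz e]]].
    rewrite inE => /eqP e /eqP; rewrite eq_residue => zq; exists q; split=> //.
    by rewrite congC (@cong_addr _ _ _ z (T q - 1)) //; lia.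
  apply/imsetP; exists q; first by rewrite inE e.
  by apply/eqP; rewrite eq_residue congC (@cong_addr _ _ _ (T q) (z + 1)) //; lia.
have {}TE : T' = act (asc_word A) \o T by apply/funext.
have le := inv_act_le (asc_word A) vT.
rewrite -TE sn size_asc // cA in le.
have Al : #|A| = l by rewrite cA; lia.
by exists A; split; rewrite -?TE //; rewrite /reduced -TE sn size_asc // Al.
Qed.

Lemma beads_drop T z m : valid T -> (beads T z <= beads T (z + m%:Z) + m)%N.
Proof.
move=> vT; elim: m => [|m IH]; first by rewrite addr0 addn0.
apply: leq_trans IH _; rewrite addnS -addSn leq_add2r.
by have := beads_le1 (z + m%:Z) vT; rewrite addn1 (_ : z + m%:Z + 1 = z + m.+1%:Z) //; lia.
Qed.

Lemma word_pieri T A : valid T -> increasing T -> (#|A| <= K)%N ->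
  reduced (asc_word A) T ->
  pieri_set K #|A| (bounded_of T) (bounded_of (act (asc_word A) \o T)).
Proof.
move=> vT iT AK rA; set T' := act (asc_word A) \o T.
have xA : residue k (cut A) \notin A by apply: cutP.
have vT' : valid T' := act_valid _ vT.
have iT' : increasing T' := act_increasing vT iT rA.
have spec q := ascending_reduced q (asc_ascending (cut A) A) vT rA.
have bound q : T q - 1 <= T' q := ascending_ge (T q) (asc_ascending (cut A) A).
have E q : (beads T' (T' q) = beads T (T q) + (T' q < T q)%R)%N := (spec q).1.
have gaps q p : T q < p <= T' q -> exists2 j, cong k (T j) p & T j < T q := (spec q).2 p.
have invT' : inv T' = (inv T + #|A|)%N by rewrite (eqP rA) size_asc.
clearbody T'; clear spec rA xA.
have bT := bounded_of_bounded vT; have bT' := bounded_of_bounded vT'.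
have /andP[pT _] := bT; have /andP[pT' _] := bT'.
have /andP[pc _] := k_conj_bounded bT; have /andP[pc' _] := k_conj_bounded bT'.
split=> //.
- by rewrite !sumn_bounded_of.
- apply/horizontal_stripP => // i; case: (ltnP i n) => ni.
    by have /= -> := conj_bounded_of (Ordinal ni) vT iT; have /= -> := conj_bounded_of (Ordinal ni) vT' iT'; rewrite E; case: (_ < _); lia.
  by rewrite !bounded_conj0 //; apply: ltnW.
have le r : (nth 0 (k_conj K (bounded_of T)) r <= nth 0 (k_conj K (bounded_of T')) r)%N.
  move: r; apply/(conj_le pc pc') => i; case: (ltnP i n) => ni; last first.
    rewrite (bounded_conj0 (k_conj_bounded bT) (ltnW ni)); exact: leq0n.
  have := conj_k_conj (rev_ord (Ordinal ni)) vT iT; rewrite rev_ordK [nat_of_ord (Ordinal ni)]/=.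
  have := conj_k_conj (rev_ord (Ordinal ni)) vT' iT'; rewrite rev_ordK [nat_of_ord (Ordinal ni)]/=.
  have := E (rev_ord (Ordinal ni)); have := bound (rev_ord (Ordinal ni)).
  by move: (rev_ord _) => q; case: (ltP (T' q) (T q)); lia.
apply/vertical_stripP => r; rewrite le /=; move: r; apply/(conj_leS pc pc') => i.
case: (ltnP i.+1 n) => ni; last first.
  rewrite (bounded_conj0 (k_conj_bounded bT') (ltnW ni)); exact: leq0n.
(* Columns i + 1 and i of the k-conjugates belong to the neighbouring labels q and q + 1. *)
pose q := rev_ord (Ordinal ni).
have q1n : (q.+1 < n)%N by rewrite /q /=; lia.
pose q1 := Ordinal q1n.
have e1 : rev_ord q = i.+1 :> nat by rewrite /q rev_ordK.
have e2 : rev_ord q1 = i :> nat by rewrite /= /q /=; lia.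
have := conj_k_conj q vT' iT'; rewrite e1; have := conj_k_conj q1 vT iT; rewrite e2.
move=> Eq1 Eq; have := E q; case: ltP => h; rewrite ?addn1 ?addn0 => Eb.
  have : (nth 0%N (conj_part (k_conj K (bounded_of T))) i.+1 <= nth 0%N (conj_part (k_conj K (bounded_of T))) i)%N.
    by apply: nth_part; [apply: conj_is_part|].
  have := conj_k_conj q vT iT; rewrite e1; have := bound q; lia.
have qq1 : T q < T q1 by apply: iT.
(* A rising gap passes only positions of classes whose first gap is smaller than T q, and T q1 is
   larger. *)
have lt1 : T' q < T q1.
  rewrite ltNge; apply/negP => h'; have [|j jc jq] := gaps q (T q1); first by rewrite qq1.
  by have jj := vT.1 _ _ jc; have := lt_trans jq qq1; rewrite jj ltxx.
(* All passed positions are empty, so the bead count stays constant along the way. *)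
have flat (d : nat) : T q + d%:Z <= T' q -> beads T (T q + d%:Z) = beads T (T q).
  elim: d => [|d IH] hd; first by rewrite addr0.
  have [|j jc jq] := gaps q (T q + d.+1%:Z); first by lia.
  rewrite -IH; last by lia.
  have := beads_pred vT jc; rewrite (_ : _ - 1 = T q + d%:Z); last by lia.
  by rewrite (_ : (_ < T j) = false) ?addn0 //; lia.
have fl : beads T (T' q) = beads T (T q).
  by rewrite -(flat (absz (T' q - T q)%R)); [congr beads; lia|lia].
have := beads_drop (T' q) (absz (T q1 - 1 - T' q)%R) vT.
rewrite (_ : T' q + (absz (T q1 - 1 - T' q)%R)%:Z = T q1 - 1); last by lia.
rewrite beads_self // fl; move: Eq1 Eq; rewrite Eb /=; lia.
Qed.

Lemma asc_word_inj T A (B : {set 'I_n}) : valid T -> (#|A| <= K)%N -> (#|B| <= K)%N ->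
  act (asc_word A) \o T = act (asc_word B) \o T -> A = B.
Proof.
move=> vT AK BK e.
have key (C : {set 'I_n}) i : (#|C| <= K)%N ->
    (i \in C) = [exists q, (residue k (T q - 1) == i) && (act (asc_word C) (T q) == T q - 1)].
  move=> CK; have xC : residue k (cut C) \notin C by apply: cutP.
  have cl q : mem_class k (asc_word C) (T q - 1) = (residue k (T q - 1) \in C).
    by apply: mem_class_asc.
  apply/idP/existsP => [iC|[q /andP[/eqP <-]]].
    have [q qi] := distinct_onto ((i : nat)%:Z + 1) vT.1.
    have ri : residue k (T q - 1) = i.
      rewrite -[RHS](residue_ord i); apply/eqP; rewrite eq_residue.
      by rewrite (@cong_addr _ _ _ (T q) ((i : nat)%:Z + 1)) //; lia.
    exists q; rewrite ri eqxx /=; have := cl q; rewrite ri iC /asc_word.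
    case: (ascendingP (T q) (asc_ascending (cut C) C)) => [_ _|h _ e'|y h _ _ _ e'] //.
      by rewrite e' in h.
    by rewrite e' in h.
  rewrite -cl; case: (ascendingP (T q) (asc_ascending (cut C) C)) => [//|_ _|y _ _ h _] /eqP; lia.
apply/setP => i; rewrite !key //; apply: eq_existsb => q.
by have /(congr1 (fun f => f q)) /= -> := e.
Qed.

End PieriWords.

(** * Pieri families and their k-conjugates *)

Section PieriFamilies.
Variables (k : nat) (R : comNzRingType).
Local Notation n := k.+2.
Local Notation K := k.+1.
Local Notation flip := (flip k).
Local Notation act := (act k).
Implicit Types (la mu nu : seq nat) (T : 'I_n -> int) (A B : {set 'I_n}).
Implicit Types (h : nat -> R) (s : seq nat -> R).

Definition pieri_family h s := forall l mu, (1 <= l <= K)%N -> k_bounded K mu ->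
  h l * s mu = \sum_(nu \in pieri_set K l mu) s nu.

Lemma bounded_of_inj T T' : valid T -> increasing T -> valid T' -> increasing T' ->
  bounded_of T = bounded_of T' -> T = T'.
Proof.
move=> vT iT vT' iT' e; apply/funext => i.
have := conj_k_conj i vT iT; have := conj_k_conj i vT' iT'.
by rewrite -!conj_bounded_of // e; lia.
Qed.

Lemma pieri_sum s l T : valid T -> increasing T -> (l <= K)%N ->
  \sum_(nu \in pieri_set K l (bounded_of T)) s nu =
  \sum_(A : {set 'I_n} | #|A| == l) word_term (s \o @bounded_of k) (asc_word A) T.
Proof.
move=> vT iT lK; pose good A := (#|A| == l) && reduced (asc_word A) T.
pose f A := bounded_of (act (asc_word A) \o T).
have -> : pieri_set K l (bounded_of T) = (f @` [set` good])%classic.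
  apply/seteqP; split=> [nu /(pieri_word vT iT lK)[A [Al rA ->]]|_ [A /andP[/eqP Al rA] <-]].
    by exists A => //; apply/andP; split=> //; apply/eqP.
  by have := word_pieri vT iT _ rA; rewrite Al; apply.
rewrite fsbig_image; last first.
  move=> A B; rewrite !inE => /andP[/eqP Al rA] /andP[/eqP Bl rB] e.
  apply: (asc_word_inj vT); rewrite ?Al ?Bl //.
  by apply: bounded_of_inj => //; (try exact: act_valid); exact: act_increasing.
rewrite -(@bigfs _ _ _ _ (index_enum _) good) ?index_enum_uniq //; last first.
  by move=> A _; rewrite mem_index_enum.
by rewrite big_mkcondr.
Qed.

Lemma pieri_family_asc h s : pieri_family h s -> asc_pieri (s \o @bounded_of k) h.
Proof.
move=> hs l T /andP[l0 lK] vT iT; rewrite /= hs ?l0 //; last exact: bounded_of_bounded.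
exact: pieri_sum.
Qed.

Lemma inv_conj_gaps T : valid T -> increasing T -> inv (conj_gaps T) = inv T.
Proof.
move=> vT iT; apply/eqP; rewrite -eqz_nat /inv !(big_morph Posz PoszD (erefl 0%:Z)).
rewrite (reindex_inj rev_ord_inj) /=.
rewrite (eq_bigr (fun i => (T i - (i : nat)%:Z) + (beads T (T i))%:Z)); last first.
  move=> i _; rewrite -conj_bounded_of; last 2 first.
  - exact: conj_gaps_valid.
  - exact: conj_gaps_increasing.
  by rewrite -k_conj_bounded_of // conj_k_conj //; lia.
by rewrite big_split /= sumrB vT.2 subrr add0r.
Qed.

(** [flip] turns the letter c into k - c and so makes an ascending word descending; the cut of the
    new word is immaterial. *)
Lemma conj_gaps_act x A T : valid T -> residue k x \notin A ->
  conj_gaps (act (asc x A) \o T) =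
  act (rev (asc (cut (flip_set A)) (flip_set A))) \o conj_gaps T.
Proof.
move=> vT xA; have vc := conj_gaps_valid vT.
have xA' : residue k (k%:Z - x - n%:Z) \notin flip_set A.
  rewrite flip_setE; suff -> : residue k (k%:Z - (k%:Z - x - n%:Z)) = residue k x by [].
  by apply/eqP; rewrite eq_residue; apply/congP; exists 1; lia.
have [An|An] := ltnP #|A| n; last first.
  have /eqP eA : A == [set: 'I_n]%SET by rewrite eqEcard finset.subsetT cardsT card_ord.
  by rewrite eA finset.in_setT in xA.
rewrite (act_desc_eq vc (cutP _) xA') ?card_flip_set //.
apply/funext => i; rewrite /conj_gaps /= flip_act -flip_asc -map_rev revK.
by [].
Qed.

Lemma pieri_family_conj h s : pieri_family h s ->
  pieri_family (elem h) (s \o k_conj K).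
Proof.
move=> hs l mu /andP[l0 lK] /exists_bounded_of[T [vT iT <-]].
rewrite pieri_sum // /= k_conj_bounded_of //.
have vc := conj_gaps_valid vT; have ic := conj_gaps_increasing iT.
have -> := desc_pieri_elem (pieri_family_asc hs) lK vc ic.
rewrite (reindex_inj (can_inj (@flip_setK k))) /=.
apply: eq_big => [A|A]; rewrite card_flip_set // => /eqP Al.
have An : (#|A| < n)%N by rewrite Al.
have An' : (#|flip_set A| < n)%N by rewrite card_flip_set Al.
have e := conj_gaps_act vT (cutP An).
(* [inv_conj_gaps] requires increasing gaps after the action; reducedness on either side supplies
   this. *)
have red : reduced (rev (asc (cut (flip_set A)) (flip_set A))) (conj_gaps T) =
    reduced (asc_word A) T.
  have sz : size (rev (asc (cut (flip_set A)) (flip_set A))) = size (asc_word A).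
    by rewrite size_rev !size_asc ?card_flip_set //; apply: cutP.
  apply/idP/idP => r.
    have ia := act_increasing vc ic r; rewrite -e in ia.
    have ib := conj_gaps_increasing ia; rewrite conj_gapsK in ib.
    move: r; rewrite /reduced -e sz !inv_conj_gaps //; exact: act_valid.
  have ia := act_increasing vT iT r.
  move: r; rewrite /reduced -e sz !inv_conj_gaps //; exact: act_valid.
rewrite /word_term red; case: ifP => // _; rewrite /= -e k_conj_bounded_of //.
exact: act_valid.
Qed.

End PieriFamilies.

(** * Triangular expansions *)

Section Spans.
Variables (I : eqType) (R : comNzRingType).
Implicit Types (P Q : I -> Prop) (S H : I -> R) (r : seq (int * I)).

(** An index may occur several times in the list, so that addition is concatenation; its true
    coefficient is then a sum, given by [coef]. *)
Definition lin S r : R := \sum_(x <- r) S x.2 *~ x.1.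
Definition coef r (i : I) : int := \sum_(x <- r | x.2 == i) x.1.

Definition spanned P S (f : R) : Prop :=
  exists2 r, (forall x, x \in r -> P x.2) & f = lin S r.

Lemma lin_cat S r1 r2 : lin S (r1 ++ r2) = lin S r1 + lin S r2.
Proof. exact: big_cat. Qed.

Lemma coef_cat r1 r2 i : coef (r1 ++ r2) i = coef r1 i + coef r2 i.
Proof. exact: big_cat. Qed.

Definition scale (c : int) r : seq (int * I) := [seq (c * x.1, x.2) | x <- r].

Lemma lin_scale S c r : lin S (scale c r) = lin S r *~ c.
Proof.
rewrite /lin big_map /= -[RHS]mulrzr mulr_suml; apply: eq_bigr => x _.
by rewrite mulrzr -mulrzA mulrC.
Qed.

Lemma coef_scale c r i : coef (scale c r) i = c * coef r i.
Proof. by rewrite /coef big_map mulr_sumr. Qed.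

Lemma spanned0 P S : spanned P S 0.
Proof. by exists [::] => //; rewrite /lin big_nil. Qed.

Lemma spanned_base P S i : P i -> spanned P S (S i).
Proof.
by move=> Pi; exists [:: (1, i)] => [x|]; rewrite ?inE ?/lin ?big_seq1 // => /eqP ->.
Qed.

Lemma spannedD P S f g : spanned P S f -> spanned P S g -> spanned P S (f + g).
Proof.
move=> [r1 h1 ->] [r2 h2 ->]; exists (r1 ++ r2); last by rewrite lin_cat.
by move=> x; rewrite mem_cat => /orP[/h1|/h2].
Qed.

Lemma spannedZ P S f c : spanned P S f -> spanned P S (f *~ c).
Proof.
move=> [r h ->]; exists (scale c r); last by rewrite lin_scale.
by move=> _ /mapP[x /h Px ->].
Qed.

Lemma spannedN P S f : spanned P S f -> spanned P S (- f).
Proof. by move=> h; rewrite -[f]mulr1z -mulrNz; apply: spannedZ. Qed.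

Lemma spanned_lin P S (J : eqType) (F : J -> R) (s : seq (int * J)) :
  (forall x, x \in s -> spanned P S (F x.2)) ->
  spanned P S (\sum_(x <- s) F x.2 *~ x.1).
Proof.
elim: s => [|x s IH] h; first by rewrite big_nil; apply: spanned0.
rewrite big_cons; apply: spannedD; first by apply/spannedZ/h; rewrite mem_head.
by apply: IH => y ys; apply: h; rewrite in_cons ys orbT.
Qed.

Lemma spanned_sub P Q S f : (forall i, P i -> Q i) -> spanned P S f -> spanned Q S f.
Proof. by move=> PQ [r h ->]; exists r => // x /h /PQ. Qed.

Lemma coef_notin r i : i \notin [seq x.2 | x <- r] -> coef r i = 0.
Proof.
move=> h; rewrite /coef big1_seq // => x /andP[/eqP e xr].
by case/negP: h; rewrite -e map_f.
Qed.

Lemma coef_uniq r x : uniq [seq y.2 | y <- r] -> x \in r -> coef r x.2 = x.1.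
Proof.
elim: r => //= y r IH /andP[yr ur]; rewrite in_cons /coef big_cons => /orP[/eqP ->|xr].
  by rewrite eqxx -/(coef r _) coef_notin // addr0.
rewrite -/(coef r _) IH // ifN //; apply: contra yr => /eqP ->.
by apply/mapP; exists x.
Qed.

Lemma lin_coef S r (s : seq I) : uniq s -> {subset [seq x.2 | x <- r] <= s} ->
  lin S r = \sum_(i <- s) S i *~ coef r i.
Proof.
move=> us; elim: r => [|x r IH] sub.
  by rewrite /lin big_nil big1 // => i _; rewrite /coef big_nil mulr0z.
rewrite /lin big_cons -/(lin S r) IH; last by move=> i ir; apply: sub; rewrite in_cons ir orbT.
have xs : x.2 \in s by apply: sub; rewrite mem_head.
rewrite (bigD1_seq x.2) //= [RHS](bigD1_seq x.2) //= addrA; congr (_ + _).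
  by rewrite /coef big_cons eqxx mulrzDr.
apply: eq_bigr => i ix; congr (_ *~ _).
by rewrite /coef big_cons eq_sym (negbTE ix).
Qed.

Lemma lin_coef0 S r : (forall i, coef r i = 0) -> lin S r = 0.
Proof.
move=> h; rewrite (@lin_coef S r (undup [seq x.2 | x <- r])) ?undup_uniq //.
  by rewrite big1 // => i _; rewrite h mulr0z.
by move=> i; rewrite mem_undup.
Qed.

Definition independent P S : Prop :=
  forall r, (forall x, x \in r -> P x.2) -> lin S r = 0 -> forall i, coef r i = 0.

Lemma normalize r : exists r1, [/\ uniq [seq x.2 | x <- r1],
  forall x, x \in r1 -> x.1 = coef r x.2 /\ x.1 != 0,
  {subset [seq x.2 | x <- r1] <= [seq x.2 | x <- r]},
  forall i, coef r i != 0 -> i \in [seq x.2 | x <- r1] &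
  forall S, lin S r1 = lin S r].
Proof.
pose s := [seq i <- undup [seq x.2 | x <- r] | coef r i != 0].
exists [seq (coef r i, i) | i <- s].
have e2 : [seq x.2 | x <- [seq (coef r i, i) | i <- s]] = s.
  by rewrite -map_comp map_id_in.
rewrite e2; split.
- exact/filter_uniq/undup_uniq.
- by move=> x /mapP[i]; rewrite mem_filter => /andP[ci _] -> /=.
- by move=> i; rewrite mem_filter mem_undup => /andP[].
- move=> i ci; rewrite mem_filter ci mem_undup /=.
  by apply: contraR ci => h; rewrite coef_notin.
move=> S; rewrite (@lin_coef S r (undup [seq x.2 | x <- r])) ?undup_uniq //; last first.
  by move=> i; rewrite mem_undup.
rewrite /lin big_map big_filter [RHS](bigID (fun i => coef r i != 0)) /=.
by rewrite [X in _ + X]big1 ?addr0 // => i /negbNE/eqP ->; rewrite mulr0z.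
Qed.

(** In a relation among the S i, pick an index of maximal weight: passing to H leaves its
    coefficient unchanged, since all corrections have smaller weight. *)
Lemma independent_triangular P S H (wt : I -> nat) :
  (forall i, P i -> spanned (fun j => P j /\ (wt j < wt i)%N) H (S i - H i)) ->
  independent P H -> independent P S.
Proof.
move=> tri indH r0 r0P lin0 i0; apply/eqP/negPn/negP => c0.
have [r [ur rc rsub rin linr]] := normalize r0.
have rP x : x \in r -> P x.2.
  move=> /(map_f snd) /rsub /mapP[y yr ->]; exact: r0P.
have [x0 x0r x0max] : exists2 x, x \in r & forall y, y \in r -> (wt y.2 <= wt x.2)%N.
  have : r != [::] by apply/eqP => e; have := rin _ c0; rewrite e.
  clear -r; elim: r => // x r IH _; have [->|rn] := eqVneq r [::].
    by exists x; rewrite ?mem_head // => y; rewrite inE => /eqP ->.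
  have [z zr zmax] := IH rn; have [le|lt] := leqP (wt z.2) (wt x.2).
    exists x; rewrite ?mem_head // => y; rewrite in_cons => /orP[/eqP -> //|/zmax].
    by move/leq_trans; apply.
  exists z; rewrite ?in_cons ?zr ?orbT // => y; rewrite in_cons => /orP[/eqP ->|/zmax //].
  exact: ltnW.
have [t tP tlin] : exists2 t : seq (int * I),
    forall y, y \in t -> P y.2 /\ (wt y.2 < wt x0.2)%N & lin S r - lin H r = lin H t.
  have : spanned (fun j => P j /\ (wt j < wt x0.2)%N) H
      (\sum_(x <- r) (S x.2 - H x.2) *~ x.1).
    apply: (spanned_lin (F := fun i => S i - H i)) => x xr.
    apply: spanned_sub (tri _ (rP _ xr)) => j [Pj lt]; split=> //.
    exact: leq_trans lt (x0max _ xr).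
  case=> t tP e; exists t => //; rewrite -e /lin -sumrB.
  by apply: eq_bigr => x _; rewrite mulrzBl.
have lin1 : lin H (r ++ t) = 0.
  by rewrite lin_cat -tlin addrC subrK linr.
have rtP x : x \in r ++ t -> P x.2 by rewrite mem_cat => /orP[/rP|/tP[]].
have := indH _ rtP lin1 x0.2; rewrite coef_cat [coef t _]coef_notin; last first.
  by apply/negP => /mapP[y /tP[_ lt] e]; rewrite e ltnn in lt.
rewrite addr0 coef_uniq // => x00; have [_ /eqP] := rc _ x0r; apply; apply: x00.
Qed.

(** Compare the two expansions of f at an index of P1: neither m nor P2 contributes there, so every
    coefficient of the first remainder vanishes. *)
Lemma spanned_unique P1 P2 P S f m :
  independent P S -> P m -> (forall i, P1 i -> P i) -> (forall i, P2 i -> P i) ->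
  (forall i, P1 i -> i <> m) -> (forall i, P1 i -> ~ P2 i) ->
  spanned P1 S (f - S m) -> spanned P2 S f -> f = S m.
Proof.
move=> ind Pm P1P P2P P1m P12 [r1 h1 e1] [r2 h2 e2].
apply/eqP; rewrite -subr_eq0 e1; apply/eqP/lin_coef0 => i.
have lin0 : lin S ((1, m) :: r1 ++ scale (-1) r2) = 0.
  rewrite -cat1s !lin_cat lin_scale -e1 -e2 mulrN1z /lin big_seq1 /= mulr1z.
  by rewrite addrA addrCA subrr addr0 subrr.
have := ind _ _ lin0 i; rewrite -cat1s !coef_cat coef_scale.
case: (boolP (i \in [seq x.2 | x <- r1])) => [/mapP[x xr ->]|/coef_notin //].
have Px := h1 _ xr.
rewrite [coef [:: _] _]coef_notin; last first.
  by rewrite inE; apply/eqP; apply: P1m.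
rewrite [coef r2 _]coef_notin; last first.
  by apply/negP => /mapP[y /h2 Py e]; apply: (P12 x.2) => //; rewrite e.
rewrite mulr0 addr0 add0r; apply=> y; rewrite in_cons => /orP[/eqP -> //|].
rewrite mem_cat => /orP[/h1/P1P //|/mapP[z /h2/P2P Pz ->]]; exact: Pz.
Qed.

End Spans.

Section Weights.
Local Open Scope nat_scope.
Implicit Types (la mu nu : seq nat).

Fixpoint weight la : nat := if la is p :: la' then weight la' + sumn la' else 0.

Lemma sumn_le a b : (forall r, nth 0 a r <= nth 0 b r) -> sumn a <= sumn b.
Proof.
elim: a b => // p a IH [|q b] le.
  have := le 0; rewrite /= leqn0 => /eqP ->.
  by apply: (IH [::]) => r; have := le r.+1; rewrite !nth_nil.
by apply: leq_add (le 0) (IH _ _) => r; exact: le r.+1.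
Qed.

Lemma weight_le a b : (forall r, nth 0 a r <= nth 0 b r) -> weight a <= weight b.
Proof.
elim: a b => // p a IH [|q b] le.
  have le' r : nth 0 a r <= nth 0 [::] r by have := le r.+1; rewrite !nth_nil.
  by have := IH _ le'; have := sumn_le le'; rewrite /=; lia.
have le' r : nth 0 a r <= nth 0 b r := le r.+1.
by apply: leq_add; [apply: IH|apply: sumn_le].
Qed.

Lemma sumn_eq a b : (forall r, nth 0 a r <= nth 0 b r) -> sumn b <= sumn a ->
  forall r, nth 0 a r = nth 0 b r.
Proof.
elim: a b => [|p a IH] b le sb r.
  rewrite nth_nil; symmetry; apply/eqP; rewrite -leqn0.
  case: (ltnP r (size b)) => rb; last by rewrite nth_default.
  by apply: leq_trans sb; rewrite sumnE (big_rem _ (mem_nth 0 rb)) leq_addr.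
case: b le sb => [|q b] le sb.
  by have := le r; rewrite nth_nil leqn0 => /eqP.
have le' r' : nth 0 a r' <= nth 0 b r' := le r'.+1.
have h1 := sumn_le le'; have h2 : p <= q := le 0.
move: sb => /= sb; case: r => [|r] /=; first by lia.
by apply: IH => //; lia.
Qed.

Lemma weight_cat a b : weight (a ++ b) = weight b + size a * sumn b + weight a.
Proof. by elim: a => [|p a IH] /=; rewrite ?sumn_cat ?IH; lia. Qed.

(** The first row has weight 0 and the other rows of nu fit into mu, so the weight is largest when
    they fill mu. This singles out l :: mu as the leading term. *)
Lemma weight_strip l mu nu : is_part mu -> is_part nu -> 0 < l ->
  sumn nu = sumn mu + l -> (forall r, nth 0 nu r.+1 <= nth 0 mu r) ->
  weight nu <= weight mu + sumn mu /\
  (weight nu = weight mu + sumn mu -> nu = l :: mu).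
Proof.
move=> pm; case: nu => [|p nu] pn l0 sn le; first by move: sn => /=; lia.
have h1 : weight nu <= weight mu := weight_le le.
have h2 : sumn nu <= sumn mu := sumn_le le.
split=> /= [|e]; first exact: leq_add.
have [_ pn' _] := is_part_cons pn.
have e' : nu = mu by apply: eq_part => //; apply: sumn_eq => //; lia.
by move: sn; rewrite e' /= => sn; congr cons; lia.
Qed.

End Weights.

Section Triangularity.
Variable k : nat.
Local Notation n := k.+2.
Local Notation K := k.+1.
Local Notation core := (bounded_to_core k.+1).
Local Notation bd := (core_to_bounded k.+1).
Implicit Types (la mu nu al be : seq nat) (T : 'I_n -> int).

Lemma bounded_size la : k_bounded K la -> size (core la) = size la.
Proof. by move/bounded_coreP=> [_ {2}<-]; rewrite size_bounded. Qed.

Lemma core_of_bounded T : valid T -> core (bounded_of T) = core_of T.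
Proof. by move=> vT; rewrite core_to_boundedK //; apply: core_of_core. Qed.

Lemma pieri_core_strip l mu nu : (l <= K)%N -> k_bounded K mu ->
  pieri_set K l mu nu -> forall r, (nth 0 (core nu) r.+1 <= nth 0 (core mu) r)%N.
Proof.
move=> lK /exists_bounded_of[T [vT iT <-]] /(pieri_word vT iT lK)[A [Al rA ->]] r.
have vT' : valid (act k (asc_word A) \o T) := act_valid _ vT.
have strip z := ascending_strip z (asc_ascending (cut A) A) vT.
rewrite !core_of_bounded //; have [p q] := core_ofP vT; have [p' q'] := core_ofP vT'.
rewrite -/(asc_word A) in strip.
move: (core_of _) p' q' => ka' p' q'; move: (core_of _) p q => ka p q.
rewrite leqNgt; apply/negP => lt.
pose N := (size ka + size ka' + r + 3)%N.
(* There are r + 2 new beads at or above the bead of row r + 1. If that row were longer than row r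
   of the old core, at most r old beads would lie above this position, one too few. *)
have := strip (bead ka' r.+1 - 1); rewrite subrK.
rewrite -(q N) ?/N /bead; try by lia.
rewrite -(q' N) ?/N; try by lia.
rewrite -/N leqNgt => /negP; apply.
apply: (@leq_ltn_trans r.+1).
  rewrite ltnNge; apply/negP => h.
  have := h; rewrite lt_nbeads /N /bead; try by lia.
have -> := @lt_nbeads ka' N _ r.+1 p'; rewrite /N /bead; lia.
Qed.

Lemma bounded_cons_inv l mu : k_bounded K (l :: mu) ->
  [/\ (0 < l <= K)%N, k_bounded K mu & (nth 0 mu 0 <= l)%N].
Proof. by case/andP=> /is_part_cons[l0 pm le] /= /andP[lK am]; rewrite l0 lK /k_bounded pm. Qed.

Lemma core_cons l mu : k_bounded K (l :: mu) ->
  exists2 L, core (l :: mu) = L :: core mu & (nth 0 (core mu) 0 <= L)%N.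
Proof.
move=> b; have [cl e] := bounded_coreP b.
case E : (core (l :: mu)) => [|L la]; first by rewrite E in e.
rewrite E in cl e; have [pl _] := cl; exists L; last first.
  have [_ _] := is_part_cons pl; suff -> : core mu = la by [].
  by move: e; rewrite bounded_cons // => -[_ <-]; rewrite core_to_boundedK //; apply: core_tail cl.
congr cons; move: e; rewrite bounded_cons // => -[_ <-].
by rewrite core_to_boundedK //; apply: core_tail cl.
Qed.

(** The k-conjugates are compared through their cores: the new core has one more row, so each of its
    first L columns is longer by one. *)
Lemma pieri_cons l mu : k_bounded K (l :: mu) -> pieri_set K l mu (l :: mu).
Proof.
move=> b; have [/andP[l0 lK] bm le] := bounded_cons_inv b.
have /andP[pl _] := b; have /andP[pm _] := bm.
split=> //; first by rewrite /= addnC.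
  apply/horizontal_stripP => // i; rewrite !nth_conj //=; case: (_ < _)%N; lia.
have [L EL lL] := core_cons b; have [cm em] := bounded_coreP bm; have [cl el] := bounded_coreP b.
rewrite EL in cl el; set ka := core mu in cm em EL lL cl el *.
have [pk _] := cm; have [pL _] := cl.
rewrite -el -em !k_conjE //; apply/vertical_stripP => c.
have [T [vT iT rT]] := exists_rep cm; have [j Lj] := core_head cl vT rT.
have rL := rep_cons Lj rT.
have vL := valid_add_row j vT.
rewrite (nth_bounded_rep _ (conj_is_part pk) (rep_conj pk vT rT)).
rewrite (nth_bounded_rep _ (conj_is_part pL) (rep_conj pL vL rL)).
have small la (U : 'I_n -> int) : is_part la -> valid U -> rep la U -> (nth 0 la 0 <= c)%N ->
    #|[pred i | (flip k \o U) i <= bead (conj_part la) c]| = 0%N.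
  move=> pla vU rU lc; rewrite -(nth_bounded_rep _ (conj_is_part pla) (rep_conj pla vU rU)).
  by rewrite nth_default // size_bounded size_conj.
case: (ltnP c L) => cL; last first.
  by rewrite (small _ _ pL vL rL) // (small _ _ pk vT rT) // (leq_trans lL).
have e : nth 0%N (conj_part (L :: ka)) c = (nth 0%N (conj_part ka) c).+1.
  by rewrite !nth_conj //= cL.
apply/andP; split.
  apply: subset_leq_card; apply/fintype.subsetP => i; rewrite !inE /bead e /flip /= /add_row.
  by case: eqP => _; lia.
(* The transposed bead and all transposed gaps rise together by one, except the gap of class j; so
   at most j is new in the count. *)
pose X : {set 'I_n} := [set i | (flip k \o T) i <= bead (conj_part ka) c]%SET.
apply: (@leq_trans #|j |: X|).
  apply: subset_leq_card; apply/fintype.subsetP => i; rewrite !inE /bead e /flip /= /add_row.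
  by case: eqP => _ //=; lia.
rewrite cardsU1 -[X in (_ <= X)%N]add1n leq_add ?leq_b1 //.
by rewrite cardsE.
Qed.

Variables (R : comNzRingType) (h : nat -> R) (S : seq nat -> R).
Hypotheses (pieriS : pieri_family k h S) (S0 : S [::] = 1).

Definition hprod (d : seq nat) : R := \prod_(l <- d) h l.

Lemma fsbig_spanned (P : seq nat -> Prop) (X : set (seq nat)) : finite_set X ->
  (forall nu, X nu -> P nu) -> spanned P S (\sum_(nu \in X) S nu).
Proof.
move=> fX XP; rewrite fsbig_finite //=.
rewrite (eq_bigr (fun nu => S (1%:Z, nu).2 *~ (1%:Z, nu).1)) => [|nu _]; last by rewrite mulr1z.
rewrite -(big_map (fun nu => (1%:Z, nu)) xpredT (fun x => S x.2 *~ x.1)).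
apply: spanned_lin => _ /mapP[nu + ->] /=; rewrite in_fset_set // inE => /XP.
exact: spanned_base.
Qed.

(** The number m bounds how many factors h_l have been multiplied onto s_mu, each of which may push
    the rows of the core down by one. The weight bound w separates the leading term from the
    rest. *)
Definition below (d m w : nat) mu nu := [/\ k_bounded K nu, sumn nu = d,
  forall r, (nth 0 (core nu) (r + m) <= nth 0 (core mu) r)%N & (weight nu < w)%N].

Lemma h_mul l mu : (0 < l <= K)%N -> k_bounded K mu ->
  spanned (below (l + sumn mu) 1 (weight mu + sumn mu).+1 mu) S (h l * S mu).
Proof.
move=> /[dup] lK /andP[l0 l1] bm; rewrite pieriS //; apply: fsbig_spanned.
  exact: finite_pieri_set.
move=> nu pn; have [bn sn hs vs] := pn; have /andP[pm _] := bm; have /andP[pnu _] := bn.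
have st : forall r, (nth 0 nu r.+1 <= nth 0 mu r)%N.
  rewrite -{1}[nu]conj_partK // -{1}[mu]conj_partK // => r.
  have [+ _] := conj_leS (conj_is_part pm) (conj_is_part pnu).
  by apply=> i; have /horizontal_stripP := hs; case/(_ pm pnu i)/andP.
have [w1 w2] := weight_strip pm pnu l0 sn st.
split=> //; first by rewrite sn addnC.
by move=> r; rewrite addn1; apply: pieri_core_strip pn _.
Qed.

Lemma h_mul_cons l mu : k_bounded K (l :: mu) ->
  spanned (below (l + sumn mu) 1 (weight mu + sumn mu) mu) S (h l * S mu - S (l :: mu)).
Proof.
move=> b; have [/[dup] lK /andP[l0 l1] bm le] := bounded_cons_inv b.
rewrite pieriS // (fsbigD1 (l :: mu)) /=; last 2 first.
- exact: finite_pieri_set.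
- exact: pieri_cons.
rewrite addrAC subrr add0r; apply: fsbig_spanned.
  exact/finite_setD/finite_pieri_set.
move=> nu [pn nuE]; have [bn sn hs vs] := pn; have /andP[pm _] := bm; have /andP[pnu _] := bn.
have st : forall r, (nth 0 nu r.+1 <= nth 0 mu r)%N.
  rewrite -{1}[nu]conj_partK // -{1}[mu]conj_partK // => r.
  have [+ _] := conj_leS (conj_is_part pm) (conj_is_part pnu).
  by apply=> i; have /horizontal_stripP := hs; case/(_ pm pnu i)/andP.
have [w1 w2] := weight_strip pm pnu l0 sn st.
split=> //; [by rewrite sn addnC| |].
  by move=> r; rewrite addn1; apply: pieri_core_strip pn _.
by rewrite ltn_neqAle w1 andbT; apply/eqP => /w2.
Qed.

Lemma core_rows mu m r : k_bounded K mu -> (nth 0 (core mu) (r + m) <= nth 0 (core mu) r)%N.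
Proof. by case/bounded_coreP=> -[pc _] _; apply: nth_part (leq_addr _ _). Qed.

(** The weight bound is the weight of d ++ be, expanded by [weight_cat]; here d is any list of
    indices, not necessarily sorted. *)
Lemma hprod_mul d be : all (fun l => 0 < l <= K)%N d -> k_bounded K be ->
  spanned (below (sumn d + sumn be) (size d)
    (weight be + size d * sumn be + weight d).+1 be) S (hprod d * S be).
Proof.
move=> + bb; elim: d => [_|l d IH /= /andP[lK /IH{IH}[r rP e]]].
  rewrite /hprod big_nil mul1r; apply: spanned_base; split=> //= [r|]; last by lia.
  by rewrite addn0.
rewrite /hprod big_cons -/(hprod d) -mulrA e /lin mulr_sumr.
rewrite (eq_bigr (fun x => (h l * S x.2) *~ x.1)) => [|x _]; last by rewrite mulrzAr.
apply: (spanned_lin (F := fun i => h l * S i)) => x /rP[b1 s1 r1 w1].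
apply: spanned_sub (h_mul lK b1) => nu [b2 s2 r2 w2]; split=> //; first by rewrite s2 s1; lia.
  by move=> q; have := r2 (q + size d)%N; rewrite addn1 -addnS => /leq_trans; apply.
by move: w2; rewrite s1; lia.
Qed.

Lemma hprod_mul_cat d be : k_bounded K (d ++ be) ->
  spanned (below (sumn d + sumn be) (size d)
    (weight be + size d * sumn be + weight d) be) S (hprod d * S be - S (d ++ be)).
Proof.
elim: d => [_|l d IH b].
  by rewrite /hprod big_nil mul1r subrr; apply: spanned0.
have [lK b' le] := bounded_cons_inv b; have [r rP e] := IH b'.
have -> : hprod (l :: d) * S be - S ((l :: d) ++ be) =
    (h l * S (d ++ be) - S (l :: d ++ be)) + h l * (hprod d * S be - S (d ++ be)).
  by rewrite /hprod big_cons; ring.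
apply: spannedD.
  apply: spanned_sub (h_mul_cons b) => nu [b2 s2 r2 w2]; split=> //.
  - by rewrite s2 sumn_cat /=; lia.
  - move=> q; have := r2 (q + size d)%N; rewrite addn1 -addnS => /leq_trans; apply.
    clear -b'; elim: d b' q => [|p d IH] b q; first by rewrite addn0.
    have [_ b' _] := bounded_cons_inv b; have [L e _] := core_cons b.
    by rewrite /= e addnS; apply: IH.
  by move: w2; rewrite sumn_cat weight_cat /=; lia.
rewrite e /lin mulr_sumr.
rewrite (eq_bigr (fun x => (h l * S x.2) *~ x.1)) => [|x _]; last by rewrite mulrzAr.
apply: (spanned_lin (F := fun i => h l * S i)) => x /rP[b1 s1 r1 w1].
apply: spanned_sub (h_mul lK b1) => nu [b2 s2 r2 w2]; split=> //; first by rewrite s2 s1 /=; lia.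
  by move=> q; have := r2 (q + size d)%N; rewrite addn1 -addnS => /leq_trans; apply.
by move: w1 w2; rewrite s1 /=; clear; move: (weight x.2) (weight nu) => w' w''; lia.
Qed.

Lemma core_nil : core [::] = [::].
Proof. by apply: size0nil; rewrite bounded_size. Qed.

Lemma size_below d m w nu : below d m w [::] nu -> (size nu <= m)%N.
Proof.
case=> bn _ r _; rewrite -(bounded_size bn) leqNgt; apply/negP => lt.
have [[pc _] _] := bounded_coreP bn.
by have := r 0%N; rewrite core_nil add0n leqNgt nth_part_gt0 // lt.
Qed.

Lemma bounded_all la : k_bounded K la -> all (fun l => 0 < l <= K)%N la.
Proof.
case/andP=> /andP[_ la0] /allP al; apply/allP => l lla; rewrite (al l lla) andbT lt0n.
by apply: contra la0 => /eqP <-.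
Qed.

Definition smaller al de := [/\ k_bounded K de, sumn de = sumn al,
  (size de <= size al)%N & (weight de < weight al)%N].

(** Inverts the unitriangular expansion of h-products. The bound on the number of parts is essential
    for later use: it limits the number of factors, hence the shift of rows, when s_al multiplies
    another function. *)
Lemma kschur_hprod al : k_bounded K al -> spanned (smaller al) hprod (S al - hprod al).
Proof.
have [m] := ubnP (weight al); elim: m al => // m IH al lem ba.
have := @hprod_mul_cat al [::]; rewrite cats0 S0 mulr1 => /(_ ba) /spannedN.
rewrite opprB => -[r rP ->].
apply: (spanned_lin (F := S)) => x xr; have bx := rP x xr; have sx := size_below bx.
case: bx => b1 s1 _ w1; rewrite /= muln0 !addn0 in s1 w1.
rewrite -[S x.2](subrK (hprod x.2)); apply: spannedD; last by apply: spanned_base.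
rewrite add0n in w1; have xm : (weight x.2 < m)%N by apply: leq_trans w1 _; exact: lem.
apply: spanned_sub (IH x.2 xm b1) => de [b2 s2 z2 w2].
split=> //; [by rewrite s2|exact: leq_trans z2 sx|exact: ltn_trans w2 w1].
Qed.

Lemma hprod_sub_mul al be : k_bounded K al -> k_bounded K be ->
  spanned (below (sumn al + sumn be) (size al)
     (weight be + size al * sumn be + weight al) be) S ((S al - hprod al) * S be).
Proof.
move=> ba bb; have [r rP ->] := kschur_hprod ba.
rewrite /lin mulr_suml.
rewrite (eq_bigr (fun x => (hprod x.2 * S be) *~ x.1)) => [|x _]; last by rewrite mulrzAl.
apply: (spanned_lin (F := fun i => hprod i * S be)) => x /rP[b1 s1 z1 w1].
apply: spanned_sub (hprod_mul (bounded_all b1) bb) => nu [b2 s2 r2 w2]; split=> //.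
- by rewrite s2 s1.
- move=> q; apply: leq_trans (r2 q); rewrite -(subnKC z1) addnA.
  exact: core_rows.
by apply: leq_trans w2 _; have := leq_mul z1 (leqnn (sumn be)); lia.
Qed.

Lemma kschur_mul al be : k_bounded K al -> k_bounded K be ->
  spanned (below (sumn al + sumn be) (size al)
     (weight be + size al * sumn be + weight al).+1 be) S (S al * S be).
Proof.
move=> ba bb; rewrite -[S al](subrK (hprod al)) mulrDl; apply: spannedD.
  by apply: spanned_sub (hprod_sub_mul ba bb) => nu [? ? ? ?]; split=> //; apply: ltnW.
exact: hprod_mul (bounded_all ba) bb.
Qed.

Lemma kschur_mul_cat al be : k_bounded K (al ++ be) -> k_bounded K al -> k_bounded K be ->
  spanned (below (sumn al + sumn be) (size al) (weight (al ++ be)) be) S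
    (S al * S be - S (al ++ be)).
Proof.
move=> bab ba bb; rewrite weight_cat.
have -> : S al * S be - S (al ++ be) = (S al - hprod al) * S be + (hprod al * S be - S (al ++ be)).
  by rewrite mulrBl addrA subrK.
by apply: spannedD; [apply: hprod_sub_mul|apply: hprod_mul_cat].
Qed.

Lemma kschur_independent : independent (k_bounded K) hprod -> independent (k_bounded K) S.
Proof.
apply: (independent_triangular (wt := weight)) => al ba.
by apply: spanned_sub (kschur_hprod ba) => de [].
Qed.

End Triangularity.

(** * Algebraic independence *)

Section Newton.
Variable N : nat.

Lemma mcoeff_hsym_mulX l (a m : 'X_{1..N}) :
  (hsym_mpoly l N * 'X_[a])@_m = ((a <= m)%MM && (mdeg m == l + mdeg a)%N)%:R.
Proof.
case: (boolP (a <= m)%MM) => am /=.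
  rewrite -{1 2}(submK am) addmC mcoeffMX mcoeff_hsym mdegD.
  by congr (_%:R : int); rewrite addnC eqn_add2r.
rewrite /hsym_mpoly mulr_suml raddf_sum big1 // => m' _ /=.
rewrite -mpolyXD mcoeffX; case: eqP => // e; case/negP: am.
by rewrite -e; apply/mnm_lepP => i; rewrite mnmDE leq_addl.
Qed.

(** Toggling the membership of i0 reverses the sign and preserves g. *)
Lemma sum_sign_set (I : finType) (i0 : I) (g : {set I} -> int) :
  (forall A : {set I}, i0 \notin A -> g (i0 |: A) = g A) ->
  \sum_(A : {set I}) (-1) ^+ #|A| * g A = 0.
Proof.
move=> gE; rewrite (bigID (fun A : {set I} => i0 \in A)) /=.
rewrite (reindex_onto (fun A : {set I} => i0 |: A) (fun A : {set I} => A :\ i0)) /=; last first.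
  by move=> A iA; rewrite finset.setD1K.
rewrite -[X in X + _](@eq_bigl _ _ _ _ _ (fun A : {set I} => i0 \notin A)); last first.
  move=> A; rewrite finset.setU11 /=; apply/idP/eqP => [iA|<-]; first by rewrite finset.setU1K.
  by rewrite finset.setD11.
rewrite -big_split big1 //= => A iA.
by rewrite cardsU1 iA gE // exprS mulN1r mulNr addNr.
Qed.

Lemma hsym_mesym l : (0 < l)%N ->
  \sum_(i < l.+1) (-1) ^+ i * hsym_mpoly i N * mesym N int (l - i) = 0.
Proof.
move=> l0; apply/mpolyP => m; rewrite mcoeff0 raddf_sum /=.
pose g (A : {set 'I_N}) : int := ((mesym1 A <= m)%MM && (mdeg m == l))%:R.
(* The coefficient counts the sets A of l - i variables whose product divides the monomial m.
   Indexing by A alone turns the sum over i into one over all sets, with i = l - #|A|. *)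
have term (i : 'I_l.+1) : ((-1) ^+ i * hsym_mpoly i N * mesym N int (l - i))@_m =
    \sum_(A : {set 'I_N} | (#|A| <= l)%N && (inord (l - #|A|) == i)) (-1) ^+ l * ((-1) ^+ #|A| * g A).
  have il : (i <= l)%N by rewrite -ltnS.
  rewrite -mulrA -signr_odd mulr_sign -(scaler_sign _ (_ * _)) mcoeffZ mesymE mulr_sumr raddf_sum /=.
  rewrite mulr_sumr; apply: eq_big => [A|A /eqP Ai].
    apply/eqP/andP => [->|[Al /eqP <-]]; last by rewrite inordK ?subKn // ltnS leq_subr.
    by rewrite leq_subr subKn // inord_val.
  rewrite mcoeff_hsym_mulX mdeg_mesym1 Ai subnKC // /g mulrA; congr (_ * _).
  rewrite -(signr_odd _ l) -(signr_odd _ (l - i)) oddB // -signr_addb.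
  by rewrite addKb.
rewrite (eq_bigr _ (fun i _ => term i)).
rewrite -(partition_big (fun A : {set 'I_N} => inord (l - #|A|) : 'I_l.+1) xpredT) //=.
rewrite -mulr_sumr big_mkcond /=.
have [ml|ml] := boolP (mdeg m == l); last first.
  by rewrite big1 ?mulr0 // => A _; rewrite /g (negbTE ml) andbF mulr0 if_same.
have [i0 mi0] : exists i0, (0 < m i0)%N.
  apply/existsP; apply: contraTT l0 => /existsPn h; rewrite -leqNgt -(eqP ml) mdegE.
  by rewrite big1 // => i _; have := h i; rewrite lt0n negbK => /eqP.
(* Sets with more than l elements may be added: their product cannot divide a monomial of degree l.
   The toggling at i0, a variable of m, then runs over all sets. *)
rewrite -(@eq_bigr _ _ _ _ _ _ (fun A : {set 'I_N} => (-1) ^+ #|A| * g A)); last first.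
  move=> A _; case: leqP => // lA; rewrite /g.
  case: (boolP (mesym1 A <= m)%MM) => [/mnm_lepP le|]; last by rewrite mulr0.
  have : (mdeg (mesym1 A) <= mdeg m)%N by rewrite !mdegE; apply: leq_sum => i _.
  by rewrite mdeg_mesym1 (eqP ml) leqNgt lA.
rewrite (sum_sign_set (i0 := i0)) ?mulr0 // => A iA.
rewrite /g; congr ((_ && _)%:R : int); apply/mnm_lepP/mnm_lepP => le i; have := le i; rewrite !mnmE in_setU1.
  by case: (i \in A); rewrite ?orbT.
by case: eqP => [->|].
Qed.

Lemma hsym_mpoly0 : hsym_mpoly 0 N = 1.
Proof. by apply/mpolyP => m; rewrite mcoeff_hsym mcoeff1 mdeg_eq0. Qed.

Lemma elem_hsym l : elem (fun i => hsym_mpoly i N) l = mesym N int l.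
Proof.
elim/ltn_ind: l => -[_|l IH]; first by rewrite elem0 mesym0E.
have := @hsym_mesym l.+1 isT; rewrite big_ord_recl /= mul1r hsym_mpoly0 mul1r subn0.
move/eqP; rewrite addr_eq0 => /eqP ->; rewrite elemS -sumrN; apply: eq_bigr => i _.
by rewrite IH ?ltnS ?leq_subr // /bump /= add1n subSS exprS !mulN1r !mulNr opprK.
Qed.

Definition at_vars (f : symfun) : {mpoly int[N]} := f N.

Lemma at_vars_zmod : zmod_morphism at_vars. Proof. by []. Qed.
Lemma at_vars_monoid : monoid_morphism at_vars. Proof. by []. Qed.

HB.instance Definition _ := GRing.isZmodMorphism.Build symfun {mpoly int[N]} at_vars at_vars_zmod.
HB.instance Definition _ := GRing.isMonoidMorphism.Build symfun {mpoly int[N]} at_vars at_vars_monoid.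

Lemma at_vars_elem l : at_vars (elem hsym l) = mesym N int l.
Proof.
rewrite -elem_hsym; elim/ltn_ind: l => -[_|l IH]; first by rewrite !elem0 rmorph1.
rewrite !elemS rmorph_sum; apply: eq_bigr => i _.
by rewrite !rmorphM rmorphXn rmorphN1 /= IH // ltnS leq_subr.
Qed.

End Newton.

Section Independence.
Variable k : nat.
Local Notation K := k.+1.

Definition mults (la : seq nat) : 'X_{1..K} := [multinom count_mem (i : nat).+1 la | i < K].

Lemma mults_inj la mu : k_bounded K la -> k_bounded K mu -> mults la = mults mu -> la = mu.
Proof.
move=> bl bm e; have /andP[/andP[sl _] _] := bl; have /andP[/andP[sm _] _] := bm.
apply: (sorted_eq geq_trans) => //; first by move=> a b /andP[ba ab]; apply/eqP; rewrite eqn_leq; apply/andP.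
rewrite /perm_eq; apply/allP => p _ /=; have out (nu : seq nat) : k_bounded K nu -> ~~ (0 < p <= K)%N -> count_mem p nu = 0%N.
  by move=> /bounded_all /allP al np; apply/count_memPn; apply: contra np => /al.
have [/andP[p0 pK]|np] := boolP (0 < p <= K)%N; last by rewrite !out.
have pK' : (p.-1 < K)%N by rewrite prednK.
have := congr1 (fun m : 'X_{1..K} => m (Ordinal pK')) e.
by rewrite !mnmE /= prednK // => ->.
Qed.

Lemma prod_mults (R : comNzRingType) (f : nat -> R) la : all (fun l => 0 < l <= K)%N la ->
  \prod_(l <- la) f l = \prod_(i < K) f i.+1 ^+ mults la i.
Proof.
elim: la => [_|l la IH /= /andP[/andP[l0 lK] al]].
  by rewrite big_nil big1 // => i _; rewrite mnmE expr0.
rewrite big_cons IH //; have lK' : (l.-1 < K)%N by rewrite prednK.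
rewrite [RHS](bigD1 (Ordinal lK')) //= [in LHS](bigD1 (Ordinal lK')) //= mulrA.
rewrite !mnmE /= prednK // eqxx exprS; congr (_ * _).
apply: eq_bigr => i il; rewrite !mnmE /=.
by case: eqP => [e|_ //]; case/eqP: il; apply: val_inj; rewrite /= e.
Qed.

(** Specialising to K variables suffices, because the elementary symmetric polynomials e_1, ..., e_K
    are algebraically independent there, and [mults] makes bounded partitions into distinct
    monomials in them. *)
Lemma elem_independent : independent (k_bounded K) (hprod (elem hsym)).
Proof.
move=> r rP /(congr1 (@at_vars K)); rewrite rmorph0 rmorph_sum /= => lin0 i.
have [ir|] := boolP (i \in [seq x.2 | x <- r]); last exact: coef_notin.
have bi : k_bounded K i by case/mapP: ir => x /rP bx ->.
pose Q : {mpoly int[K]} := \sum_(x <- r) x.1 *: 'X_[mults x.2].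
have Q0 : Q = 0.
  apply: (@msym_fundamental_un0 K int); rewrite -[RHS]lin0 /Q raddf_sum /=.
  rewrite big_seq [RHS]big_seq; apply: eq_bigr => x /rP bx.
  rewrite comp_mpolyZ rmorphMz -[RHS]scaler_int; congr (_ *: _); first by rewrite intz.
  rewrite /hprod rmorph_prod /=.
  rewrite (eq_bigr (fun l => mesym K int l)) => [|l _]; last exact: at_vars_elem.
  rewrite (prod_mults _ (bounded_all bx)) comp_mpolyX.
  by apply: eq_bigr => j _; rewrite tnth_mktuple.
have := congr1 (mcoeff (mults i)) Q0; rewrite mcoeff0 /Q raddf_sum /=.
move=> <-; rewrite /coef big_mkcond /=.
rewrite big_seq [RHS]big_seq; apply: eq_bigr => x /rP bx; rewrite mcoeffZ mcoeffX.
case: (x.2 =P i) => [->|ne]; first by rewrite eqxx mulr1.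
by case: eqP => [/(mults_inj bx bi)//|_]; rewrite mulr0.
Qed.

End Independence.

(** * Containment of cores *)

Section Containment.
Variable k : nat.
Local Notation n := k.+2.
Local Notation K := k.+1.
Local Notation cong := (cong k).
Local Notation refl := (refl k).
Local Notation flip := (flip k).
Local Notation core := (bounded_to_core k.+1).
Local Notation bd := (core_to_bounded k.+1).
Implicit Types (la mu nu ka rho : seq nat) (T U : 'I_n -> int) (f : int -> nat).

(* The effect on bead counts of removing all removable boxes of residue c. *)
Definition remove (c : int) f (z : int) : nat :=
  if cong z c then maxn (f (z + 1)) (f (z - 1)).-1 else f z.

(** Monotonicity is the point of the formula with [maxn]: containment survives the simultaneous
    removal of boxes from both cores. *)
Lemma remove_le c f g : (forall z, (f z <= g z)%N) ->
  forall z, (remove c f z <= remove c g z)%N.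
Proof.
move=> le z; rewrite /remove; case: ifP => // _.
by have := le (z + 1); have := le (z - 1); lia.
Qed.

Lemma beads_near c z T i j : valid T -> cong (T i) c -> cong (T j) (c + 1) -> cong z c ->
  beads T (z - 1) = (beads T z + (z < T i)%R)%N /\
  beads T z = (beads T (z + 1) + (z + 1 < T j)%R)%N.
Proof.
move=> vT ic jc zc; split; first by apply: beads_pred => //; rewrite (congl _ ic) congC.
have := @beads_pred k (z + 1) T j vT; rewrite addrK => -> //.
by rewrite (congl _ jc) congDr congC.
Qed.

Lemma beads_remove c z T i j : valid T -> cong (T i) c -> cong (T j) (c + 1) ->
  T i + 1 < T j -> beads (refl c \o T) z = remove c (beads T) z.
Proof.
move=> vT ic jc ij; rewrite /remove; case: (boolP (cong z c)) => zc; last exact: beads_refl_eq.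
have [e1 e2] := beads_near vT ic jc zc; have := beads_refl vT ic jc zc.
case: (ltP z (T i)) e1; case: (ltP (z + 1) (T j)) e2; lia.
Qed.

Lemma beads_unremovable c z T i j : valid T -> cong (T i) c -> cong (T j) (c + 1) ->
  T j <= T i + 1 -> beads T z = remove c (beads T) z.
Proof.
move=> vT ic jc ij; rewrite /remove; case: (boolP (cong z c)) => zc //.
have [e1 e2] := beads_near vT ic jc zc.
case: (ltP z (T i)) e1; case: (ltP (z + 1) (T j)) e2; lia.
Qed.

(** The neighbouring counts are untouched by the reflection, so a core with removable boxes of
    residue c can be recovered after their removal. *)
Lemma beads_restore c z T i j : valid T -> cong (T i) c -> cong (T j) (c + 1) ->
  T i + 1 < T j -> cong z c -> beads T z = minn (beads T (z - 1)) (beads T (z + 1)).+1.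
Proof.
move=> vT ic jc ij zc; have [e1 e2] := beads_near vT ic jc zc.
case: (ltP z (T i)) e1; case: (ltP (z + 1) (T j)) e2; lia.
Qed.

Lemma no_removable T : valid T ->
  (forall i j, cong (T j) (T i + 1) -> T j <= T i + 1) -> rep [::] T.
Proof.
move=> vT no; apply: rep_nil => //.
have [j jmax] : exists j, forall q, T q <= T j.
  by case: (arg_maxP T (isT : xpredT (ord0 : 'I_n))) => j _ jmax; exists j => q; apply: jmax.
case: (ltP (T j) n%:Z) => [jn i|jn]; first exact: le_lt_trans (jmax i) jn.
apply: valid_small => // q.
(* Without removable boxes the gaps are the n consecutive integers ending at the maximum T j. If T j
   >= n they are nonnegative, so that [valid_small] applies. *)
have chain (d : nat) : exists i, T i = T j - d%:Z \/ (n <= d)%N.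
  elim: d => [|d [i [e|nd]]]; first by exists j; left; rewrite subr0.
    have [i' ci] := distinct_onto (T i - 1) vT.1; exists i'.
    have h1 : T i <= T i' + 1.
      by apply: no; rewrite congC (@cong_addr _ _ _ (T i') (T i - 1)) //; lia.
    have [dn|nd] := leqP n d.+1; first by right.
    left; case: (ltP (T i') (T i)) => h2; first by lia.
    have := cong_small ci; have := jmax i'; lia.
  by exists j; right; apply: leqW.
pose d := absz ((T j - T q) %% n%:Z)%Z.
have d0 : 0 <= ((T j - T q) %% n%:Z)%Z by rewrite modz_ge0.
have dn : ((T j - T q) %% n%:Z)%Z < n%:Z by rewrite ltz_pmod.
have [i [e|]] := chain d; last by rewrite /d; lia.
have cq : cong (T q) (T j - d%:Z).
  have -> : T j - d%:Z = T q + ((T j - T q) %/ n%:Z)%Z * n%:Z.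
    by have := divz_eq (T j - T q) n%:Z; rewrite /d; lia.
  by apply/congP; exists (- ((T j - T q) %/ n%:Z)%Z); lia.
have qi : q = i by apply: vT.1; rewrite e.
by rewrite qi e /d; lia.
Qed.

Lemma beads_ge z T : valid T -> - z - 1 <= (beads T z)%:Z.
Proof.
move=> vT; have := beads_flip (- z - 2) vT.
by rewrite (_ : - (- z - 2) - 2 = z); lia.
Qed.

(* Containment of cores is the strong Bruhat order: it is graded by inv. *)
Lemma beads_le_inv T T' : valid T -> valid T' ->
  (forall z, (beads T z <= beads T' z)%N) ->
  (inv T <= inv T')%N /\ (inv T = inv T' -> forall z, beads T z = beads T' z).
Proof.
have [m] := ubnP (inv T'); elim: m T T' => // m IH T T' lem vT vT' le.
have [/existsP[i /existsP[j /andP[cij lij]]]|no] :=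
  boolP [exists i, exists j, cong (T' j) (T' i + 1) && (T' i + 1 < T' j)].
  pose c := T' i; have ic : cong (T' i) c by rewrite congxx.
  have E := inv_refl vT' ic cij; rewrite lij (_ : (T' j < T' i) = false) in E; last by lia.
  have vU' := refl_valid c vT'.
  have [p [q [_ pc qc _]]] := refl_labels c vT.1.
  (* If T has no removable box of residue c, it is already contained in the reduced T', and its
     length is strictly smaller. Otherwise both are reduced. *)
  have [up|down] := leP (T q) (T p + 1).
    have lU z : (beads T z <= beads (refl c \o T') z)%N.
      rewrite (beads_remove z vT' ic cij lij) (beads_unremovable z vT pc qc up).
      exact: remove_le.
    have lt : (inv (refl c \o T') < m)%N by lia.
    by have [h1 h2] := IH _ _ lt vT vU' lU; split; lia.
  have lU z : (beads (refl c \o T) z <= beads (refl c \o T') z)%N.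
    rewrite (beads_remove z vT' ic cij lij) (beads_remove z vT pc qc down).
    exact: remove_le.
  have E2 := inv_refl vT pc qc; rewrite down (_ : (T q < T p) = false) in E2; last by lia.
  have lt : (inv (refl c \o T') < m)%N by lia.
  have [h1 h2] := IH _ _ lt (refl_valid c vT) vU' lU; split; first by lia.
  move=> e z; have {}h2 : forall z, beads (refl c \o T) z = beads (refl c \o T') z by apply: h2; lia.
  have same y : ~~ cong y c -> beads T y = beads T' y.
    by move=> yc; rewrite -(beads_refl_eq vT yc) -(beads_refl_eq vT' yc).
  (* Only at class c could the removal have hidden a difference; there both counts are restored from
     their equal neighbours. *)
  have [zc|zc] := boolP (cong z c); last exact: same.
  rewrite (beads_restore vT pc qc down zc) (beads_restore vT' ic cij lij zc).
  rewrite !same //; first by rewrite congC ncongS // congC.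
  by apply/negP; rewrite congC => /ncongS; rewrite subrK congC zc.
(* The larger core is empty, and its bead counts are the least possible by [beads_ge]. *)
have r0 : rep [::] T'.
  apply: no_removable => // i j cij; rewrite leNgt; apply: contra no => lij.
  by apply/existsP; exists i; apply/existsP; exists j; rewrite cij.
have val z : beads T' z = if z is Negz m then m else 0%N.
  by rewrite -(r0 (absz z)) ?nbeads_nil //; lia.
have eqb z : beads T z = beads T' z.
  apply/eqP; rewrite eqn_leq le val; have := beads_ge z vT.
  by case: z => q; lia.
split=> // ; rewrite /inv big1 // => i _; rewrite eqb val.
have := beads_self i vT; rewrite !eqb !val; case: (T i) => // q.
case E : (Negz q - 1) => [q'|q']; lia.
Qed.

Lemma contained_core_eq ka mu : is_core n ka -> is_core n mu ->
  (forall r, (nth 0 ka r <= nth 0 mu r)%N) -> sumn (bd ka) = sumn (bd mu) -> ka = mu.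
Proof.
move=> ck cm le sz; have [T [vT iT rT]] := exists_rep ck; have [U [vU iU rU]] := exists_rep cm.
have [pk _] := ck; have [pm _] := cm.
rewrite (sumn_bounded_rep pk vT iT rT) (sumn_bounded_rep pm vU iU rU) in sz.
have leb z : (beads T z <= beads U z)%N.
  pose N := (size ka + size mu + absz z)%N.
  rewrite -(rT N) -?(rU N) /N; try by lia.
  apply: sub_count => r; have := le r; rewrite /bead; lia.
have [_ /(_ sz) e] := beads_le_inv vT vU leb.
by apply: rep_unique pk pm (rep_eq _ rT) rU => z; rewrite e.
Qed.

Lemma spanned_reindex (R : comNzRingType) (P : seq nat -> Prop) (s : seq nat -> R)
    (f : R) (g : seq nat -> seq nat) :
  spanned P (s \o g) f -> spanned (fun nu => exists2 la, nu = g la & P la) s f.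
Proof.
case=> r rP ->; exists [seq (x.1, g x.2) | x <- r].
  by move=> _ /mapP[x xr ->] /=; exists x.2 => //; apply: rP.
by rewrite /lin big_map.
Qed.

Variable s : seq nat -> symfun.
Hypothesis hs : is_kschur K s.

Lemma kschur_pieri : pieri_family k hsym s.
Proof. by move=> l mu lK bm; case: hs => _ _; apply. Qed.

Lemma k_conj_nil : k_conj K [::] = [::].
Proof. by apply: size0nil; rewrite /k_conj size_bounded size_conj core_nil. Qed.

Lemma kschur_conj_nil : (s \o k_conj K) [::] = 1.
Proof. by rewrite /= k_conj_nil; case: hs. Qed.

(** Independence is first obtained for s composed with [k_conj], which expands in products of the
    e_l, and then carried over along the involution [k_conj]. *)
Lemma kschur_indep : independent (k_bounded K) s.
Proof.
have ind := kschur_independent (pieri_family_conj kschur_pieri) kschur_conj_nil (@elem_independent k).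
move=> r rP lin0 i; have [ir|] := boolP (i \in [seq x.2 | x <- r]); last exact: coef_notin.
have bi : k_bounded K i by case/mapP: ir => x /rP bx ->.
pose r' := [seq (x.1, k_conj K x.2) | x <- r].
have r'P x : x \in r' -> k_bounded K x.2.
  by case/mapP=> y /rP Py -> /=; apply: k_conj_bounded.
have lin0' : lin (s \o k_conj K) r' = 0.
  rewrite -lin0 /lin big_map big_seq [RHS]big_seq; apply: eq_bigr => x /rP Px.
  by rewrite /= k_conjK.
rewrite -(ind r' r'P lin0' (k_conj K i)) /coef big_map /= big_seq_cond [RHS]big_seq_cond.
apply: eq_bigl => x; case xr : (x \in r) => //=; have Px := rP x xr.
by apply/eqP/eqP => [->//|/(congr1 (k_conj K))]; rewrite !k_conjK.
Qed.

(* Expanding s (bd rho1) in the h-basis bounds the rows of the cores in the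
   product, and the dual Pieri rule bounds their columns, so that they are
   contained in mu. *)
Lemma kschur_stack rho1 rho2 mu : is_core n rho1 -> is_core n rho2 -> is_core n mu ->
  bd mu = bd rho1 ++ bd rho2 ->
  (forall r, (r < size rho1)%N -> nth 0%N mu r = (nth 0%N rho1 r + nth 0%N rho2 0)%N) ->
  (forall r, nth 0%N mu (r + size rho1) = nth 0%N rho2 r) ->
  s (bd mu) = s (bd rho1) * s (bd rho2).
Proof.
move=> c1 c2 cm e up low.
have b1 := core_bounded c1; have b2 := core_bounded c2; have bm := core_bounded cm.
have s0 : s [::] = 1 by case: hs.
symmetry.
have H1 := @kschur_mul_cat k _ _ s kschur_pieri s0 (bd rho1) (bd rho2).
rewrite -e in H1; have {}H1 := H1 bm b1 b2.
(* The factors change roles: the one expanded in products of the e_l is s_rho2, so the shift of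
   columns is the number of columns of rho2. *)
have H2 := kschur_mul (pieri_family_conj kschur_pieri) kschur_conj_nil
  (k_conj_bounded b2) (k_conj_bounded b1).
move/spanned_reindex: H2; rewrite /= !k_conjK // mulrC => H2.
have ne i : below k (sumn (bd rho1) + sumn (bd rho2)) (size (bd rho1))
    (weight (bd mu)) (bd rho2) i -> i <> bd mu.
  by move=> [_ _ _ lt] ei; rewrite ei ltnn in lt.
apply: (spanned_unique kschur_indep bm _ _ _ _ H1 H2) => [i []|i [la -> [bl _ _ _]]|i|i B1] //.
- exact: k_conj_bounded.
- exact: ne.
(* A common index of the two expansions has a core contained in mu of the same bounded size, hence
   is mu, which [ne] excludes. *)
case=> la ei [bl _ rl _]; have := ne _ B1; apply; case: B1 => bi si ri _.
have [ci Ei] := bounded_coreP bi; have [cl El] := bounded_coreP bl.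
suff ec : core i = mu by rewrite -Ei ec.
apply: contained_core_eq => //; last by rewrite Ei si e sumn_cat.
have pi := ci.1; have p1 := c1.1.
have Ec : conj_part (core i) = core la.
  have pl := cl.1; rewrite ei -{1}El k_conjE // core_to_boundedK; last exact: conj_core.
  by rewrite conj_partK.
move=> r; have [rs|rs] := ltnP r (size rho1); last first.
  have := ri (r - size rho1)%N; rewrite core_to_boundedK // size_bounded -low subnK //.
(* For an upper row: the column with index (rho1)_r + (rho2)_0 is at most column (rho1)_r of rho1,
   whose height is at most r. *)
rewrite up // leqNgt -lt_conj // Ec -leqNgt.
have := rl (nth 0%N rho1 r); rewrite size_bounded.
have -> : size (conj_part (core (bd rho2))) = nth 0%N rho2 0 by rewrite size_conj core_to_boundedK.
rewrite k_conjE // core_to_boundedK; last exact: conj_core.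
move/leq_trans; apply; by rewrite leqNgt lt_conj // ltnn.
Qed.

End Containment.

(** * Components of the boundary *)

Section Connectedness.
Local Open Scope nat_scope.
Implicit Types (S : set box) (b c d : box).

Lemma joined_refl S b : S b -> joined S b b.
Proof. by move=> Sb; exists [::]; split=> // x; rewrite inE => /eqP ->. Qed.

Lemma joined_trans S c b d : joined S b c -> joined S c d -> joined S b d.
Proof.
move=> [p [pp lp Sp]] [q [pq lq Sq]]; exists (p ++ q); split.
- by rewrite cat_path pp lp.
- by rewrite last_cat lp.
move=> x; rewrite -cat_cons mem_cat => /orP[/Sp //|xq].
by apply: Sq; rewrite in_cons xq orbT.
Qed.

Lemma adjacentC b c : adjacent b c = adjacent c b.
Proof.
by rewrite /adjacent (eq_sym b.1) (eq_sym b.2) (orbC (b.2.+1 == _)) (orbC (b.1.+1 == _)).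
Qed.

Lemma joined_sym S b c : joined S b c -> joined S c b.
Proof.
move=> [p [pp lp Sp]]; exists (rev (belast b p)); split.
- rewrite -lp rev_path; rewrite (eq_path (e' := adjacent)) // => x y.
  exact: adjacentC.
- by case: p {pp Sp} lp => [//|a p] lp /=; rewrite rev_cons last_rcons.
move=> x; rewrite -lp -rev_rcons -lastI mem_rev; exact: Sp.
Qed.

Lemma joined_step S b c : S b -> S c -> adjacent b c -> joined S b c.
Proof.
move=> Sb Sc bc; exists [:: c]; split=> //=; first by rewrite bc.
by move=> x; rewrite !inE => /orP[/eqP ->|/eqP ->].
Qed.

Lemma joined_inl S b c : joined S b c -> S b.
Proof. by case=> p [_ _]; apply; rewrite mem_head. Qed.

Lemma joined_inr S b c : joined S b c -> S c.
Proof. by move/joined_sym/joined_inl. Qed.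

Lemma components_connected S b : S b -> connected_shape S ->
  shape_components S = [set S]%classic.
Proof.
move=> Sb conn; have e c : S c -> joined S c = S.
  move=> Sc; apply/funext => d; apply/propext; split; last exact: conn.
  exact: joined_inr.
apply/seteqP; split=> [_ [c Sc <-]|_ ->]; first exact: e.
by exists b => //; apply: e.
Qed.

Definition apart S1 S2 := forall b c, S1 b -> S2 c -> ~~ adjacent b c /\ b <> c.

Lemma apartC S1 S2 : apart S1 S2 -> apart S2 S1.
Proof. by move=> ap b c Sb Sc; have [h1 h2] := ap c b Sc Sb; rewrite adjacentC; split=> // /esym. Qed.

Lemma joined_apart S1 S2 b : apart S1 S2 -> S1 b ->
  joined (S1 `|` S2)%classic b = joined S1 b.
Proof.
move=> ap S1b; apply/funext => d; apply/propext; split; last first.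
  by case=> p [pp lp Sp]; exists p; split=> // x /Sp; left.
case=> p; elim: p b S1b => [|c p IH] b S1b [/= pp lp Sp].
  by rewrite -lp; apply: joined_refl.
have S1c : S1 c.
  have [|//|S2c] := Sp c; first by rewrite !inE eqxx orbT.
  by have [/negP[]] := ap _ _ S1b S2c; case/andP: pp.
apply: (@joined_trans _ c); first by apply: joined_step => //; case/andP: pp.
apply: (IH c S1c); case/andP: pp => _ pp; split=> // x xp; apply: Sp.
by rewrite in_cons xp orbT.
Qed.

Lemma components_apart S1 S2 : apart S1 S2 ->
  shape_components (S1 `|` S2)%classic = (shape_components S1 `|` shape_components S2)%classic.
Proof.
move=> ap; apply/seteqP; split=> [_ [b [Sb|Sb] <-]|_ [[b Sb <-]|[b Sb <-]]].
- by left; exists b => //; rewrite (joined_apart ap).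
- by right; exists b => //; rewrite classical_sets.setUC (joined_apart (apartC ap)).
- by exists b; [left|rewrite (joined_apart ap)].
by exists b; [right|rewrite classical_sets.setUC (joined_apart (apartC ap))].
Qed.

Lemma components_disjoint S1 S2 X : apart S1 S2 ->
  shape_components S1 X -> ~ shape_components S2 X.
Proof.
move=> ap [b Sb <-] [c Sc e]; have : joined S1 b b by apply: joined_refl.
by rewrite -e => /joined_inr S2b; have [_] := ap _ _ Sb S2b.
Qed.

End Connectedness.

(** * Cutting a core along its boundary *)

Section Blocks.
Local Open Scope nat_scope.
Variable k : nat.
Local Notation n := k.+2.
Local Notation K := k.+1.
Local Notation bd := (core_to_bounded k.+1).
Implicit Types (mu rho : seq nat).

Lemma hook_mono mu r r' c c' : is_part mu -> r <= r' -> c <= c' -> c' < nth 0 mu r' ->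
  hook_length mu (r', c') <= hook_length mu (r, c).
Proof.
move=> pm rr cc h; have h1 := nth_part pm rr.
have h2 := nth_part (conj_is_part pm) cc.
have := lt_conj c' r' pm; rewrite h /hook_length /= => h3; lia.
Qed.

Lemma count_suffix (p : pred nat) m c : (forall a a', a <= a' -> a' < m -> p a -> p a') ->
  c < m -> p c = (m - count p (iota 0 m) <= c).
Proof.
elim: m c => // m IH c up cm; rewrite -addn1 iotaD count_cat /= add0n addn0.
have up' a a' : a <= a' -> a' < m -> p a -> p a' by move=> h1 h2; apply: up => //; apply: leqW.
have cs : count p (iota 0 m) <= m by apply: leq_trans (count_size _ _) _; rewrite size_iota.
have [pm|npm] := boolP (p m).
  rewrite subnDr; move: cm; rewrite ltnS leq_eqVlt => /orP[/eqP ->|cm]; last exact: IH.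
  by rewrite pm leq_subr.
have nop a : a <= m -> ~~ p a by move=> am; apply: contra npm; apply: up.
rewrite (negbTE (nop _ _)) // addn0.
have -> : count p (iota 0 m) = 0.
  apply/eqP; rewrite -leqn0 leqNgt -has_count; apply/hasPn => a; rewrite mem_iota => am.
  by apply: nop; lia.
by rewrite subn0 leqNgt addn1 cm.
Qed.

Definition start mu r := nth 0 mu r - nth 0 (bd mu) r.

Lemma boundaryE mu r c : is_part mu ->
  boundary K mu (r, c) <-> start mu r <= c < nth 0 mu r.
Proof.
move=> pm; rewrite /boundary /diagram /start nth_core_to_bounded /=.
have key : c < nth 0 mu r -> (hook_length mu (r, c) <= K) =
    (nth 0 mu r - count (fun j => hook_length mu (r, j) <= K) (iota 0 (nth 0 mu r)) <= c).
  move=> cr; apply: (count_suffix (p := fun j => hook_length mu (r, j) <= K)) => // a a' aa' a'r.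
  by apply: leq_trans; apply: hook_mono.
by split=> [[cr h]|/andP[h cr]]; [rewrite -key ?h ?cr|split; rewrite ?key].
Qed.

Lemma bounded_le mu r : nth 0 (bd mu) r <= nth 0 mu r.
Proof.
by rewrite nth_core_to_bounded; apply: leq_trans (count_size _ _) _; rewrite size_iota.
Qed.

Lemma start_lt mu r : is_core n mu -> r < size mu -> start mu r < nth 0 mu r.
Proof.
move=> cm rm; have /andP[pb _] := core_bounded cm.
have := nth_part_gt0 r pb; rewrite size_bounded rm /start.
by have := nth_part_gt0 r cm.1; rewrite rm; lia.
Qed.

(** If row r + 1 contains the column where the boundary of row r starts, the box there has an even
    smaller hook; otherwise row r + 1 ends before it. *)
Lemma startS mu r : is_core n mu -> start mu r.+1 <= start mu r.
Proof.
move=> cm; have [pm _] := cm; have [h|h] := leqP (nth 0 mu r.+1) (start mu r).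
  by apply: leq_trans h; apply: leq_subr.
have : boundary K mu (r.+1, start mu r).
  split=> //=; apply: leq_trans (_ : hook_length mu (r, start mu r) <= _).
    exact: hook_mono.
  have rm : r < size mu.
    by apply: ltn_trans (ltnSn r) _; rewrite -(nth_part_gt0 _ pm); apply: leq_ltn_trans h.
  have : boundary K mu (r, start mu r) by apply/boundaryE => //; rewrite leqnn start_lt.
  by case.
by case/(boundaryE _ _ pm)/andP.
Qed.

(** Row i ends before the boundary of row i - 1 starts. Boundary boxes above and below this line
    then share no column, and only diagonal contact remains possible. *)
Definition splits_at mu i := (0 < i < size mu) && (nth 0 mu i <= start mu i.-1).

Lemma shift_adjacent v b c : adjacent (shift v b) (shift v c) = adjacent b c.
Proof. by rewrite /adjacent /shift /= -!addnS !eqn_add2l. Qed.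

Lemma shiftI v : injective (shift v).
Proof. by move=> [r c] [r' c']; rewrite /shift /= => -[/addnI -> /addnI ->]. Qed.

Lemma shiftA v w b : shift v (shift w b) = shift (shift v w) b.
Proof. by rewrite /shift /= !addnA. Qed.

Lemma image_shiftE v S b : (shift v @` S)%classic (shift v b) <-> S b.
Proof. by split=> [[c Sc /shiftI <-]|Sb]; [|exists b]. Qed.

Lemma unsplit_connected mu v : is_core n mu -> (forall i, ~~ splits_at mu i) ->
  connected_shape (shift v @` boundary K mu)%classic.
Proof.
move=> cm nosplit; have [pm _] := cm; set S := (_ @` _)%classic.
have inS r c : start mu r <= c < nth 0 mu r -> S (shift v (r, c)).
  by move=> h; apply/image_shiftE/boundaryE.
have row r c d : start mu r <= c -> c + d < nth 0 mu r ->
    joined S (shift v (r, c)) (shift v (r, c + d)).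
  move=> h; elim: d => [|d IH] cd.
    by rewrite addn0 in cd *; apply/joined_refl/inS; rewrite h.
  apply: joined_trans (IH _) _; first by lia.
  apply: joined_step; try by apply: inS; lia.
  by rewrite shift_adjacent /adjacent /= eqxx addnS eqxx.
have col r : r < size mu -> joined S (shift v (0, start mu 0)) (shift v (r, start mu r)).
  elim: r => [|r IH] rm; first by apply/joined_refl/inS; rewrite leqnn start_lt.
  have rm' : r < size mu by apply: ltnW.
  apply: joined_trans (IH rm') _.
  (* As mu is not cut here, the box below the first boundary box of row r exists, and it joins the
     two rows. *)
  have lt : start mu r < nth 0 mu r.+1.
    by have := nosplit r.+1; rewrite /splits_at rm /= -ltnNge.
  apply: (@joined_trans _ (shift v (r.+1, start mu r))).
    apply: joined_step; [by apply: inS; rewrite leqnn start_lt| |].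
      by apply: inS; rewrite startS.
    by rewrite shift_adjacent /adjacent /= !eqxx orbT.
  apply: joined_sym; rewrite -(subnKC (startS r cm)); apply: row => //.
  by rewrite subnKC // startS.
have all b : S b -> joined S (shift v (0, start mu 0)) b.
  case=> -[r c] /(boundaryE _ _ pm)/andP[h1 h2] <-.
  apply: joined_trans (col r _) _; first by rewrite -(nth_part_gt0 _ pm); apply: leq_ltn_trans h2.
  by rewrite -(subnKC h1); apply: row => //; rewrite subnKC.
by move=> b c /all jb /all; apply/joined_trans/joined_sym.
Qed.

Lemma translates_bounded mu rho v : is_core n mu -> is_core n rho -> mu != [::] ->
  translates (boundary K rho) (shift v @` boundary K mu)%classic -> bd rho = bd mu.
Proof.
move=> cm cr mu0 [u [w]].
have -> : (shift u @` (shift v @` boundary K mu) = shift (shift u v) @` boundary K mu)%classic.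
  apply/seteqP; split=> [_ [_ [b Sb <-] <-]|_ [b Sb <-]].
    by exists b => //; rewrite shiftA.
  by exists (shift v b); [exists b|rewrite shiftA].
move: (shift u v) => {u v} u e.
have first ka : is_core n ka -> ka != [::] -> boundary K ka (0, start ka 0).
  by move=> ck k0; apply/boundaryE; rewrite ?leqnn ?start_lt //; [case: ck|case: ka k0 ck].
have trans ka la p q : (shift p @` boundary K ka = shift q @` boundary K la)%classic ->
    forall b, boundary K ka b -> exists2 c, boundary K la c & shift p b = shift q c.
  move=> E b Bb; have : (shift q @` boundary K la)%classic (shift p b) by rewrite -E; exists b.
  by case=> c Bc <-; exists c.
have rho0 : rho != [::].
  have [c Bc _] := trans _ _ _ _ (esym e) _ (first _ cm mu0).
  by apply/eqP => r0; move: Bc; rewrite r0 => -[]; rewrite /diagram /= nth_nil.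
(* Row 0 of both boundaries is occupied, so the translation cannot move rows. *)
have rows : w.1 = u.1.
  have [[r c] _ [h1 _]] := trans _ _ _ _ e _ (first _ cr rho0).
  have [[r' c'] _ [h2 _]] := trans _ _ _ _ (esym e) _ (first _ cm mu0).
  by move: h1 h2; rewrite /=; lia.
(* The images of the first and last box of a boundary row show that the other row is at least as
   long. *)
have le ka la p q : is_core n ka -> is_core n la -> p.1 = q.1 ->
    (shift p @` boundary K ka = shift q @` boundary K la)%classic ->
    forall r, nth 0 (bd ka) r <= nth 0 (bd la) r.
  move=> ck cl pq E r; have [rk|rk] := ltnP r (size ka); last first.
    by rewrite nth_default // size_bounded.
  have [pk _] := ck; have [pl _] := cl; have lt := start_lt ck rk.
  have [|[r1 c1] /(boundaryE _ _ pl) B1 [e1 e1']] := trans _ _ _ _ E (r, start ka r).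
    by apply/boundaryE; rewrite ?leqnn.
  have [|[r2 c2] /(boundaryE _ _ pl) B2 [e2 e2']] := trans _ _ _ _ E (r, (nth 0 ka r).-1).
    by apply/boundaryE => //; lia.
  have {e1} e1 : r1 = r by move: e1; rewrite /= pq => /addnI.
  have {e2} e2 : r2 = r by move: e2; rewrite /= pq => /addnI.
  subst r1 r2; move: (bounded_le ka r) e1' e2' B1 B2 lt; rewrite /start.
  by move: (nth 0 (bd ka) r) (nth 0 (bd la) r) (nth 0 ka r) (nth 0 la r) => *; lia.
have /andP[pb _] := core_bounded cm; have /andP[pb' _] := core_bounded cr.
apply: eq_part => // r; apply/eqP; rewrite eqn_leq.
by rewrite (le _ _ _ _ cr cm rows e) (le _ _ _ _ cm cr (esym rows) (esym e)).
Qed.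

Section Split.
Variables (mu : seq nat) (i : nat).
Hypotheses (cm : is_core n mu) (sp : splits_at mu i).

Definition upper := [seq x - nth 0 mu i | x <- take i mu].
Definition lower := drop i mu.

Let t := nth 0 mu i.
Let pm : is_part mu := cm.1.
Let im : i < size mu. Proof. by case/andP: sp => /andP[]. Qed.
Let i0 : 0 < i. Proof. by case/andP: sp => /andP[]. Qed.
Let t_start : t <= start mu i.-1. Proof. by case/andP: sp. Qed.

Let t_lt r : r < i -> t < nth 0 mu r.
Proof.
move=> ri; apply: leq_ltn_trans t_start _; apply: leq_trans (start_lt cm _) _.
  by apply: leq_ltn_trans im; apply: leq_pred.
by apply: nth_part => //; lia.
Qed.

Lemma size_upper : size upper = i.
Proof. by rewrite size_map size_takel // ltnW. Qed.

Lemma nth_upper r : nth 0 upper r = if r < i then nth 0 mu r - t else 0.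
Proof.
case: ltnP => ri; last by rewrite nth_default // size_upper.
by rewrite (nth_map 0) ?nth_take // size_takel // ltnW.
Qed.

Lemma nth_lower r : nth 0 lower r = nth 0 mu (i + r).
Proof. by rewrite nth_drop. Qed.

Lemma upper_part : is_part upper.
Proof.
apply/andP; split.
  apply/(sortedP 0) => r; rewrite size_upper => ri; rewrite !nth_upper ri ltnW //.
  by apply: leq_sub2r; apply: nth_part.
apply/negP => /(nthP 0)[r]; rewrite size_upper => ri; rewrite nth_upper ri.
by have := t_lt ri; lia.
Qed.

Lemma lower_part : is_part lower.
Proof.
have /andP[srt m0] := pm; apply/andP; split; first by apply: drop_sorted.
by apply: contra m0; apply: mem_drop.
Qed.

Lemma conj_upper c : nth 0 (conj_part upper) c = nth 0 (conj_part mu) (c + t).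
Proof.
apply: eq_lt_nat => r; rewrite !lt_conj // ?upper_part // nth_upper.
case: (ltnP r i) => ri; first by rewrite ltn_subRL addnC.
apply/esym/negbTE; rewrite -leqNgt; apply: leq_trans (nth_part pm ri) (leq_addl _ _).
Qed.

Lemma conj_lower c : c < t -> nth 0 (conj_part mu) c = i + nth 0 (conj_part lower) c.
Proof.
move=> ct; apply: eq_lt_nat => r; rewrite lt_conj //.
have [ri|ri] := ltnP r i; first by rewrite (ltn_trans ct (t_lt ri)); lia.
by rewrite -{1}(subnKC ri) -nth_lower -lt_conj ?lower_part //; lia.
Qed.

Lemma hook_upper r c : c < nth 0 upper r ->
  hook_length upper (r, c) = hook_length mu (r, c + t).
Proof.
rewrite /hook_length /= conj_upper nth_upper; case: ifP => // ri cr.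
by congr (_ + _ + _); lia.
Qed.

Lemma hook_lower r c : c < nth 0 lower r ->
  hook_length lower (r, c) = hook_length mu (i + r, c).
Proof.
move=> cr; have ct : c < t.
  by apply: leq_trans cr _; rewrite nth_lower; apply: nth_part => //; apply: leq_addr.
by rewrite /hook_length /= nth_lower (conj_lower ct); congr (_ + _ + _); lia.
Qed.

(** In row i - 1 the column c lies before the start of the boundary, and hooks only grow towards the
    top. The rectangle to the left of the upper block is thus free of boundary boxes. *)
Lemma hook_corner r c : r < i -> c < t -> K < hook_length mu (r, c).
Proof.
move=> ri ct; have c1 : c < start mu i.-1 by apply: leq_trans t_start.
have c2 : c < nth 0 mu i.-1 by apply: leq_trans c1 (leq_subr _ _).
apply: leq_trans (_ : hook_length mu (i.-1, c) <= _); last by apply: hook_mono => //; lia.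
rewrite ltnNge; apply/negP => h.
have : boundary K mu (i.-1, c) by split.
by case/(boundaryE _ _ pm)/andP; lia.
Qed.

Lemma upper_core : is_core n upper.
Proof.
split; first exact: upper_part.
move=> [r c] rc; rewrite hook_upper //; apply: cm.2; rewrite /diagram /=.
by move: rc; rewrite /diagram /= nth_upper; case: ifP => //; lia.
Qed.

Lemma lower_core : is_core n lower.
Proof.
split; first exact: lower_part.
move=> [r c] rc; rewrite hook_lower //; apply: cm.2.
by move: rc; rewrite /diagram /= nth_lower.
Qed.

Lemma bounded_split : bd mu = bd upper ++ bd lower.
Proof.
apply: (@eq_from_nth _ 0).
  by rewrite size_cat !size_bounded size_upper size_drop subnKC // ltnW.
move=> r _; rewrite nth_cat size_bounded size_upper !nth_core_to_bounded.
case: ltnP => ri; last first.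
  rewrite nth_lower subnKC //; apply: eq_in_count => c; rewrite mem_iota => cr.
  by rewrite hook_lower ?nth_lower ?subnKC.
rewrite nth_upper ri -{1}(subnKC (ltnW (t_lt ri))) iotaD count_cat add0n.
rewrite (_ : count _ (iota 0 t) = 0); last first.
  apply/eqP; rewrite -leqn0 leqNgt -has_count; apply/hasPn => c; rewrite mem_iota => ct.
  by rewrite -ltnNge hook_corner.
rewrite add0n -[X in iota X _]addn0 iotaDl count_map; apply: eq_in_count => c.
by rewrite mem_iota => cr /=; rewrite hook_upper ?nth_upper ?ri // addnC.
Qed.

Lemma boundary_split : boundary K mu =
  (shift (0, t) @` boundary K upper `|` shift (i, 0) @` boundary K lower)%classic.
Proof.
apply/seteqP; split=> [[r c] [rc h]|_ [[[r c] [rc h] <-]|[[r c] [rc h] <-]]].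
- rewrite /diagram /= in rc; have [ri|ri] := ltnP r i.
    have ct : t <= c by rewrite leqNgt; apply/negP => ct; have := hook_corner ri ct; lia.
    left; exists (r, c - t); last by rewrite /shift /= subnKC.
    have c' : c - t < nth 0 upper r by rewrite nth_upper ri ltn_sub2r // t_lt.
    by split=> //; rewrite hook_upper // subnK.
  right; exists (r - i, c); last by rewrite /shift /= subnKC.
  have c' : c < nth 0 lower (r - i) by rewrite nth_lower subnKC.
  by split=> //; rewrite hook_lower // subnKC.
- rewrite /shift /= add0n addnC; split; last by rewrite -hook_upper.
  by move: rc; rewrite /diagram /= nth_upper; case: ifP => //; lia.
rewrite /shift /=; split; last by rewrite -hook_lower.
by move: rc; rewrite /diagram /= nth_lower.
Qed.

Lemma split_apart v : apart (shift (shift v (0, t)) @` boundary K upper)%classic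
  (shift (shift v (i, 0)) @` boundary K lower)%classic.
Proof.
move=> _ _ [[r c] [rc _] <-] [[r' c'] [rc' _] <-]; rewrite /diagram /= in rc rc'.
have ri : r < i by move: rc; rewrite nth_upper; case: ifP.
have ct : c' < t.
  by apply: leq_trans rc' _; rewrite nth_lower; apply: nth_part => //; apply: leq_addr.
split; last by rewrite /shift /= => -[]; lia.
by apply/negP; rewrite /adjacent /shift /=; lia.
Qed.

End Split.

Variable s : seq nat -> symfun.
Hypothesis hs : is_kschur K s.

Lemma kschur_split mu i : is_core n mu -> splits_at mu i ->
  s (bd mu) = (s (bd (upper mu i)) * s (bd (lower mu i)))%R.
Proof.
move=> cm sp; apply: (kschur_stack hs _ _ cm (bounded_split cm sp)).
- exact: upper_core.
- exact: lower_core.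
- move=> r; rewrite size_upper // nth_upper // => ri; rewrite ri nth_lower addn0 subnK //.
  by apply: nth_part; [case: cm|apply: ltnW].
by move=> r; rewrite size_upper // nth_lower addnC.
Qed.

(** The translation v and the index set A are general for the sake of the induction on rows: a cut
    leaves the components in place and distributes them over the upper and the lower block. *)
Lemma kschur_components (r : nat) (rho : 'I_r -> seq nat) (C : 'I_r -> set box)
    mu v (A : {set 'I_r}) : is_core n mu ->
  {in A &, injective C} ->
  (C @` [set` A])%classic = shape_components (shift v @` boundary K mu)%classic ->
  (forall i, i \in A -> is_core n (rho i) /\ translates (boundary K (rho i)) (C i)) ->
  s (bd mu) = (\prod_(i in A) s (bd (rho i)))%R.
Proof.
have [m] := ubnP (size mu); elim: m mu v A => // m IH mu v A lem cm injC CA tr.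
have [mu0|mu0] := eqVneq mu [::].
  rewrite big1 ?mu0; first by case: hs.
  move=> i iA; have : (C @` [set` A])%classic (C i) by exists i.
  by rewrite CA mu0 => -[_ [b [+ _] _] _]; rewrite /diagram /= nth_nil.
have [[i sp]|nosplit] := pselect (exists i, splits_at mu i); last first.
  have conn : connected_shape (shift v @` boundary K mu)%classic.
    by apply: unsplit_connected => // i; apply/negP => sp; apply: nosplit; exists i.
  have B0 : (shift v @` boundary K mu)%classic (shift v (0, start mu 0)).
    apply/image_shiftE/boundaryE; first by case: cm.
    by rewrite leqnn start_lt //; case: (mu) mu0.
  rewrite (components_connected B0 conn) in CA.
  have CE i : i \in A -> C i = (shift v @` boundary K mu)%classic.
    move=> iA; have : (C @` [set` A])%classic (C i) by exists i.
    by rewrite CA.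
  have [i iA _] : (C @` [set` A])%classic (shift v @` boundary K mu)%classic by rewrite CA.
  have -> : A = [set i]%SET.
    apply/setP => j; rewrite inE; apply/idP/eqP => [jA|->//].
    by apply: injC => //; rewrite !CE.
  rewrite big_set1; have [ci ti] := tr i iA; rewrite CE // in ti.
  by rewrite (translates_bounded cm ci mu0 ti).
rewrite (kschur_split cm sp).
have ap := @split_apart mu i cm sp v.
have SE : (shift v @` boundary K mu = shift (shift v (0, nth 0 mu i)) @` boundary K (upper mu i)
   `|` shift (shift v (i, 0)) @` boundary K (lower mu i))%classic.
  rewrite (boundary_split cm sp) image_setU; congr (_ `|` _)%classic;
    by rewrite image_comp; apply: eq_imagel => b _ /=; rewrite shiftA.
rewrite SE (components_apart ap) in CA.
move: ap CA; set S1 := (X in apart X _); set S2 := (X in apart _ X) => ap CA.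
(* The indices whose component lies in the upper block; since the blocks are apart, all other
   indices of A belong to the lower one. *)
pose P1 j := `[< shape_components S1 (C j) >].
have sz : 0 < i < size mu by case/andP: sp.
have inA j : j \in A -> (shape_components S1 `|` shape_components S2)%classic (C j).
  by move=> jA; rewrite -CA; exists j.
have CA1 : (C @` [set` [set j in A | P1 j]%SET])%classic = shape_components S1.
  apply/seteqP; split=> [_ [j /= + <-]|X X1]; first by rewrite inE => /andP[_ /asboolP].
  have : (C @` [set` A])%classic X by rewrite CA; left.
  by case=> j jA jX; exists j => //=; rewrite inE jA; apply/asboolP; rewrite jX.
have CA2 : (C @` [set` [set j in A | ~~ P1 j]%SET])%classic = shape_components S2.
  apply/seteqP; split=> [_ [j /= + <-]|X X2].
    by rewrite inE => /andP[/inA[h /asboolP//|//]].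
  have : (C @` [set` A])%classic X by rewrite CA; right.
  case=> j jA jX; exists j => //=; rewrite inE jA; apply/asboolP; rewrite jX.
  by move=> X1; apply: (components_disjoint ap X1).
have sub (Q : pred 'I_r) : {subset [set j in A | Q j]%SET <= A} by move=> j; rewrite inE => /andP[].
rewrite (IH (upper mu i) _ [set j in A | P1 j]%SET _ _ _ CA1); first 1 last.
- by rewrite size_upper //; lia.
- exact: upper_core.
- by move=> a b /sub aA /sub bA; apply: injC.
- by move=> j /sub; apply: tr.
rewrite (IH (lower mu i) _ [set j in A | ~~ P1 j]%SET _ _ _ CA2); first 1 last.
- by rewrite size_drop; lia.
- exact: lower_core.
- by move=> a b /sub aA /sub bA; apply: injC.
- by move=> j /sub; apply: tr.
rewrite [RHS](bigID P1) /=; congr (_ * _)%R; apply: eq_bigl => j; by rewrite inE.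
Qed.

End Blocks.

Theorem theorem2 (k : nat) (hk : (1 <= k)%N)
    (s : seq nat -> symfun) (hs : is_kschur k s)
    (mu : seq nat) (hmu : is_core k.+1 mu) (hsplit : splits k mu)
    (r : nat) (rho : 'I_r -> seq nat) (hrho : core_components k mu rho) :
  s (core_to_bounded k mu) = \prod_(i < r) s (core_to_bounded k (rho i)).
Proof.
case: k hk hs hmu hsplit hrho => // k _ hs hmu _ [C [injC rC tr]].
rewrite (kschur_components hs (v := (0, 0)%N) (C := C) (rho := rho) (A := [set: 'I_r]%SET)) //.
- by apply: eq_bigl => i; rewrite inE.
- by move=> i j _ _; apply: injC.
have -> : (shift (0, 0)%N @` boundary k.+1 mu)%classic = boundary k.+1 mu.
  rewrite -[RHS]image_id; apply: eq_imagel => -[a b] _; by rewrite /shift /= !add0n.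
by rewrite -rC; congr (_ @` _)%classic; apply/seteqP; split=> i //= _; rewrite inE.
Qed.
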